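(* For every integer $d\geq 1$ (with $m\geq 1$ the integer determined by $d=2m-1$ or $d=2m$), $$e_{\mathrm{HK}}(R_{2,d})=\begin{cases}\dfrac{2^m}{2^m-1} & (d=2m-1)\\[2mm] \dfrac{2^m+1}{2^m} & (d=2m)\end{cases}\qquad\text{and}\qquad e_{\mathrm{HK}}(S_{2,d})=\begin{cases}\dfrac{2^{m-1}+1}{2^{m-1}} & (d=2m-1)\\[2mm] \dfrac{2^{m+1}+1}{2^{m+1}-1} & (d=2m),\end{cases}$$ and $$e_{\mathrm{HK}}(R_{3,d})=1+\frac{3\cdot 2^d}{3^{d+1}-2^d+(-1)^d}\qquad\text{and}\qquad e_{\mathrm{HK}}(S_{3,d})=1+\left(\frac{2}{3}\right)^{d-1}.$$
   Context: For a Noetherian local ring $(R,\mathfrak{m})$ of prime characteristic $p$ and dimension $d$, let $\mathfrak{m}^{[p^e]}=(a^{p^e}:a\in\mathfrak{m})$, $\mathrm{HK}_e(R)=\operatorname{length}_R(R/\mathfrak{m}^{[p^e]})$, and $e_{\mathrm{HK}}(R)=\lim_{e\to\infty}\mathrm{HK}_e(R)/p^{ed}$ (the Hilbert–Kunz multiplicity; the limit exists). The $A_1$ singularity is $R_{p,d}=\mathbb{F}_p[[x_0,\dots,x_d]]/(Q_d)$, where $Q_d=x_0x_1+x_2x_3+\dots+x_{d-1}x_d$ if $d$ is odd and $Q_d=x_0x_1+\dots+x_{d-2}x_{d-1}+x_d^2$ if $d$ is even. The $A_2$ singularity is $S_{p,d}=\mathbb{F}_p[[x_0,\dots,x_d]]/(P_d)$,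 where $P_d=x_0x_1+\dots+x_{d-3}x_{d-2}+x_{d-1}^2+x_d^3$ if $d$ is odd (so $P_1=x_0^2+x_1^3$) and $P_d=x_0x_1+\dots+x_{d-2}x_{d-1}+x_d^3$ if $d$ is even. *)

(* Defs.v *)
From HB Require Import structures.
From mathcomp Require Import all_boot all_order all_algebra.
From mathcomp Require Import all_classical all_reals all_analysis.
From mathcomp Require Export ring_quotient.

Set Implicit Arguments.
Unset Strict Implicit.
Unset Printing Implicit Defensive.

Import Order.TTheory GRing.Theory Num.Theory.
Import numFieldNormedType.Exports.

Local Open Scope classical_set_scope.
Local Open Scope ring_scope.

(* The exponent a stands for the monomial \prod_i x_i ^ (a i). *)
Definition expo (n : nat) := {ffun 'I_n -> nat}.

Definition expo0 n : expo n := [ffun=> 0%N].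
Definition expo1 n (i : 'I_n) : expo n := [ffun j => (j == i) : nat].
Definition expo_add n (a b : expo n) : expo n := [ffun i => a i + b i]%N.
Definition expo_sub n (a b : expo n) : expo n := [ffun i => a i - b i]%N.
Definition expo_le n (a b : expo n) : bool := [forall i, a i <= b i]%N.

(* The exponents below m; 'I_(\max_j m j).+1 only serves to have a finite     *)
(* type to enumerate.                                                         *)
Definition expo_below n (m : expo n) : seq (expo n) :=
  [seq a <- [seq [ffun i => a i : nat]
              | a : {ffun 'I_n -> 'I_(\max_(j < n) m j).+1}] | expo_le a m].

Lemma mem_expo_below n (m a : expo n) : (a \in expo_below m) = expo_le a m.
Proof.
rewrite mem_filter; case: (boolP (expo_le a m)) => //= /forallP lam.
have lt i : (a i < (\max_(j < n) m j).+1)%N.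
  by rewrite ltnS (leq_trans (lam i)) // (leq_bigmax i).
apply/mapP; exists [ffun i => Ordinal (lt i)]; first by rewrite mem_enum.
by apply/ffunP => i; rewrite !ffunE.
Qed.

Lemma expo_below_uniq n (m : expo n) : uniq (expo_below m).
Proof.
apply/filter_uniq; rewrite map_inj_uniq ?enum_uniq // => a b /ffunP eab.
by apply/ffunP => i; apply/val_inj; have := eab i; rewrite !ffunE.
Qed.

Lemma expo_subK n (m a : expo n) :
  expo_le a m -> expo_sub m (expo_sub m a) = a.
Proof. by move=> /forallP am; apply/ffunP => i; rewrite !ffunE subKn. Qed.

Lemma expo_below_le n (m c : expo n) : expo_le c m ->
  perm_eq (expo_below c) [seq a <- expo_below m | expo_le a c].
Proof.
move=> /forallP cm; apply: uniq_perm.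
- exact: expo_below_uniq.
- exact/filter_uniq/expo_below_uniq.
move=> a; rewrite mem_expo_below mem_filter mem_expo_below andb_idr // => /forallP ac.
by apply/forallP => i; rewrite (leq_trans (ac i)).
Qed.

Lemma expo_below_sub n (m : expo n) :
  perm_eq [seq expo_sub m a | a <- expo_below m] (expo_below m).
Proof.
have le_sub a : expo_le (expo_sub m a) m.
  by apply/forallP => i; rewrite ffunE leq_subr.
apply: uniq_perm; last 1 first.
- move=> a; rewrite mem_expo_below; apply/mapP/idP => [[b _ ->] //|am].
  by exists (expo_sub m a); rewrite ?expo_subK ?mem_expo_below.
- rewrite map_inj_in_uniq ?expo_below_uniq // => a b.
  by rewrite !mem_expo_below => /expo_subK {2}<- /expo_subK {2}<- ->.
- exact: expo_below_uniq.
Qed.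

Lemma expo_below_shift n (m b : expo n) : expo_le b m ->
  perm_eq [seq a <- expo_below m | expo_le b a]
          [seq expo_add b c | c <- expo_below (expo_sub m b)].
Proof.
move=> /forallP bm; apply: uniq_perm.
- exact/filter_uniq/expo_below_uniq.
- rewrite map_inj_uniq ?expo_below_uniq // => c c' /ffunP e.
  by apply/ffunP => i; have := e i; rewrite !ffunE => /addnI.
- move=> a; rewrite mem_filter mem_expo_below; apply/andP/mapP.
    move=> [/forallP ba /forallP am]; exists (expo_sub a b).
      by rewrite mem_expo_below; apply/forallP => i; rewrite !ffunE leq_sub2r.
    by apply/ffunP => i; rewrite !ffunE subnKC.
  move=> [c]; rewrite mem_expo_below => /forallP cm ->.
  split; apply/forallP => i; rewrite !ffunE ?leq_addr //.
  by have := cm i; rewrite ffunE leq_subRL.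
Qed.

Record mpseries (n : nat) (K : Type) := MPSeries { coefps : expo n -> K }.

HB.instance Definition _ n K := gen_eqMixin (mpseries n K).
HB.instance Definition _ n K := gen_choiceMixin (mpseries n K).

Section MPSeriesRing.
Variables (n : nat) (K : comNzRingType).
Local Notation S := (mpseries n K).
Implicit Types f g h : S.

Definition mps_zero : S := MPSeries (fun=> 0).
Definition mps_one : S := MPSeries (fun m => (m == expo0 n)%:R).
Definition mps_opp f : S := MPSeries (fun m => - coefps f m).
Definition mps_add f g : S := MPSeries (fun m => coefps f m + coefps g m).
Definition mps_mul f g : S :=
  MPSeries (fun m =>
    \sum_(a <- expo_below m) coefps f a * coefps g (expo_sub m a)).

Lemma mpsP f g : (forall m, coefps f m = coefps g m) -> f = g.
Proof. by case: f g => f [g] /= /funext ->. Qed.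

Lemma mps_addA : associative mps_add.
Proof. by move=> f g h; apply/mpsP => m /=; rewrite addrA. Qed.
Lemma mps_addC : commutative mps_add.
Proof. by move=> f g; apply/mpsP => m /=; rewrite addrC. Qed.
Lemma mps_add0 : left_id mps_zero mps_add.
Proof. by move=> f; apply/mpsP => m /=; rewrite add0r. Qed.
Lemma mps_addN : left_inverse mps_zero mps_opp mps_add.
Proof. by move=> f; apply/mpsP => m /=; rewrite addNr. Qed.

HB.instance Definition _ :=
  GRing.isZmodule.Build S mps_addA mps_addC mps_add0 mps_addN.

Lemma mps_mulC : commutative mps_mul.
Proof.
move=> f g; apply/mpsP => m /=.
rewrite -(perm_big _ (expo_below_sub m)) big_map /= [LHS]big_seq [RHS]big_seq.
apply: eq_bigr => a; rewrite mem_expo_below => am.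
by rewrite mulrC expo_subK.
Qed.

Lemma mps_mulA : associative mps_mul.
Proof.
move=> f g h; apply/mpsP => m /=; symmetry.
transitivity (\sum_(c <- expo_below m) \sum_(a <- expo_below m | expo_le a c)
    coefps f a * coefps g (expo_sub c a) * coefps h (expo_sub m c)).
  rewrite [LHS]big_seq [RHS]big_seq; apply: eq_bigr => c.
  rewrite mem_expo_below => cm; rewrite mulr_suml -[RHS]big_filter.
  by apply: perm_big; rewrite expo_below_le.
rewrite (exchange_big_dep predT) //= [LHS]big_seq [RHS]big_seq.
apply: eq_bigr => a; rewrite mem_expo_below => am.
rewrite -big_filter (perm_big _ (expo_below_shift am)) big_map mulr_sumr.
apply: eq_bigr => b _; rewrite mulrA; congr (_ * coefps g _ * coefps h _).
  by apply/ffunP => i; rewrite !ffunE addKn.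
by apply/ffunP => i; rewrite !ffunE subnDA.
Qed.

Lemma expo_below0 : expo_below (expo0 n) = [:: expo0 n].
Proof.
apply: perm_small_eq => //; apply: uniq_perm => // [|a].
  exact: expo_below_uniq.
rewrite mem_expo_below inE; apply/forallP/eqP => [a0|-> i] //.
by apply/ffunP => i; have := a0 i; rewrite !ffunE leqn0 => /eqP.
Qed.

Lemma mps_mul1 : left_id mps_one mps_mul.
Proof.
move=> f; apply/mpsP => m /=.
rewrite (bigD1_seq (expo0 n)) ?expo_below_uniq //=; last first.
  by rewrite mem_expo_below; apply/forallP => i; rewrite ffunE.
rewrite eqxx mul1r big1 ?addr0 => [|a /negPf ->]; last by rewrite mul0r.
by congr coefps; apply/ffunP => i; rewrite !ffunE subn0.
Qed.

Lemma mps_mulDl : left_distributive mps_mul mps_add.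
Proof.
move=> f g h; apply/mpsP => m /=; rewrite -big_split.
by apply: eq_bigr => a _; rewrite mulrDl.
Qed.

Lemma mps_oner_neq0 : mps_one != 0.
Proof.
apply/eqP => /(congr1 (fun f => coefps f (expo0 n))) /=.
by rewrite eqxx; apply/eqP/oner_neq0.
Qed.

HB.instance Definition _ := GRing.Zmodule_isComNzRing.Build S
  mps_mulA mps_mulC mps_mul1 mps_mulDl mps_oner_neq0.

Definition mpsX (i : 'I_n) : S := MPSeries (fun m => (m == expo1 i)%:R).

Definition const_term f : K := coefps f (expo0 n).
Arguments const_term : simpl never.

Lemma const_term_is_zmod_morphism : zmod_morphism const_term.
Proof. by []. Qed.

Lemma const_term_is_monoid_morphism : monoid_morphism const_term.
Proof.
rewrite /const_term; split=> [|f g] /=; first by rewrite eqxx.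
rewrite expo_below0 big_seq1; congr (_ * coefps g _).
by apply/ffunP => i; rewrite !ffunE.
Qed.

HB.instance Definition _ :=
  GRing.isZmodMorphism.Build S K const_term const_term_is_zmod_morphism.
HB.instance Definition _ :=
  GRing.isMonoidMorphism.Build S K const_term const_term_is_monoid_morphism.

Lemma const_termX i : const_term (mpsX i) = 0.
Proof.
rewrite /const_term /=; case: eqP => // /ffunP/(_ i).
by rewrite !ffunE eqxx.
Qed.

(* K[[x_0, ..., x_(n-1)]] / (f); the constant term of f has to vanish for the *)
(* ideal to be proper.                                                        *)
Section Hypersurface.
Variables (f : S) (f0 : const_term f = 0).

Definition mps_principal of const_term f = 0 : {pred S} :=
  fun g => `[< exists h, g = h * f >].

Lemma mps_principal_ideal : idealr_closed (mps_principal f0).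
Proof.
split=> [||a u v].
- by apply/asboolP; exists 0; rewrite mul0r.
- apply/asboolP => -[h] /(congr1 const_term).
  by rewrite rmorphM rmorph1 /= f0 mulr0; apply/eqP/oner_neq0.
move=> /asboolP[g ->] /asboolP[h ->]; apply/asboolP; exists (a * g + h).
by rewrite mulrDl mulrA.
Qed.

HB.instance Definition _ := isIdealr.Build S (mps_principal f0)
  mps_principal_ideal.

Definition hypersurface : comNzRingType := {ideal_quot (mps_principal f0)}.

End Hypersurface.

End MPSeriesRing.

Arguments mpsX {n K} i.
Arguments const_term {n K} f : simpl never.


(* There are X_0 < X_1 < ... < X_n (n strict inclusions) satisfying P.        *)
Definition has_chain (T : Type) (P : set (set T)) (n : nat) : Prop :=
  exists X : nat -> set T,
    (forall i, (i <= n)%N -> P (X i)) /\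
    (forall i, (i < n)%N -> X i `<` X i.+1).

(* The supremum of the lengths of the chains in P is finite and equal to n.   *)
Definition sup_chain (T : Type) (P : set (set T)) (n : nat) : Prop :=
  has_chain P n /\ (forall k, has_chain P k -> (k <= n)%N).

Section CommutativeAlgebra.
Variable A : comNzRingType.

(* idealr_closed includes 1 \notin I. *)
Definition is_proper_ideal (I : set A) : Prop := idealr_closed [in I].

Definition is_prime_ideal (I : set A) : Prop :=
  is_proper_ideal I /\ prime_idealr_closed [in I].

Definition is_maximal_ideal (I : set A) : Prop :=
  is_proper_ideal I /\
  (forall J : set A, is_proper_ideal J -> I `<=` J -> J = I).

Definition is_local (m : set A) : Prop :=
  is_maximal_ideal m /\ (forall m', is_maximal_ideal m' -> m' = m).

Definition is_krull_dim (d : nat) : Prop := sup_chain is_prime_ideal d.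

Definition is_length (M : lmodType A) (n : nat) : Prop :=
  sup_chain (fun N : set M => submod_closed [in N]) n.

Definition span_set (M : lmodType A) (X : set M) : {pred M} :=
  fun u => `[< exists (k : nat) (c : 'I_k -> A) (x : 'I_k -> M),
    (forall i, X (x i)) /\ u = \sum_(i < k) c i *: x i >].

Lemma span_set_submod (M : lmodType A) (X : set M) : submod_closed (span_set X).
Proof.
split.
  apply/asboolP; exists 0%N, (fun=> 0), (fun=> 0).
  by split=> [[]//|]; rewrite big_ord0.
move=> a _ _ /asboolP[k [c [x [Xx ->]]]] /asboolP[l [b [y [Xy ->]]]].
apply/asboolP; exists (k + l)%N.
exists (fun i => match fintype.split i with inl j => a * c j | inr j => b j end).
exists (fun i => match fintype.split i with inl j => x j | inr j => y j end).
split=> [i|]; first by case: (fintype.split i).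
rewrite big_split_ord scaler_sumr; congr (_ + _); apply: eq_bigr => i _.
  by rewrite -[lshift _ _]/(unsplit (inl i)) unsplitK scalerA.
by rewrite -[rshift _ _]/(unsplit (inr i)) unsplitK.
Qed.

HB.instance Definition _ (M : lmodType A) (X : set M) :=
  GRing.isSubmodClosed.Build A M (span_set X) (span_set_submod X).

Section QuotientModule.
Variables (M : lmodType A) (X : set M).

Definition quot_module : Type := Quotient.quot (span_set X).
HB.instance Definition _ := GRing.Zmodule.on quot_module.

Local Notation piQ u := (\pi_(Quotient.quot (span_set X))%qT u : quot_module).

Definition quot_scale (a : A) (x : quot_module) : quot_module :=
  piQ (a *: (repr (x : Quotient.quot (span_set X)) : M)).

Lemma quot_scale_pi a u : quot_scale a (piQ u) = piQ (a *: u).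
Proof.
apply/eqP; rewrite -Quotient.idealrBE -scalerBr rpredZ //.
by rewrite Quotient.idealrBE reprK.
Qed.

Lemma piQD u v : piQ (u + v) = piQ u + piQ v.
Proof. exact: Quotient.pi_add. Qed.

Lemma piQ_ind (P : quot_module -> Prop) : (forall u, P (piQ u)) -> forall x, P x.
Proof. exact: quotW. Qed.

Lemma quot_scaleA a b x : quot_scale a (quot_scale b x) = quot_scale (a * b) x.
Proof. by elim/piQ_ind: x => u; rewrite !quot_scale_pi scalerA. Qed.

Lemma quot_scale1 : left_id 1 quot_scale.
Proof. by elim/piQ_ind => u; rewrite quot_scale_pi scale1r. Qed.

Lemma quot_scaleDr : right_distributive quot_scale +%R.
Proof.
move=> a x y; elim/piQ_ind: x => u; elim/piQ_ind: y => v.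
by rewrite -piQD !quot_scale_pi scalerDr piQD.
Qed.

Lemma quot_scaleDl x : {morph quot_scale^~ x : a b / a + b}.
Proof.
by elim/piQ_ind: x => u a b; rewrite !quot_scale_pi scalerDl piQD.
Qed.

HB.instance Definition _ := GRing.Zmodule_isLmodule.Build A quot_module
  quot_scaleA quot_scale1 quot_scaleDr quot_scaleDl.

End QuotientModule.

(* The A-module A / m^[q], where m^[q] is the ideal generated by the a ^+ q   *)
(* with a in m.                                                               *)
Definition mod_frobenius_power (m : set A) (q : nat) : lmodType A :=
  @quot_module A^o [set a ^+ q | a in m].

(* e_HK(A) = l, for A local of characteristic p. All the data (the maximal    *)
(* ideal m, the dimension d and the lengths HK e) are uniquely determined, so *)
(* l is the Hilbert-Kunz multiplicity, and the existence of the limit is part *)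
(* of the relation.                                                           *)
Definition is_hilbert_kunz_multiplicity (R : realType) (p : nat) (l : R) :=
  exists (m : set A) (d : nat) (HK : nat -> nat),
    [/\ p \in [pchar A], is_local m, is_krull_dim d,
        forall e, is_length (mod_frobenius_power m (p ^ e)) (HK e)
      & (fun e => (HK e)%:R / (p%:R ^+ (e * d)) : R) @ \oo --> l].

End CommutativeAlgebra.

Section Singularities.
Variables (p d : nat).
Local Notation S := (mpseries d.+1 'F_p).
Local Notation x i := (@mpsX d.+1 'F_p (inord i)).

(* uphalf d is m for both d = 2m - 1 and d = 2m.                              *)
Definition Q_poly : S :=
  \sum_(i < uphalf d) x i.*2 * x i.*2.+1
    + (if odd d then 0 else x d ^+ 2).

(* d./2 is m - 1 for d = 2m - 1, and m for d = 2m.                            *)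
Definition P_poly : S :=
  \sum_(i < d./2) x i.*2 * x i.*2.+1
    + (if odd d then x d.-1 ^+ 2 else 0) + x d ^+ 3.

Lemma Q_poly_const : const_term Q_poly = 0.
Proof.
rewrite rmorphD rmorph_sum big1 ?add0r => [|i _]; last first.
  by rewrite rmorphM /= const_termX mul0r.
by case: odd; rewrite ?rmorph0 // rmorphXn /= const_termX expr0n.
Qed.

Lemma P_poly_const : const_term P_poly = 0.
Proof.
rewrite !rmorphD rmorph_sum big1 ?add0r => [|i _]; last first.
  by rewrite rmorphM /= const_termX mul0r.
rewrite rmorphXn /= const_termX expr0n addr0.
by case: odd; rewrite ?rmorph0 // rmorphXn /= const_termX expr0n.
Qed.

Definition A1_singularity : comNzRingType := hypersurface Q_poly_const.
Definition A2_singularity : comNzRingType := hypersurface P_poly_const.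

End Singularities.

(* Main.v *)
From HB Require Import structures.
Require Import Defs.
From mathcomp Require Import all_boot all_order all_algebra.
From mathcomp Require Import all_classical all_reals all_analysis.
From mathcomp Require Import zify ring lra.

(** Fix [q = p^e] and a hypersurface ring [A = K[[x_0, ..., x_d]] / (f)]. As the
    Frobenius map is additive, [A / m^[q]] is the cokernel of [f] on
    [K[x_0, ..., x_d] / (x_0^q, ..., x_d^q)], so that its length is the dimension
    of the kernel. Let [T] act on this truncation as [f]: the length is the number
    of Jordan blocks of [T] ([hilbert_kunz_length]). Here [f] is a sum of
    polynomials [xy], [x^2], [x^3] in separate variables, so the truncation is a
    tensor product of [K[T]]-modules, where [T] acts by the Leibniz rule. The
    blocks of [xy] have the sizes [q, 1, ..., q-1, 1, ..., q-1] and those of [x^k]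
    have about the size [q/k], and the length is the sum, over all choices of one
    block in each factor, of the number [tblocks s] of blocks of a tensor product
    of blocks of sizes [s] ([nblocks_blocks]).

    The numbers [tblocks s] need not be known individually. For sizes at most
    [Q = p^(e+1)], the difference [excess Q s] between [tblocks s] and
    [(\prod s) / Q] vanishes when [Q] is one of the sizes, because a tensor product
    with a free [K[T] / T^Q]-module is free, and it does not change when two sizes
    [i, j] are replaced with [Q - i, Q - j] ([excess_reflection]). Moreover
    [tblocks (i :: s) = \prod s] as soon as [i] is at least [q] and all of [s] is
    at most [q] ([tblocksQ_full]), since [T^q] kills the product of the blocks [s].

    For [p = 2], the sizes of [xy] at [2q] are those at [q], their complements in
    [2q], and [2q]. Reflecting two factors at a time brings all the sizes down to
    at most [q], each step contributing a factor 2, until a single factor is left,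
    whose large sizes give products ([excess_xysizes_doubling]). So the length at
    [2q] is expressed by the length at [q]. For [p = 3], a linear change of
    variables turns [xy] into [x^2 - y^2], which has the same blocks as
    [x^2 + y^2], and everything is reduced to tensor powers of the module of [x^2].
    When [k] factors at [3q] are mixed with factors at [q], the same folding gives
    numbers with [t_(k+2) = t_(k+1) + 2 t_k], which are solved by the Jacobsthal
    numbers ([excess_tripling]). A cube contributes blocks that are free at level
    [q] when [p = 3], and blocks of size at most [q] when [p = 2].

    In all cases the lengths divided by [q^d] satisfy [u_(e+1) = a + r u_e] with
    [|r| < 1], and the multiplicity is [a / (1 - r)]
    ([hypersurface_hilbert_kunz]).

    It remains to see that the ring is local of dimension [d]. Chains of primes are
    bounded with Noether normalization for power series, Cayley-Hamilton and
    incomparability ([krull_le]). A chain of length [d] consists of kernels of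
    parametrizations: if [f = x_0 x_1 + g], substituting [t] for [x_1] and [t x_i]
    for the other variables makes [g] divisible by [t], so that [x_0] can be chosen
    to annihilate [f]; then the parameters are set to zero one by one
    ([pair_shape_krull]; the cusp has a parametrization of its own). All substitutions into power series, inverses, and the
    completed form of Nakayama's lemma are obtained by solving contracting
    equations ([solutionE]). *)

Set Implicit Arguments.
Unset Strict Implicit.
Unset Printing Implicit Defensive.

Import Order.TTheory GRing.Theory Num.Theory.
Import numFieldNormedType.Exports.
Local Open Scope ring_scope.

(** * Modules over K[T] and their Jordan blocks *)

Section EndoPowers.
Variables (K : fieldType) (V : vectType K).
Implicit Types (a b T : 'End(V)) (U : {vspace V}).

Definition endopow T i : 'End(V) := iter i (comp_lfun T) \1%VF.

Lemma endopowE T i v : endopow T i v = iter i T v.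
Proof. by elim: i => [|i IH]; rewrite /= ?id_lfunE // comp_lfunE IH. Qed.

Lemma endopow_add T i j : endopow T (i + j) = (endopow T i \o endopow T j)%VF.
Proof. by apply/lfunP => v; rewrite comp_lfunE !endopowE iterD. Qed.

Lemma dim_ker_comp (f g : 'End(V)) :
  (\dim (lker (f \o g)%VF) <= \dim (lker f) + \dim (lker g))%N.
Proof.
rewrite -(limg_ker_dim g (lker (f \o g)%VF)) addnC leq_add //.
  apply/dimvS/subvP => _ /memv_imgP [v + ->].
  by rewrite !memv_ker comp_lfunE.
by apply/dimvS; rewrite capvSr.
Qed.

Lemma ker_endopow_le T r i : (\dim (lker T) <= r)%N -> (\dim (lker (endopow T i)) <= i * r)%N.
Proof.
move=> Tr; elim: i => [|i IH].
  rewrite mul0n leqn0 dimv_eq0; apply/eqP/vspaceP => v.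
  by rewrite memv_ker endopowE memv0.
by rewrite (leq_trans (dim_ker_comp _ _)) // mulSn leq_add.
Qed.

(** [V] is free over [K[T] / T^Q]: equality holds in [ker_endopow_le] at [Q],
    hence at every exponent. *)
Lemma ker_endopow_free T r Q : (forall v, iter Q T v = 0) -> (\dim (lker T) <= r)%N ->
    \dim {:V} = (Q * r)%N -> forall i, (i <= Q)%N ->
  \dim (lker (endopow T i)) = (i * r)%N /\ lker (endopow T i) = limg (endopow T (Q - i)).
Proof.
move=> TQ Tr dV.
have kQ : lker (endopow T Q) = fullv.
  by apply/vspaceP => v; rewrite memv_ker endopowE TQ eqxx memvf.
have dk i : (i <= Q)%N -> \dim (lker (endopow T i)) = (i * r)%N.
  move=> iQ; apply/eqP; rewrite eqn_leq ker_endopow_le //=.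
  have := dim_ker_comp (endopow T i) (endopow T (Q - i)).
  rewrite -endopow_add subnKC // kQ dV => h.
  have := ker_endopow_le (Q - i) Tr; rewrite mulnBl.
  have : (i * r <= Q * r)%N by rewrite leq_mul.
  lia.
move=> i iQ; split; first exact: dk.
apply/eqP; rewrite eq_sym eqEdim; apply/andP; split.
  apply/subvP => _ /memv_imgP [v _ ->].
  by rewrite memv_ker -comp_lfunE -endopow_add subnKC // endopowE TQ.
have := limg_ker_dim (endopow T (Q - i)) fullv.
rewrite capfv dV !dk ?leq_subr // mulnBl.
have : (i * r <= Q * r)%N by rewrite leq_mul.
lia.
Qed.

(** Both terms concern [V / (im a^i + im b^j)]: applying [a^(Q-i)], whose kernel
    is [im a^i], turns it into the cokernel of [b^j] on [ker a^i], and the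
    cokernel and the kernel of one endomorphism have the same dimension. *)
Lemma coker_ker_free a b Q i j : (forall v, a (b v) = b (a v)) -> (i <= Q)%N ->
    (forall k, (k <= Q)%N -> lker (endopow a k) = limg (endopow a (Q - k))) ->
  (\dim (limg (endopow a i) + limg (endopow b j)) + \dim (lker (endopow a i) :&: lker (endopow b j))
   = \dim {:V})%N.
Proof.
move=> ab iQ aQ.
have abn n k v : iter n a (iter k b v) = iter k b (iter n a v).
  elim: n => //= n ->; move: (iter n a v) => w.
  by elim: k => //= k <-; rewrite ab.
pose f := endopow a (Q - i).
have kf : lker f = limg (endopow a i) by rewrite aQ ?leq_subr // subKn.
have imf : limg f = lker (endopow a i) by rewrite aQ.
have := limg_ker_dim f (limg (endopow a i) + limg (endopow b j))%VS.
rewrite limgD -{2}kf.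
have -> : (f @: lker f = 0)%VS by apply/eqP; rewrite -lkerE.
rewrite add0v (_ : (_ :&: _)%VS = limg (endopow a i)); last first.
  by rewrite kf; apply/capv_idPr/addvSl.
have -> : (f @: limg (endopow b j) = endopow b j @: lker (endopow a i))%VS.
  rewrite -imf -!limg_comp; apply/eq_in_limg => v _.
  by rewrite !comp_lfunE !endopowE abn.
have := limg_ker_dim (endopow b j) (lker (endopow a i)).
have := limg_ker_dim (endopow a i) fullv; rewrite capfv.
lia.
Qed.

(** By freeness, the kernels of [a^(Q-i)] and [b^(Q-j)] are the images of [a^i] and
    [b^j]; the dimension of their intersection is that of their sum up to known
    terms, and the sum is computed by [coker_ker_free]. *)
Lemma ker_reflection a b r Q i j : (forall v, a (b v) = b (a v)) ->
    (forall v, iter Q a v = 0) -> (\dim (lker a) <= r)%N ->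
    (forall v, iter Q b v = 0) -> (\dim (lker b) <= r)%N ->
    \dim {:V} = (Q * r)%N -> (i <= Q)%N -> (j <= Q)%N ->
  (\dim (lker (endopow a (Q - i)) :&: lker (endopow b (Q - j))) + (i + j) * r
   = \dim (lker (endopow a i) :&: lker (endopow b j)) + Q * r)%N.
Proof.
move=> ab aQ ar bQ excess dV iQ jQ.
have fa := ker_endopow_free aQ ar dV; have fb := ker_endopow_free bQ excess dV.
have /= := coker_ker_free j ab iQ (fun k kQ => (fa k kQ).2).
have := dimv_sum_cap (limg (endopow a i)) (limg (endopow b j)).
have := (fa _ (leq_subr i Q)).2; have := (fb _ (leq_subr j Q)).2.
rewrite !subKn // => -> ->; rewrite dV.
have := limg_ker_dim (endopow a i) fullv; have := limg_ker_dim (endopow b j) fullv.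
rewrite !capfv dV (fa _ iQ).1 (fb _ jQ).1 mulnDl; lia.
Qed.

End EndoPowers.

Section KModules.
Variable K : fieldType.

(** A finite-dimensional module over [K[T]]. *)
Record kmod := KMod { kcar : vectType K; kop : 'End(kcar) }.

Implicit Types X Y Z : kmod.

(** For a nilpotent operator, each Jordan block meets the kernel in a line. *)
Definition nblocks X := \dim (lker (kop X)).

Definition kiso X Y := exists g : 'Hom(kcar X, kcar Y),
  [/\ lker g == 0%VS, limg g = fullv & forall v, g (kop X v) = kop Y (g v)].

Lemma kisoI X Y (g : kcar X -> kcar Y) (h : kcar Y -> kcar X) : linear g ->
  cancel g h -> cancel h g -> (forall v, g (kop X v) = kop Y (g v)) -> kiso X Y.
Proof.
move=> lg gh hg gT.
pose gL : {linear _ -> _} := HB.pack g (GRing.isLinear.Build _ _ _ _ g lg).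
have E : linfun gL =1 g by move=> v; rewrite lfunE.
exists (linfun gL); split=> [||v].
- by apply/lker0P => u v; rewrite !E => /(can_inj gh).
- apply/vspaceP => w; rewrite memvf; apply/memv_imgP.
  by exists (h w); rewrite ?memvf // E hg.
- by rewrite !E gT.
Qed.

Lemma kiso_refl X : kiso X X.
Proof. by apply: (@kisoI X X id id). Qed.

Lemma kiso_trans Y X Z : kiso X Y -> kiso Y Z -> kiso X Z.
Proof.
move=> [g [kg ig cg]] [h [kh ih ch]]; exists (h \o g)%VF; split.
- apply/lker0P => u v; rewrite !comp_lfunE => /(elimT lker0P kh).
  exact: (elimT lker0P kg).
- by rewrite limg_comp ig ih.
- by move=> v; rewrite !comp_lfunE cg ch.
Qed.

Lemma nblocks_iso X Y : kiso X Y -> nblocks X = nblocks Y.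
Proof.
move=> [g [kg ig cg]]; rewrite /nblocks -(limg_dim_eq (f := g)); last first.
  by rewrite (eqP kg) capv0.
congr (\dim _); apply/vspaceP => w; rewrite memv_ker.
have /memv_imgP [v _ ->] : w \in limg g by rewrite ig memvf.
rewrite -cg; apply/memv_imgP/eqP => [[u + /(elimT lker0P kg) ->]|].
  by rewrite memv_ker => /eqP ->; rewrite linear0.
move=> /eqP; rewrite -[0](linear0 g) => /eqP /(elimT lker0P kg) v0.
by exists v; rewrite // memv_ker v0.
Qed.

Section Tensor.
Variables (I : finType) (phi : I -> option I) (c : K) (X : kmod).

(** The tensor product of [X] with the module of basis [I] where [T] maps the basis
    vector [k] to [c] times the basis vector [phi k], or to zero; [T] acts by the
    Leibniz rule. *)
Definition tens_fun (v : {ffun I -> kcar X}) : {ffun I -> kcar X} :=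
  [ffun i => kop X (v i) + c *: \sum_(k | phi k == Some i) v k].

Lemma tens_fun_linear : linear tens_fun.
Proof.
move=> x u v; apply/ffunP => i; rewrite !ffunE linearP /= scalerDr addrACA.
congr (_ + _); rewrite scalerA mulrC -scalerA -scalerDr; congr (_ *: _).
rewrite scaler_sumr -big_split; apply: eq_bigr => k _; rewrite !ffunE //.
Qed.

HB.instance Definition _ :=
  GRing.isLinear.Build K _ _ _ tens_fun tens_fun_linear.

Definition tens : kmod := KMod (linfun tens_fun).

Lemma tensE v i : kop tens v i = kop X (v i) + c *: \sum_(k | phi k == Some i) v k.
Proof. by rewrite lfunE /= ffunE. Qed.

End Tensor.

End KModules.

Section Strings.
Variables (K : fieldType) (I E : finType) (phi : I -> option I) (c : K).
Variables (X : kmod K) (g : E -> nat -> I) (len : E -> nat).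
Hypothesis c0 : c != 0.
Hypothesis gS : forall i, exists ej : E * nat, (ej.2 < len ej.1)%N /\ i = g ej.1 ej.2.
Hypothesis gI : forall e j e' j', (j < len e)%N -> (j' < len e')%N ->
  g e j = g e' j' -> e = e' /\ j = j'.
Hypothesis phiE : forall e j, (j < len e)%N ->
  phi (g e j) = if (j.+1 < len e)%N then Some (g e j.+1) else None.

Local Notation T := (kop X).

Lemma string_op v e j : (j < len e)%N ->
  kop (tens phi c X) v (g e j) =
  T (v (g e j)) + (if j is j'.+1 then c *: v (g e j') else 0).
Proof.
move=> je; rewrite tensE; congr (_ + _).
have pre k : phi k == Some (g e j) -> exists2 j', j = j'.+1 & k = g e j'.
  have [[e1 j1] /= [j1e ->]] := gS k; rewrite phiE //.
  case: ifP => // j1e' /eqP [eq]; have [ee jj] := gI j1e' je eq.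
  by exists j1; rewrite // -ee.
case: j je pre => [|j] je pre.
  by rewrite big_pred0 ?scaler0 // => k; apply/negP => /pre [].
rewrite (big_pred1 (g e j)) // => k; apply/idP/eqP => [/pre [j' [->]]|->] //=.
by rewrite phiE ?je ?eqxx // ltnW.
Qed.

(** When [phi] moves the basis along strings, the equation for the kernel expresses
    every coordinate on a string by the next one, hence by the last one; the first
    coordinate then has to be killed by [T], and so the last one by [T^len]. *)
Lemma nblocks_strings :
  nblocks (tens phi c X) = (\sum_e \dim (lker (endopow T (len e))))%N.
Proof.
have /choice [s hs] := gS.
pose eo i := (s i).1; pose jo i := (s i).2.
have eoE e j : (j < len e)%N -> (eo (g e j) = e) * (jo (g e j) = j).
  move=> je; have [lt eq] := hs (g e j); have [e1 e2] := gI je lt eq.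
  by split; apply: esym.
pose a := - c^-1.
pose Psi e (x : kcar X) : {ffun I -> kcar X} := [ffun i => if eo i == e then
  a ^+ (len e - (jo i).+1) *: endopow T (len e - (jo i).+1) x else 0].
have lPsi e : linear (Psi e).
  move=> k u v; apply/ffunP => i; rewrite !ffunE; case: eqP => _; last first.
    by rewrite scaler0 addr0.
  by rewrite linearP /= scalerDr !scalerA mulrC.
pose P e : {linear kcar X -> {ffun I -> kcar X}} :=
  HB.pack (Psi e) (GRing.isLinear.Build _ _ _ _ (Psi e) (lPsi e)).
have PE e x : linfun (P e) x = Psi e x by rewrite lfunE.
pose U e := lker (endopow T (len e)).
have PsiE e j x e' : (j < len e)%N ->
    Psi e' x (g e j) =
    if e == e' then a ^+ (len e - j.+1) *: endopow T (len e - j.+1) x else 0.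
  by move=> je; rewrite ffunE !(eoE e j je); case: eqP => // ->.
have dsum : directv (\sum_e (linfun (P e) @: U e)).
  apply/directv_sum_independent => us usU us0 e _.
  have {}usU e' : exists x, us e' = Psi e' x.
    by have /memv_imgP [x _ ->] := usU e' isT; exists x; rewrite PE.
  apply/ffunP => i; have [[e1 j1] /= [j1e ->]] := gS i.
  rewrite [RHS]ffunE; have [x ux] := usU e; rewrite ux PsiE //.
  case: eqP => // ee; move/ffunP/(_ (g e1 j1)): us0.
  rewrite sum_ffunE ffunE (bigD1 e) //= big1 => [|e' ne].
    by rewrite addr0 ux PsiE // ee eqxx.
  have [y ->] := usU e'; rewrite PsiE // ee.
  by rewrite eq_sym (negPf ne).
rewrite /nblocks (_ : lker _ = (\sum_e (linfun (P e) @: U e))%VS); last first.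
  apply/vspaceP => v; apply/idP/idP; last first.
    move: v; apply/subvP/subv_sumP => e _; apply/subvP => _ /memv_imgP [x + ->].
    rewrite PE !memv_ker endopowE => /eqP x0; apply/eqP/ffunP => i.
    have [[e1 j1] /= [j1e ->]] := gS i; rewrite string_op // [RHS]ffunE PsiE //.
    case: eqP => [ee|ne]; last first.
      case: j1 j1e => [|j1] j1e; first by rewrite linear0 addr0.
      by rewrite PsiE ?(ltnW j1e) //; case: eqP => // _; rewrite linear0 scaler0 addr0.
    case: j1 j1e => [|j1] j1e.
      rewrite addr0 linearZ /= endopowE -iterS subn1 prednK; last by case: (len e1) j1e.
      by rewrite ee x0 scaler0.
    rewrite PsiE ?(ltnW j1e) // ee eqxx scalerA.
    have -> : (len e - j1.+1 = (len e - j1.+2).+1)%N by rewrite ee in j1e; lia.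
    rewrite linearZ /= comp_lfunE exprS mulrA mulrN mulfV // mulN1r.
    by rewrite scaleNr subrr.
  rewrite memv_ker => /eqP v0.
  have step e j : (j.+1 < len e)%N -> v (g e j) = a *: T (v (g e j.+1)).
    move=> je; move/ffunP/(_ (g e j.+1)): v0; rewrite string_op // [RHS]ffunE.
    move=> /eqP; rewrite addr_eq0 => /eqP ->.
    by rewrite /a scalerN scaleNr opprK scalerA mulVf // scale1r.
  have stepn e k j : (j + k < len e)%N ->
      v (g e j) = a ^+ k *: iter k T (v (g e (j + k)%N)).
    elim: k j => [|k IH] j jk; first by rewrite addn0 expr0 scale1r.
    rewrite step ?(leq_ltn_trans _ jk) //; last by lia.
    rewrite IH; last by rewrite addSnnS.
    by rewrite addSnnS linearZ /= scalerA exprS.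
  pose w e := v (g e (len e).-1).
  pose x e := if (0 < len e)%N then w e else 0.
  have -> : v = \sum_e Psi e (x e).
    apply/ffunP => i; have [[e j] /= [je ->]] := gS i.
    rewrite sum_ffunE (bigD1 e) //= big1 => [|e' ne]; last first.
      by rewrite PsiE // eq_sym (negPf ne).
    rewrite addr0 PsiE // eqxx /x (leq_ltn_trans _ je) // endopowE /w.
    by rewrite (stepn e (len e - j.+1)%N j); [congr (_ *: iter _ _ (v (g e _))) | ]; lia.
  apply: memv_sumr => e _; rewrite -PE; apply: memv_img.
  rewrite memv_ker endopowE /x; case: ifP => [l0|]; last first.
    by case: (len e).
  move/ffunP/(_ (g e 0%N)): (v0); rewrite string_op // addr0 [RHS]ffunE.
  rewrite (stepn e (len e).-1 0%N) ?prednK // add0n linearZ /= -iterS prednK //.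
  move=> /eqP; rewrite scaler_eq0 => /orP [|//].
  by rewrite expf_eq0 oppr_eq0 invr_eq0 (negPf c0) andbF.
rewrite (directvP dsum) /=; apply: eq_bigr => e _; apply: limg_dim_eq.
apply/eqP; rewrite -subv0; apply/subvP => x; rewrite memv_cap memv0 !memv_ker endopowE PE.
move=> /andP [x0 /eqP/ffunP P0].
case: (posnP (len e)) => l0; first by move: x0; rewrite l0.
have := P0 (g e (len e).-1); rewrite PsiE ?prednK // eqxx subnn expr0 scale1r.
by rewrite endopowE [RHS]ffunE => /= ->.
Qed.

End Strings.

Section TensorTheory.
Variable K : fieldType.
Implicit Types (X Y Z : kmod K) (c d : K) (s : seq nat).

Lemma tens_iso (I : finType) (phi : I -> option I) c X Y :
  kiso X Y -> kiso (tens phi c X) (tens phi c Y).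
Proof.
move=> [g [kg ig cg]].
have gK : cancel g g^-1%VF by apply: lker0_lfunK.
have gVK : cancel g^-1%VF g by move=> w; apply: limg_lfunVK; rewrite ig memvf.
apply: (@kisoI _ (tens phi c X) (tens phi c Y)
         (fun v => [ffun i => g (v i)]) (fun v => [ffun i => (g^-1)%VF (v i)])).
- by move=> k u v; apply/ffunP => i; rewrite !ffunE linearP.
- by move=> v; apply/ffunP => i; rewrite !ffunE gK.
- by move=> v; apply/ffunP => i; rewrite !ffunE gVK.
move=> v; apply/ffunP => i; rewrite ffunE !tensE linearD linearZ linear_sum ffunE -cg.
by congr (_ + _ *: _); apply: eq_bigr => k _; rewrite ffunE.
Qed.

Lemma tens_swap (I J : finType) (phi : I -> option I) (psi : J -> option J) c d X :
  kiso (tens phi c (tens psi d X)) (tens psi d (tens phi c X)).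
Proof.
apply: (@kisoI _ (tens phi c (tens psi d X)) (tens psi d (tens phi c X))
         (fun v : {ffun I -> {ffun J -> kcar X}} => [ffun j => [ffun i => v i j]])
         (fun v : {ffun J -> {ffun I -> kcar X}} => [ffun i => [ffun j => v j i]])).
- by move=> k u v; apply/ffunP => i; apply/ffunP => j; rewrite !ffunE.
- by move=> v; apply/ffunP => i; apply/ffunP => j; rewrite !ffunE.
- by move=> v; apply/ffunP => i; apply/ffunP => j; rewrite !ffunE.
move=> v; apply/ffunP => j; apply/ffunP => i.
rewrite 2!ffunE (@tensE _ _ _ _ (tens psi d X)) (@tensE _ _ _ _ (tens phi c X)).
rewrite !ffunE !tensE !sum_ffunE !ffunE -!addrA; congr (_ + _).
rewrite addrC; congr (_ *: _ + _ *: _); apply: eq_bigr => k _; rewrite !ffunE //.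
Qed.

Lemma dim_tens (I : finType) (phi : I -> option I) c X :
  \dim {:kcar (tens phi c X)} = (#|I| * \dim {:kcar X})%N.
Proof. by rewrite !dimvf. Qed.

(** The tensor product with a Jordan block of size [i]. *)
Definition delta i X : kmod K := tens (fun k : 'I_i => insub k.+1) 1 X.

(** Multiplication by [x^k] on the monomials of [K[x] / x^q]. *)
Definition powstep k q (a : 'I_q) : option 'I_q := insub (a + k)%N.

(** The strings are the residue classes modulo [k]. *)
Lemma nblocks_pow k q c X : c != 0 -> (0 < k)%N -> (0 < q)%N ->
  nblocks (tens (@powstep k q) c X) =
  (\sum_(r <- iota 0 k) \dim (lker (endopow (kop X) ((q + (k.-1 - r)) %/ k))))%N.
Proof.
move=> c0 k0; case: q => // q _.
have lt (r : 'I_k) j : (j < (q.+1 + (k.-1 - r)) %/ k)%N = (r + j * k < q.+1)%N.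
  by rewrite leq_divRL // mulSn; have := ltn_ord r; lia.
rewrite (@nblocks_strings K _ 'I_k (@powstep k q.+1) c X
  (fun r j => inord (r + j * k)) (fun r : 'I_k => ((q.+1 + (k.-1 - r)) %/ k)%N)) //.
- by rewrite -val_enum_ord big_map big_enum.
- move=> i; have rk : (i %% k < k)%N by rewrite ltn_mod.
  exists (Ordinal rk, (i %/ k)%N) => /=; rewrite (lt (Ordinal rk)) /=.
  have e : (i %% k + i %/ k * k = i)%N by rewrite addnC -divn_eq.
  by rewrite e ltn_ord; split=> //; rewrite inord_val.
- move=> r j r' j'; rewrite !lt => l l' /(congr1 val) /=; rewrite !inordK // => e.
  have : ((r + j * k) %% k = (r' + j' * k) %% k)%N by rewrite e.
  rewrite ![(_ + _ * _)%N]addnC !modnMDl !modn_small // => rr; split; first exact/val_inj.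
  by move: e; rewrite rr => /addnI /eqP; rewrite eqn_pmul2r // => /eqP.
- move=> r j; rewrite !lt /powstep => l; rewrite inordK //.
  rewrite mulSn addnCA [(k + _)%N]addnC; case: ltnP => h.
    rewrite insubT; congr Some; apply/val_inj; rewrite /= inordK //.
  by rewrite insubF // ltnNge h.
Qed.

Lemma nblocks_delta i X : nblocks (delta i X) = \dim (lker (endopow (kop X) i)).
Proof.
case: i => [|i].
  transitivity 0%N; last first.
    apply/esym/eqP; rewrite dimv_eq0; apply/eqP/vspaceP => v.
    by rewrite memv_ker endopowE memv0.
  apply/eqP; rewrite -leqn0 /nblocks (leq_trans (dimvS (subvf _))) //.
  by rewrite dim_tens card_ord mul0n.
have := nblocks_pow (k := 1) X (oner_neq0 K) isT (ltn0Sn i).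
rewrite big_seq1 addn0 divn1 => <-; congr nblocks.
congr tens; apply/funext => k; by rewrite /powstep addn1.
Qed.

End TensorTheory.

(** * Tensor products of Jordan blocks in positive characteristic *)

Section Frobenius.
Variables (K : fieldType) (V : vectType K).
Implicit Types (a b : 'End(V)).

Lemma iter_comm a b n k v : (forall w, a (b w) = b (a w)) ->
  iter n a (iter k b v) = iter k b (iter n a v).
Proof.
move=> ab; elim: n => //= n ->; move: (iter n a v) => w.
by elim: k => //= k <-; rewrite ab.
Qed.

Lemma iter_binomial a b n v : (forall w, a (b w) = b (a w)) ->
  iter n (a + b) v = \sum_(k < n.+1) iter (n - k) a (iter k b v) *+ 'C(n, k).
Proof.
move=> ab; elim: n => [|n IH]; first by rewrite big_ord1 mulr1n.
have ba w : b (a w) = a (b w) by [].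
rewrite iterS IH add_lfunE !linear_sum [RHS]big_ord_recl /=.
under [X in _ = _ + X]eq_bigr do rewrite /bump /= add1n subSS binS mulrnDr.
rewrite big_split /= addrA; congr (_ + _); last first.
  apply: eq_bigr => i _; rewrite linearMn; congr (_ *+ _).
  by have /= := iter_comm (n - i) 1 (iter i b v) ab => ->.
rewrite big_ord_recl [X in _ = _ + X]big_ord_recr /= (bin_small (ltnSn n)) mulr0n addr0 !bin0.
rewrite !mulr1n subn0; congr (_ + _); apply: eq_bigr => i _.
rewrite linearMn /bump /= add1n; congr (_ *+ _).
by rewrite -iterS; congr (iter _ a _); have := ltn_ord i; lia.
Qed.

(** The Frobenius identity in the commutative algebra generated by [a] and [b]. *)
Lemma iter_frobenius p a b e v : p \in [pchar K] -> (forall w, a (b w) = b (a w)) ->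
  iter (p ^ e) (a + b) v = iter (p ^ e) a v + iter (p ^ e) b v.
Proof.
move=> pK ab; have p_pr := pcharf_prime pK.
have V0 (w : V) : w *+ p = 0 by rewrite -scaler_nat (pcharf0 pK) scale0r.
have one (f g : 'End(V)) w : (forall u, f (g u) = g (f u)) ->
    iter p (f + g) w = iter p f w + iter p g w.
  move=> fg; rewrite iter_binomial // big_ord_recl.
  have [p' pp'] : exists p', p = p'.+1 by exists p.-1; rewrite prednK ?prime_gt0.
  have bin_p i : (i < p')%N -> (p %| 'C(p, i.+1))%N.
    by move=> ip; rewrite prime_dvd_bin //=; lia.
  move: bin_p V0; rewrite [in \sum_(i < p) _]pp' => bin_p V0.
  rewrite big_ord_recr big1 => [|i _]; last first.
    have /dvdnP [c ec] := bin_p i (ltn_ord i).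
    by rewrite [X in _ *+ X](_ : _ = c * p)%N ?mulrnA ?V0 // -ec lift0 /= -pp'.
  by rewrite /= subn0 bin0 /bump /= add1n -pp' subnn binn !mulr1n add0r add0n -iterS -pp' /=.
elim: e v => [|e IH] v; first by rewrite expn0 /= add_lfunE.
rewrite expnS !iterM.
have H (f : 'End(V)) u : iter p (iter (p ^ e) f) u = iter p (endopow f (p ^ e)) u.
  by apply: eq_iter => w; rewrite endopowE.
rewrite !H -one; last by move=> u; rewrite !endopowE iter_comm.
by apply: eq_iter => w; rewrite add_lfunE !endopowE IH.
Qed.

End Frobenius.

Section BlockCount.
Variable K : fieldType.
Implicit Types (X Y Z : kmod K) (c d : K) (s : seq nat).

Definition unitk : kmod K := KMod (0 : 'End(K^o)).

Definition deltas s := foldr (@delta K) unitk s.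

Definition tblocks s := nblocks (deltas s).

Lemma delta_iso i X Y : kiso X Y -> kiso (delta i X) (delta i Y).
Proof. exact: tens_iso. Qed.

Lemma deltas_cat s X s' : foldr (@delta K) X (s ++ s') = foldr (@delta K) (foldr (@delta K) X s') s.
Proof. exact: foldr_cat. Qed.

Lemma tens_deltas (I : finType) (phi : I -> option I) c X s :
  kiso (tens phi c (foldr (@delta K) X s)) (foldr (@delta K) (tens phi c X) s).
Proof.
elim: s => [|i s IH]; first exact: kiso_refl.
exact: kiso_trans (tens_swap _ _ _ _ _) (delta_iso _ IH).
Qed.

Lemma deltas_perm s s' : perm_eq s s' -> kiso (deltas s) (deltas s').
Proof.
elim: s s' => [|i s IH] s'; first by rewrite perm_sym => /perm_nilP ->; apply: kiso_refl.
move=> pss'; have is' : i \in s' by rewrite -(perm_mem pss') mem_head.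
case/path.splitPr: is' pss' => s1 s2 pss'.
have /IH e : perm_eq s (s1 ++ s2).
  by rewrite -(perm_cons i) (perm_trans pss') // (perm_catCA s1 [:: i] s2).
apply: kiso_trans (delta_iso i e) _.
by rewrite /deltas !deltas_cat; apply: tens_deltas.
Qed.

Lemma tblocks_perm s s' : perm_eq s s' -> tblocks s = tblocks s'.
Proof. by move/deltas_perm/nblocks_iso. Qed.

Lemma tblocks_cons i s : tblocks (i :: s) = \dim (lker (endopow (kop (deltas s)) i)).
Proof. exact: nblocks_delta. Qed.

Lemma dim_deltas s : \dim {:kcar (deltas s)} = (\prod_(i <- s) i)%N.
Proof.
elim: s => [|i s IH]; first by rewrite big_nil dimvf.
by rewrite big_cons dim_tens card_ord IH.
Qed.

Definition nilk q X := forall v, iter q (kop X) v = 0.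

(** [T^q] kills the product of the blocks [s], hence so does [T^i]. *)
Lemma tblocks_full q i s : nilk q (deltas s) -> (q <= i)%N -> tblocks (i :: s) = (\prod_(j <- s) j)%N.
Proof.
move=> nil qi; rewrite tblocks_cons -dim_deltas; congr (\dim _).
apply/vspaceP => v; rewrite memvf memv_ker endopowE -(subnK qi) iterD nil.
by rewrite -endopowE linear0 eqxx.
Qed.

Definition shift n X : 'End({ffun 'I_n -> kcar X}) :=
  kop (delta n (KMod (0 : 'End(kcar X)))).

Lemma shiftE n X v (j : 'I_n) : shift n X v j = \sum_(k : 'I_n | k.+1 == j) v k.
Proof.
rewrite [LHS](@tensE _ _ _ _ (KMod (0 : 'End(kcar X)))) zero_lfunE add0r scale1r.
apply: eq_bigl => k.
case: insubP => [u /= uk e|]; first by rewrite -e.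
by move/negPf => h; apply/esym/eqP => e; move: h; rewrite e ltn_ord.
Qed.

Lemma shift_iter n X m v (j : 'I_n) : iter m (shift n X) v j = \sum_(k : 'I_n | (k + m)%N == j) v k.
Proof.
elim: m j => [|m IH] j.
  by rewrite (big_pred1 j) // => k; rewrite addn0.
rewrite iterS shiftE; under eq_bigr do rewrite IH.
case: (posnP j) => j0.
  by rewrite !big_pred0 // => k; rewrite j0 ?addnS.
have lt : (j.-1 < n)%N by have := ltn_ord j; lia.
rewrite (big_pred1 (Ordinal lt)) => [|k].
  by apply: eq_bigl => k /=; rewrite addnS -[in RHS](prednK j0) eqSS.
by rewrite /= -[in LHS](prednK j0) eqSS.
Qed.

Lemma delta_opE n X v (j : 'I_n) : kop (delta n X) v j = kop X (v j) + shift n X v j.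
Proof. by rewrite tensE [in RHS](@tensE _ _ _ _ (KMod (0 : 'End(kcar X)))) zero_lfunE add0r. Qed.

Definition lift_op (I : finType) X : 'End({ffun I -> kcar X}) :=
  kop (tens (fun=> None : option I) 1 X).

Lemma lift_opE (I : finType) X v i : lift_op I X v i = kop X (v i).
Proof. by rewrite /lift_op tensE big_pred0 // scaler0 addr0. Qed.

Lemma lift_op_iter (I : finType) X m v i : iter m (lift_op I X) v i = iter m (kop X) (v i).
Proof. by elim: m => //= m <-; rewrite lift_opE. Qed.

Lemma delta_op n X : kop (delta n X) = lift_op _ X + shift n X.
Proof.
by apply/lfunP => v; apply/ffunP => j; rewrite add_lfunE delta_opE ffunE lift_opE.
Qed.

Lemma lift_shift n X v : lift_op _ X (shift n X v) = shift n X (lift_op _ X v).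
Proof.
apply/ffunP => j; rewrite lift_opE !shiftE linear_sum.
by apply: eq_bigr => k _; rewrite lift_opE.
Qed.

Lemma shift_nil n X m v : (n <= m)%N -> iter m (shift n X) v = 0.
Proof.
move=> nm; apply/ffunP => j; rewrite shift_iter ffunE big_pred0 // => k.
by apply/eqP => e; have := ltn_ord j; rewrite -e; lia.
Qed.

(** By the Frobenius identity, [T^(p^e)] acts on a tensor product as the sum of its
    actions on the two factors. *)
Lemma delta_nil p e i X : p \in [pchar K] -> nilk (p ^ e) X -> (i <= p ^ e)%N ->
  nilk (p ^ e) (delta i X).
Proof.
move=> pK nX iq v; rewrite delta_op (iter_frobenius _ _ pK); last exact: lift_shift.
by rewrite shift_nil // addr0; apply/ffunP => j; rewrite lift_op_iter nX ffunE.
Qed.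

Lemma deltas_nil p e s : p \in [pchar K] -> all (leq^~ (p ^ e)%N) s -> nilk (p ^ e) (deltas s).
Proof.
move=> pK; elim: s => [_ v|i s IH /= /andP [iq sq]].
  have p0 : (0 < p ^ e)%N by rewrite expn_gt0 prime_gt0 // (pcharf_prime pK).
  by rewrite -(prednK p0) iterS zero_lfunE.
exact: delta_nil (IH sq) iq.
Qed.

(** The module [delta i X] sits in [delta Q X] as the kernel of the [i]-th power
    of the shift, hence both sides are dimensions of the common kernel of a power
    of the shift and a power of the operator. *)
Lemma tblocks_joint_kernel i j Q X : (i <= Q)%N ->
  nblocks (delta j (delta i X)) =
  \dim (lker (endopow (shift Q X) i) :&: lker (endopow (kop (delta Q X)) j)).
Proof.
move=> iQ; rewrite nblocks_delta.
pose ep (v : {ffun 'I_i -> kcar X}) : {ffun 'I_Q -> kcar X} :=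
  [ffun k : 'I_Q => \sum_(l : 'I_i | (l + (Q - i))%N == k) v l].
have lep : linear ep.
  move=> k u v; apply/ffunP => m; rewrite !ffunE scaler_sumr -big_split.
  by apply: eq_bigr => l _; rewrite !ffunE.
pose E : {linear _ -> _} := HB.pack ep (GRing.isLinear.Build _ _ _ _ ep lep).
have EE v : linfun E v = ep v by rewrite lfunE.
have epl v (l : 'I_i) (k : 'I_Q) : (l + (Q - i))%N = k -> ep v k = v l.
  move=> lk; rewrite ffunE (big_pred1 l) // => l'.
  by rewrite -lk eqn_add2r.
have inj : lker (linfun E) == 0%VS.
  apply/lker0P => u v; rewrite !EE => /ffunP uv; apply/ffunP => l.
  have lt : (l + (Q - i) < Q)%N by have := ltn_ord l; lia.
  by have := uv (Ordinal lt); rewrite !(epl _ l).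
have com v : ep (kop (delta i X) v) = kop (delta Q X) (ep v).
  apply/ffunP => k; rewrite delta_opE.
  case: (ltnP k (Q - i)) => kQ.
    rewrite !ffunE !big_pred0 ?linear0 ?add0r; last first.
    - by move=> l; apply/eqP; lia.
    - by move=> l; apply/eqP; lia.
    rewrite shiftE big1 // => k' /eqP kk; rewrite ffunE big_pred0 // => l.
    by apply/eqP; lia.
  have lt : (k - (Q - i) < i)%N by have := ltn_ord k; lia.
  have e : (Ordinal lt + (Q - i))%N = k by rewrite /= subnK.
  rewrite !(epl _ _ _ e) delta_opE; congr (_ + _); rewrite !shiftE /=.
  case: (posnP (k - (Q - i))) => z.
    rewrite big_pred0 => [|l]; last by rewrite z.
    rewrite big1 // => k' /eqP kk; rewrite ffunE big_pred0 // => l.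
    by apply/eqP; lia.
  have lt1 : ((k - (Q - i)).-1 < i)%N by lia.
  rewrite (big_pred1 (Ordinal lt1)) => [|l]; last first.
    by rewrite /= -[in LHS](prednK z) eqSS.
  have lt2 : (k.-1 < Q)%N by have := ltn_ord k; lia.
  rewrite (big_pred1 (Ordinal lt2)) => [|l]; last first.
    by apply/eqP/eqP => [kl|->] /=; [apply/val_inj => /= | ]; lia.
  by rewrite (epl _ (Ordinal lt1)) //=; lia.
have comn v n : ep (iter n (kop (delta i X)) v) = iter n (kop (delta Q X)) (ep v).
  by elim: n => //= n <-; rewrite com.
rewrite -(limg_dim_eq (f := linfun E)) ?(eqP inj) ?capv0 //; congr (\dim _).
apply/vspaceP => w; rewrite memv_cap !memv_ker !endopowE; apply/memv_imgP/andP.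
  move=> [v]; rewrite memv_ker endopowE EE => /eqP v0 ->; rewrite -comn v0; split; last first.
    by rewrite -EE linear0.
  apply/eqP/ffunP => k; rewrite shift_iter [RHS]ffunE big1 // => k' /eqP kk.
  by rewrite ffunE big_pred0 // => l; apply/eqP; have := ltn_ord k; lia.
move=> [/eqP/ffunP w0 wj].
pose v : {ffun 'I_i -> kcar X} := [ffun l : 'I_i => \sum_(k : 'I_Q | (l + (Q - i))%N == k) w k].
have vw : ep v = w.
  apply/ffunP => k; case: (ltnP k (Q - i)) => kQ.
    rewrite ffunE big_pred0 => [|l]; last by apply/eqP; lia.
    have lt : (k + i < Q)%N by lia.
    have := w0 (Ordinal lt); rewrite shift_iter ffunE (big_pred1 k) // => k'.
    by rewrite eqn_add2r.
  have lt : (k - (Q - i) < i)%N by have := ltn_ord k; lia.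
  rewrite (epl _ (Ordinal lt)) /= ?subnK // ffunE (big_pred1 k) // => k' /=.
  by rewrite subnK // eq_sym.
exists v; last by rewrite EE vw.
rewrite memv_ker endopowE; apply/eqP/(elimT lker0P inj).
by rewrite linear0 EE comn vw (eqP wj).
Qed.

(** On [delta Q X] with [Q = p^e], if [T^Q] kills [X], both the shift and the
    operator have all their Jordan blocks of size [Q]. *)
Lemma nblocks_reflection p e X i j : p \in [pchar K] -> nilk (p ^ e) X ->
    (i <= p ^ e)%N -> (j <= p ^ e)%N ->
  (nblocks (delta (p ^ e - j) (delta (p ^ e - i) X)) + (i + j) * \dim {:kcar X}
   = nblocks (delta j (delta i X)) + p ^ e * \dim {:kcar X})%N.
Proof.
move=> pK nX iq jq; set q := (p ^ e)%N.
rewrite !(@tblocks_joint_kernel _ _ q) ?leq_subr //.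
apply: ker_reflection => //.
- by move=> v; rewrite delta_op !add_lfunE linearD lift_shift.
- by move=> v; apply: shift_nil.
- by rewrite /shift -/(nblocks (delta q (KMod (0 : 'End(kcar X))))) nblocks_delta; apply/dimvS/subvf.
- by move=> v; apply: delta_nil pK nX (leqnn q) v.
- by rewrite -/(nblocks (delta q X)) nblocks_delta; apply/dimvS/subvf.
- by rewrite -[LHS]/(\dim {:kcar (delta q X)}) dim_tens card_ord.
Qed.

Lemma tblocks_reflection p e s i j : p \in [pchar K] -> all (leq^~ (p ^ e)%N) s ->
    (i <= p ^ e)%N -> (j <= p ^ e)%N ->
  (tblocks [:: p ^ e - i, p ^ e - j & s] + (i + j) * \prod_(k <- s) k
   = tblocks [:: i, j & s] + p ^ e * \prod_(k <- s) k)%N.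
Proof.
move=> pK sq iq jq; rewrite -dim_deltas [(i + j)%N]addnC.
exact: nblocks_reflection (deltas_nil pK sq) jq iq.
Qed.

End BlockCount.

(** * Blocks of xy and of a difference of two squares *)

Section PairStrings.
Variable K : fieldType.
Implicit Types (X Y Z : kmod K) (c d : K) (s : seq nat).

Definition ordpair m n (a b : nat) : option ('I_m * 'I_n) :=
  if (insub a, insub b) is (Some x, Some y) then Some (x, y) else None.

Lemma ordpairE m n a b :
  ordpair m.+1 n.+1 a b =
  if (a < m.+1)%N && (b < n.+1)%N then Some (inord a, inord b) else None.
Proof.
rewrite /ordpair; case: insubP => [x -> ax|/negPf -> //].
case: insubP => [y -> by_|/negPf -> //] /=.
by rewrite -ax -by_ !inord_val.
Qed.

(** Multiplication by [xy] on the monomials [x^a y^b], [a < Q], [b < q], of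
    [K[x, y] / (x^Q, x^q - y^q)]; for [Q = q] this is [K[x, y] / (x^q, y^q)]. *)
Definition diagstep Q q (ab : 'I_Q * 'I_q) : option ('I_Q * 'I_q) :=
  if (ab.2.+1 < q)%N then ordpair Q q ab.1.+1 ab.2.+1 else ordpair Q q (ab.1 + q).+1 0.

Definition diag_nat q (ab : nat * nat) : nat * nat :=
  if (ab.2.+1 < q)%N then (ab.1.+1, ab.2.+1) else ((ab.1 + q).+1, 0%N).

(** Describing the strings by natural numbers instead of ordinals leaves conditions
    of linear arithmetic. *)
Lemma nblocks_diag Q q c X (E : finType) (g : E -> nat -> nat * nat) (len : E -> nat) :
    c != 0 -> (0 < Q)%N -> (0 < q)%N ->
    (forall e j, (j < len e)%N -> ((g e j).1 < Q)%N && ((g e j).2 < q)%N) ->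
    (forall a b, (a < Q)%N -> (b < q)%N ->
      exists ej : E * nat, (ej.2 < len ej.1)%N /\ g ej.1 ej.2 = (a, b)) ->
    (forall e j e' j', (j < len e)%N -> (j' < len e')%N ->
      g e j = g e' j' -> e = e' /\ j = j') ->
    (forall e j, (j.+1 < len e)%N -> diag_nat q (g e j) = g e j.+1) ->
    (forall e j, len e = j.+1 -> (Q <= (diag_nat q (g e j)).1)%N) ->
  nblocks (tens (@diagstep Q q) c X) = (\sum_e \dim (lker (endopow (kop X) (len e))))%N.
Proof.
move=> c0; case: Q => // Q _; case: q => // q _ gB gS gI gN gL.
apply: (@nblocks_strings _ _ _ _ c X (fun e j => (inord (g e j).1, inord (g e j).2))) => //.
- move=> [a b]; have [[e j] [/= je ej]] := gS a b (ltn_ord a) (ltn_ord b).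
  by exists (e, j); rewrite /= ej !inord_val.
- move=> e j e' j' je je'; have /andP [b1 b2] := gB _ _ je.
  have /andP [b1' b2'] := gB _ _ je'.
  move=> [/(congr1 val) /= + /(congr1 val) /=]; rewrite !inordK // => e1 e2.
  by apply: gI => //; rewrite [LHS]surjective_pairing e1 e2 -surjective_pairing.
move=> e j je; have /andP [b1 b2] := gB _ _ je.
rewrite /diagstep /= !inordK // !ordpairE.
have gd : ((diag_nat q.+1 (g e j)).2 < q.+1)%N by rewrite /diag_nat; case: ifP.
rewrite (_ : (if _ then _ else _) =
  if ((diag_nat q.+1 (g e j)).1 < Q.+1) then
    Some (inord (diag_nat q.+1 (g e j)).1, inord (diag_nat q.+1 (g e j)).2)
  else None)%N; last first.
  by rewrite /diag_nat; case: ifP => /= h; rewrite ?h ?andbT.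
case: (ltnP j.+1 (len e)) => h.
  by rewrite gN //; have /andP [-> _] := gB _ _ h.
by rewrite ltnNge gL //; lia.
Qed.

(** The sizes of the blocks of [xy] on [K[x, y] / (x^q, y^q)], the strings of which
    start at the monomials [x^a] and [y^b]. *)
Definition xysizes q := q :: iota 1 q.-1 ++ iota 1 q.-1.

(** The sizes of the blocks of [xy] on [K[x, y] / (x^(3q), x^q - y^q)]. *)
Definition midsizes q := q :: q.*2 :: iota q.+1 q.-1 ++ iota q.+1 q.-1.

Lemma sum_rev_iota (F : nat -> nat) n :
  (\sum_(a < n) F (n - a) = \sum_(s <- iota 1 n) F s)%N.
Proof.
elim: n => [|n IH]; first by rewrite big_ord0 big_nil.
rewrite big_ord_recl subn0 -[in RHS](addn1 n) iotaD big_cat /= big_seq1 addnC.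
by rewrite -IH add1n.
Qed.

Lemma nblocks_diag_square q c X : c != 0 -> (0 < q)%N ->
  nblocks (tens (@diagstep q q) c X) =
  (\sum_(s <- xysizes q) \dim (lker (endopow (kop X) s)))%N.
Proof.
move=> c0 q0.
rewrite (@nblocks_diag q q c X ('I_q + 'I_q.-1)%type
   (fun e j => match e with inl a => (a + j, j) | inr b => (j, b.+1 + j) end)%N
   (fun e => match e with inl a => q - a | inr b => q.-1 - b end)%N) //.
- rewrite big_sumType /= /xysizes big_cons big_cat /= addnA; congr (_ + _)%N.
    case: q q0 => // q _; rewrite big_ord_recl subn0; congr (_ + _)%N.
    by rewrite -(sum_rev_iota (fun l => \dim (lker (endopow (kop X) l)))).
  by rewrite -(sum_rev_iota (fun l => \dim (lker (endopow (kop X) l)))).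
- by move=> [a|b] j /=; [have := ltn_ord a | have := ltn_ord b]; lia.
- move=> a b aq bq; case: (leqP b a) => ab.
    have lt : (a - b < q)%N by lia.
    exists (inl (Ordinal lt), b); split => /=; first by lia.
    by rewrite subnK.
  have lt : ((b - a).-1 < q.-1)%N by lia.
  exists (inr (Ordinal lt), a); split => /=; first by lia.
  congr pair; lia.
- move=> [a|b] j [a'|b'] j' /= l l' [h1 h2].
  + by split; [congr inl; apply: val_inj => /= | ]; lia.
  + lia.
  + lia.
  + by split; [congr inr; apply: val_inj => /= | ]; lia.
- by move=> [a|b] j /= l; rewrite /diag_nat /= ifT; try (congr pair); lia.
- by move=> [a|b] j /= l; rewrite /diag_nat /=; case: ifP => /=; lia.
Qed.

Lemma nblocks_diag_mid q c X : c != 0 -> (0 < q)%N ->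
  nblocks (tens (@diagstep (3 * q) q) c X) =
  (\sum_(s <- midsizes q) \dim (lker (endopow (kop X) s)))%N.
Proof.
move=> c0 q0.
(* The strings through [x^a], [a <= q], and through [y^(b+1)], [b + 1 < q]; they
   continue past the relation [y^q = x^q]. *)
rewrite (@nblocks_diag (3 * q) q c X ('I_q.+1 + 'I_q.-1)%type
   (fun e j => match e with
     | inl a => if j < q then (a + j, j) else (a + j + q, j - q)
     | inr b => if j < q - b.+1 then (j, b.+1 + j) else (j + q, j - (q - b.+1))
     end)%N
   (fun e => match e with inl a => q.*2 - a | inr b => q.*2 - b.+1 end)%N) //.
- rewrite big_sumType /= /midsizes !big_cons big_cat /=.
  pose F (i : nat) : nat := \dim (lker (endopow (kop X) i)).
  have head (G : nat -> nat) : (\sum_(i < q) G i = G 0 + \sum_(i < q.-1) G i.+1)%N.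
    by case: q q0 => // n _; rewrite big_ord_recl.
  have rev : (\sum_(i < q.-1) F (q.*2 - i.+1) = \sum_(i <- iota q.+1 q.-1) F i)%N.
    rewrite -[q.+1]addn1 iotaDl big_map -(sum_rev_iota (fun l => F (q + l)%N)).
    by apply: eq_bigr => i _; congr F; have := ltn_ord i; lia.
  change ((\sum_(i < q.+1) F (q.*2 - i)%N + \sum_(i < q.-1) F (q.*2 - i.+1)%N)%N =
    (F q + (F q.*2 + (\sum_(l <- iota q.+1 q.-1) F l + \sum_(l <- iota q.+1 q.-1) F l)))%N).
  rewrite big_ord_recr /= (head (fun i => F (q.*2 - i)%N)) rev subn0.
  by rewrite (_ : q.*2 - q = q)%N; lia.
- by rewrite muln_gt0.
- by move=> [a|b] j /=; [have := ltn_ord a | have := ltn_ord b]; case: ifP => /=; lia.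
- move=> a b aq bq; case: (leqP b a) => ab; last first.
    have lt : ((b - a).-1 < q.-1)%N by lia.
    exists (inr (Ordinal lt), a); split => /=; first by lia.
    by rewrite ifT; first congr pair; lia.
  case: (leqP (a - b) q) => abq.
    have lt : (a - b < q.+1)%N by lia.
    exists (inl (Ordinal lt), b); split => /=; first by lia.
    by rewrite bq subnK.
  case: (ltnP (a - b) q.*2) => abq2.
    have lt : ((q.*2 - (a - b)).-1 < q.-1)%N by lia.
    exists (inr (Ordinal lt), (q - (q.*2 - (a - b)) + b)%N); split => /=; first by lia.
    by rewrite ifF; first congr pair; lia.
  have lt : (a - b - q.*2 < q.+1)%N by lia.
  exists (inl (Ordinal lt), (q + b)%N); split => /=; first by lia.
  by rewrite ifF; first congr pair; lia.
- move=> [a|a] j [a'|a'] j' /= l l'; have A := ltn_ord a; have A' := ltn_ord a';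
    do 2 (case: ifP => ?); move=> [h1 h2]; try (exfalso; lia);
    by split; [first [congr inl | congr inr]; apply: val_inj => /= | ]; lia.
- move=> [a|a] j /= l; have A := ltn_ord a; rewrite /diag_nat;
    [case: (ltnP j q) => ? | case: (ltnP j (q - a.+1)) => ?];
    by repeat (case: ifP => /= ?); try (congr pair); lia.
- move=> [a|a] j /= l; have A := ltn_ord a; rewrite /diag_nat;
    [case: (ltnP j q) => ? | case: (ltnP j (q - a.+1)) => ?];
    by repeat (case: ifP => /= ?); lia.
Qed.

End PairStrings.

Lemma ordpairP m n a b : match ordpair m n a b with
  | Some xy => (xy.1 = a :> nat) /\ (xy.2 = b :> nat)
  | None => (m <= a)%N \/ (n <= b)%N
  end.
Proof.
rewrite /ordpair; case: insubP => [x _ ax|]; last by rewrite -leqNgt; left.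
by case: insubP => [y _ bY|]; [split | rewrite -leqNgt; right].
Qed.

Lemma iter_oppl (K : fieldType) (V : vectType K) (f : 'End(V)) n v :
  iter n (- f) v = (-1) ^+ n *: iter n f v.
Proof.
elim: n => [|n IH]; first by rewrite scale1r.
by rewrite !iterS IH opp_lfunE linearZ exprS mulN1r scaleNr.
Qed.

(** If [q] is a power of the characteristic, which is odd, then [x = u + v] and
    [y = u - v] turn [u^Q, v^q] and [u^2 - v^2] into [x^Q, x^q - y^q] and [xy]. *)
Section ChangeOfCoordinates.
Variables (K : fieldType) (X : kmod K) (p e k : nat).
Hypothesis (pK : p \in [pchar K]) (p2 : 2%:R != 0 :> K) (k0 : (0 < k)%N).
Local Notation q := (p ^ e)%N.
Local Notation Q := (k * p ^ e)%N.

Let Y0 := tens (@powstep 2 q) (-1) X.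
Let Y := tens (@powstep 2 Q) 1 Y0.
Let V := {ffun 'I_Q -> {ffun 'I_q -> kcar X}}.
(* The multiplications by the two variables, and the operator of [X]. *)
Let u : 'End(V) := shift Q Y0.
Let v : 'End(V) := lift_op 'I_Q (KMod (shift q X)).
Let T : 'End(V) := lift_op 'I_Q (KMod (lift_op 'I_q X)).
Let x : 'End(V) := u + v.
Let y : 'End(V) := u - v.

Let uv w : u (v w) = v (u w).
Proof. by have := lift_shift (n := Q) (X := KMod (shift q X)) w. Qed.

Let uT w : T (u w) = u (T w).
Proof. by have := lift_shift (n := Q) (X := KMod (lift_op 'I_q X)) w. Qed.

Let vE w a : v w a = shift q X (w a).
Proof. exact: (@lift_opE _ _ (KMod (shift q X))). Qed.

Let TE w a : T w a = lift_op 'I_q X (w a).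
Proof. exact: (@lift_opE _ _ (KMod (lift_op 'I_q X))). Qed.

Let vT w : T (v w) = v (T w).
Proof. by apply/ffunP => a; rewrite TE !vE TE lift_shift. Qed.

Let xT w : T (x w) = x (T w).
Proof. by rewrite !add_lfunE linearD /= uT vT. Qed.

Let yT w : T (y w) = y (T w).
Proof. by rewrite !add_lfunE !opp_lfunE linearB /= uT vT. Qed.

Let xy w : x (y w) = u (u w) - v (v w).
Proof.
by rewrite !add_lfunE !opp_lfunE !linearB /= uv addrA subrK.
Qed.

Let yx w : y (x w) = x (y w).
Proof.
by rewrite xy !add_lfunE !opp_lfunE !linearD /= uv addrA addrK.
Qed.

Let opE w : kop Y w = T w + (u (u w) - v (v w)).
Proof.
apply/ffunP => a; rewrite [LHS](@tensE _ _ _ _ Y0) ffunE TE scale1r.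
have -> : \sum_(l | powstep 2 l == Some a) w l = u (u w) a.
  have /= -> := shift_iter (X := Y0) 2 w a; apply: eq_bigl => l.
  rewrite /powstep; case: insubP => [l' _ <-|] //=.
  by move/negPf => h; apply/esym/eqP => e1; move: h; rewrite e1 ltn_ord.
rewrite [X in _ = _ + X]ffunE addrA [RHS]addrAC; congr (_ + _).
apply/ffunP => b; rewrite tensE !ffunE lift_opE scaleN1r !vE; congr (_ - _).
have /= -> := shift_iter (X := X) 2 (w a) b; apply: eq_bigl => l.
rewrite /powstep; case: insubP => [l' _ <-|] //=.
by move/negPf => h; apply/esym/eqP => e1; move: h; rewrite e1 ltn_ord.
Qed.

Let vq w : iter q v w = 0.
Proof.
apply/ffunP => a; rewrite (@lift_op_iter _ _ (KMod (shift q X))) /=.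
by rewrite shift_nil // ffunE.
Qed.

Let xq w : iter q x w = iter q u w.
Proof. by rewrite (iter_frobenius _ _ pK) // vq addr0. Qed.

Let yq w : iter q y w = iter q x w.
Proof.
rewrite xq (iter_frobenius _ _ pK); last by move=> z; rewrite !opp_lfunE linearN /= uv.
by rewrite iter_oppl vq scaler0 addr0.
Qed.

Let xQ w : iter Q x w = 0.
Proof.
rewrite iterM (eq_iter (f' := iter q u)) // -iterM.
exact: (@shift_nil _ _ Y0).
Qed.

Let io (z : kcar X) : V :=
  [ffun a : 'I_Q => [ffun b : 'I_q => if (a == 0 :> nat) && (b == 0 :> nat) then z else 0]].

(* The monomial [x^a y^b] with coefficient [z]. *)
Let m a b z : V := iter a x (iter b y (io z)).

Let ioD : linear io.
Proof.
move=> c z z'; apply/ffunP => a; apply/ffunP => b; rewrite !ffunE.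
by case: ifP => // _; rewrite scaler0 addr0.
Qed.

Let mD a b : linear (m a b).
Proof. by move=> c z z'; rewrite /m ioD -!endopowE !linearP. Qed.

HB.instance Definition _ a b := GRing.isLinear.Build K _ _ _ (m a b) (mD a b).

Let ym a b z : y (m a b z) = m a b.+1 z.
Proof.
rewrite /m iterS -[y (iter b y _)]/(iter 1 y (iter b y (io z))).
by rewrite -[LHS]/(iter 1 y _) -iter_comm.
Qed.

Let mq a z : m a q z = m (a + q) 0 z.
Proof. by rewrite /m yq iterD. Qed.

Let mQ a b z : (Q <= a)%N -> m a b z = 0.
Proof. by move=> /subnK <-; rewrite /m iterD xQ -endopowE linear0. Qed.

Let Tm a b z : T (m a b z) = m a b (kop X z).
Proof.
have iterT f n w : (forall w', T (f w') = f (T w')) ->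
    T (iter n f w) = iter n f (T w) by move=> Tf; elim: n => //= n <-.
rewrite /m !iterT //; congr (iter _ _ (iter _ _ _)).
apply/ffunP => a'; rewrite TE; apply/ffunP => b'; rewrite lift_opE !ffunE.
by case: ifP => // _; rewrite linear0.
Qed.

Let Psi (w : {ffun 'I_Q * 'I_q -> kcar X}) : V := \sum_(ab : 'I_Q * 'I_q) m ab.1 ab.2 (w ab).

Let PsiD : linear Psi.
Proof.
move=> c w w'; rewrite scaler_sumr -big_split; apply: eq_bigr => ab _.
by rewrite !ffunE linearP.
Qed.

HB.instance Definition _ := GRing.isLinear.Build K _ _ _ Psi PsiD.

Let Psi_op w : Psi (kop (tens (@diagstep Q q) 1 X) w) = kop Y (Psi w).
Proof.
rewrite opE -xy !linear_sum -big_split /=.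
transitivity (\sum_(ab : 'I_Q * 'I_q) (T (m ab.1 ab.2 (w ab)) + \sum_(l | diagstep l == Some ab)
    m ab.1 ab.2 (w l))).
  by apply: eq_bigr => ab _; rewrite tensE scale1r Tm linearD linear_sum.
rewrite [LHS]big_split [RHS]big_split; congr (_ + _).
rewrite (exchange_big_dep predT) //=; apply: eq_bigr => -[a b] _ /=.
rewrite /diagstep /=; have -> : x (y (m a b (w (a, b)))) = m a.+1 b.+1 (w (a, b)).
  by rewrite ym.
case: ifP => bq.
  have := ordpairP Q q a.+1 b.+1; case: ordpair => [[a' b'] /= [e1 e2]|].
    by rewrite (big_pred1 (a', b')) => [|l]; [rewrite /= e1 e2 | rewrite eq_sym].
  by move=> [aQ|]; [rewrite big_pred0 // mQ | rewrite leqNgt bq].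
have -> : b.+1 = q by have := ltn_ord b; lia.
have := ordpairP Q q (a + q).+1 0; rewrite mq; case: ordpair => [[a' b'] /= [e1 b0]|].
  by rewrite (big_pred1 (a', b')) => [|l]; [rewrite /= e1 b0 | rewrite eq_sym].
have q0 : (0 < q)%N by have := ltn_ord b; lia.
by move=> [aQ|]; [rewrite big_pred0 // mQ | rewrite leqNgt q0].
Qed.

Let mP a b z : (0 < q)%N -> m a b z \in limg (linfun Psi).
Proof.
move=> q0; elim/ltn_ind: b a => b IH a; case: (leqP q b) => bq.
  have -> : m a b z = m (a + q) (b - q) z.
    rewrite /m -[in LHS](subnKC bq) [iter (q + _) _ _]iterD yq iterD.
    by congr (iter a x _); rewrite !iter_comm.
  by apply: IH; lia.
case: (leqP Q a) => aQ; first by rewrite mQ // mem0v.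
apply/memv_imgP.
exists [ffun ab => if ab == (Ordinal aQ, Ordinal bq) then z else 0]; rewrite ?memvf //.
rewrite lfunE /= /Psi (bigD1 (Ordinal aQ, Ordinal bq)) //= ffunE eqxx big1 ?addr0 //.
by move=> ab /negPf ne; rewrite ffunE ne linear0.
Qed.

(** The monomials in [x] and [y] span a subspace that is stable under [u] and [v],
    hence everything; [Psi] is then bijective by dimension. *)
Lemma change_of_coordinates : kiso (tens (@diagstep Q q) 1 X) Y.
Proof.
have q0 : (0 < q)%N by rewrite expn_gt0 prime_gt0 // (pcharf_prime pK).
have Q0 : (0 < Q)%N by rewrite muln_gt0 k0.
pose P := limg (linfun Psi).
have PsiE w : linfun Psi w = Psi w by rewrite lfunE.
have Px w : w \in P -> x w \in P.
  move=> /memv_imgP [w' _ ->]; rewrite PsiE /Psi linear_sum.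
  by apply: rpred_sum => ab _; apply: (mP ab.1.+1).
have Py w : w \in P -> y w \in P.
  move=> /memv_imgP [w' _ ->]; rewrite PsiE /Psi linear_sum.
  by apply: rpred_sum => ab _; have := mP ab.1 ab.2.+1 (w' ab) q0; rewrite -ym.
have half w : w = (2%:R : K)^-1 *: (w + w).
  have h2 : (2%:R : K)^-1 * 2%:R = 1 by rewrite mulVf.
  by rewrite -[w + w]mulr2n -[w *+ 2]scaler_nat scalerA h2 scale1r.
have Pu w : w \in P -> u w \in P.
  move=> wP; rewrite [u w]half; apply: memvZ.
  have -> : u w + u w = x w + y w by rewrite !add_lfunE !opp_lfunE addrACA subrr addr0.
  by rewrite memvD ?Px ?Py.
have Pv w : w \in P -> v w \in P.
  move=> wP; rewrite [v w]half; apply: memvZ.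
  have -> : v w + v w = x w - y w.
    by rewrite !add_lfunE !opp_lfunE opprB [RHS]addrC addrA subrK.
  by rewrite memvB ?Px ?Py.
have Piter n f w : (forall w', w' \in P -> f w' \in P) -> w \in P -> iter n f w \in P.
  by move=> Pf wP; elim: n => //= n; apply: Pf.
have val (a' b' : nat) z (a : 'I_Q) (b : 'I_q) : iter a' u (iter b' v (io z)) a b =
    if (a == a' :> nat) && (b == b' :> nat) then z else 0.
  rewrite (@shift_iter _ _ Y0) sum_ffunE.
  under eq_bigr => l _ do rewrite (@lift_op_iter _ _ (KMod (shift q X))) shift_iter.
  case: eqP => [ea|ea] /=; last first.
    rewrite big1 // => l /eqP la; rewrite big1 // => l' _; rewrite !ffunE.
    by case: eqP => // l0; case: ea; rewrite -la l0.
  rewrite (big_pred1 (Ordinal Q0)) => [|l]; last first.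
    by rewrite ea -[X in _ == X]add0n eqn_add2r.
  case: eqP => [eb|eb]; last first.
    rewrite big1 // => l' /eqP lb; rewrite !ffunE /=.
    by case: eqP => // l0; case: eb; rewrite -lb l0.
  rewrite (big_pred1 (Ordinal q0)) => [|l]; last first.
    by rewrite eb -[X in _ == X]add0n eqn_add2r.
  by rewrite !ffunE.
have PT : P = fullv.
  apply/vspaceP => w; rewrite memvf.
  have -> : w = \sum_(a < Q) \sum_(b < q) iter a u (iter b v (io (w a b))).
    apply/ffunP => a; apply/ffunP => b; rewrite sum_ffunE sum_ffunE.
    under eq_bigr => a' _.
      rewrite sum_ffunE sum_ffunE.
      under eq_bigr do rewrite val.
      over.
    rewrite (bigD1 a) //= (bigD1 b) //= !eqxx /= big1 => [|b' /negPf bb]; last first.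
      by rewrite val_eqE eq_sym bb.
    rewrite addr0 big1 ?addr0 // => a' /negPf aa.
    by rewrite big1 // => b' _; rewrite val_eqE eq_sym aa.
  apply: rpred_sum => a _; apply: rpred_sum => b _.
  by apply/Piter/Piter/(mP 0 0).
exists (linfun Psi); split=> [||w]; last by rewrite !PsiE Psi_op.
  rewrite -dimv_eq0; have := limg_ker_dim (linfun Psi) fullv.
  have dV : \dim {:V} = (Q * (q * dim (kcar X)))%N.
    by rewrite dimvf -[LHS]/(#|'I_Q| * (#|'I_q| * dim (kcar X)))%N !card_ord.
  have dW : \dim {:{ffun 'I_Q * 'I_q -> kcar X}} = (Q * (q * dim (kcar X)))%N.
    rewrite dimvf -[LHS]/(#|{: 'I_Q * 'I_q}| * dim (kcar X))%N.
    by rewrite card_prod !card_ord mulnA.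
  by rewrite capfv -/P PT dV dW => /eqP; rewrite -[X in _ == X]add0n eqn_add2r.
exact: PT.
Qed.

End ChangeOfCoordinates.

(** * Sums over lists of block sizes *)

Section Multilinear.
Variable R : comPzRingType.
Implicit Types (F G : seq nat -> R) (M : seq nat) (Ms Ns : seq (seq nat)) (s : seq nat).

(** [F] extended multilinearly to formal sums of sizes: tensoring with a module
    amounts to summing over its blocks. *)
Fixpoint multisum F Ms s : R :=
  if Ms is M :: Ms' then \sum_(i <- M) multisum F Ms' (i :: s) else F s.

Definition symfun F := forall s s', perm_eq s s' -> F s = F s'.

Lemma multisum_sym F Ms : symfun F -> symfun (multisum F Ms).
Proof.
move=> Fs; elim: Ms => [|M Ms IH] s s' ss' /=; first exact: Fs.
by apply: eq_bigr => i _; apply: IH; rewrite perm_cons.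
Qed.

Lemma multisum_cat F Ms Ns s : multisum F (Ms ++ Ns) s = multisum (multisum F Ns) Ms s.
Proof. by elim: Ms s => //= M Ms IH s; apply: eq_bigr => i _; rewrite IH. Qed.

Lemma multisum_swap F M M' Ms s : symfun F -> multisum F [:: M, M' & Ms] s = multisum F [:: M', M & Ms] s.
Proof.
move=> Fs /=; rewrite exchange_big; apply: eq_bigr => i _; apply: eq_bigr => j _.
by apply: multisum_sym => //; rewrite (perm_catCA [:: i] [:: j] s).
Qed.

Lemma multisum_perm F Ms Ns s : symfun F -> perm_eq Ms Ns -> multisum F Ms s = multisum F Ns s.
Proof.
move=> Fs; elim: Ms Ns s => [|M Ms IH] Ns s.
  by rewrite perm_sym => /perm_nilP ->.
move=> pMN; have MN : M \in Ns by rewrite -(perm_mem pMN) mem_head.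
case/path.splitPr: MN pMN => N1 N2 pMN.
have /IH e : perm_eq Ms (N1 ++ N2).
  by rewrite -(perm_cons M) (perm_trans pMN) // (perm_catCA N1 [:: M] N2).
have insert N s' : multisum F (N ++ M :: N2) s' = multisum F (M :: N ++ N2) s'.
  elim: N s' => [|N N' IHN] s' //; rewrite cat_cons multisum_swap //=.
  by apply: eq_bigr => i _; rewrite IHN.
by rewrite insert /=; apply: eq_bigr => i _; rewrite e.
Qed.

Lemma multisum_rot F Ns Ms s : symfun F -> multisum F (Ns ++ Ms) s = multisum (multisum F Ns) Ms s.
Proof. by move=> Fs; rewrite (multisum_perm _ Fs (permEl (perm_catC _ _))) multisum_cat. Qed.

Lemma eq_multisum (P : pred nat) F G Ms s :
    (forall s', all P s' -> F s' = G s') -> all (all P) Ms -> all P s ->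
  multisum F Ms s = multisum G Ms s.
Proof.
move=> FG; elim: Ms s => [|M Ms IH] s /=; first by move=> _; apply: FG.
move=> /andP [PM PMs] Ps; rewrite !big_seq; apply: eq_bigr => i iM.
by apply: IH => //=; rewrite (allP PM).
Qed.

Lemma multisum_lin a b F G Ms s :
  multisum (fun s' => a * F s' + b * G s') Ms s = a * multisum F Ms s + b * multisum G Ms s.
Proof.
elim: Ms s => //= M Ms IH s; rewrite !mulr_sumr -big_split.
by apply: eq_bigr => i _; rewrite IH.
Qed.

Definition szprod s : R := (\prod_(i <- s) i)%:R.

Lemma szprod_cons i s : szprod (i :: s) = i%:R * szprod s.
Proof. by rewrite /szprod big_cons natrM. Qed.

Lemma multisum_szprod Ms s : multisum szprod Ms s = (\prod_(M <- Ms) (sumn M)%:R) * szprod s.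
Proof.
elim: Ms s => [|M Ms IH] s /=; first by rewrite big_nil mul1r.
under eq_bigr do rewrite IH szprod_cons mulrCA.
by rewrite -mulr_suml big_cons sumnE natr_sum mulrA.
Qed.

End Multilinear.

Section Brackets.
Variables (K : fieldType) (p : nat).
Hypothesis pK : p \in [pchar K].
Implicit Types (s : seq nat) (Ms : seq (seq nat)).

Definition tblocksQ s : rat := (tblocks K s)%:R.

(** The number of indecomposable summands in excess of what a free module over
    [K[T] / T^Q] of the same dimension would have. *)
Definition excess Q s : rat := tblocksQ s - szprod rat s / Q%:R.

Lemma tblocksQ_sym : symfun tblocksQ.
Proof. by move=> s s' ss'; rewrite /tblocksQ (tblocks_perm _ ss'). Qed.

Lemma szprod_sym : symfun (szprod rat).
Proof. by move=> s s' ss'; rewrite /szprod (perm_big _ ss'). Qed.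

Lemma excess_sym Q : symfun (excess Q).
Proof. by move=> s s' ss'; rewrite /excess (tblocksQ_sym ss') (szprod_sym ss'). Qed.

Lemma multisum_excess Q Ms s : multisum (excess Q) Ms s = multisum tblocksQ Ms s - multisum (szprod rat) Ms s / Q%:R.
Proof.
transitivity (multisum (fun s' => 1 * tblocksQ s' + (- Q%:R^-1) * szprod rat s') Ms s).
  apply: (@eq_multisum _ predT) => [s' _||]; last exact: all_predT.
    by rewrite /excess mul1r mulNr [_ / _]mulrC.
  by apply/allP => M _; apply: all_predT.
by rewrite multisum_lin mul1r mulNr [_ / _]mulrC.
Qed.

Let p_gt0 e : (0 < p ^ e)%N.
Proof. by rewrite expn_gt0 prime_gt0 // (pcharf_prime pK). Qed.

Lemma tblocksQ_full e i s : all (leq^~ (p ^ e)%N) s -> (p ^ e <= i)%N -> tblocksQ (i :: s) = szprod rat s.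
Proof. by move=> sq qi; rewrite /tblocksQ (tblocks_full (deltas_nil pK sq)). Qed.

Lemma excess_full e s : all (leq^~ (p ^ e)%N) s -> excess (p ^ e) (p ^ e :: s)%N = 0.
Proof.
move=> sq; rewrite /excess (tblocksQ_full sq) // szprod_cons mulrAC mulfV ?mul1r ?subrr //.
by rewrite pnatr_eq0 -lt0n.
Qed.

Lemma excess0 Q s : excess Q (0%N :: s) = 0.
Proof.
rewrite /excess szprod_cons mul0r mul0r subr0 /tblocksQ tblocks_cons.
apply/eqP; rewrite pnatr_eq0 dimv_eq0; apply/eqP/vspaceP => v.
by rewrite memv_ker endopowE memv0.
Qed.

(** The correction terms of [tblocks_reflection] are exactly the change of
    [(\prod s) / Q]. *)
Lemma excess_reflection e i j s (Q := (p ^ e)%N) : all (leq^~ Q) s -> (i <= Q)%N ->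
  (j <= Q)%N -> excess Q [:: Q - i, Q - j & s]%N = excess Q [:: i, j & s].
Proof.
move=> sq iq jq; have := tblocks_reflection pK sq iq jq; rewrite -/Q.
move/(congr1 (fun n => n%:R : rat)); rewrite !natrD !natrM -/(tblocksQ _) -/(tblocksQ _).
rewrite natrD -/(szprod rat s) => h.
rewrite /excess !szprod_cons !natrB //.
have Q0 : Q%:R != 0 :> rat by rewrite pnatr_eq0 -lt0n p_gt0.
have -> : tblocksQ [:: Q - i, Q - j & s]%N = tblocksQ [:: i, j & s] + Q%:R * szprod rat s
    - (i%:R + j%:R) * szprod rat s by rewrite -h addrK.
by field.
Qed.

(** The block of size [Q - i] is so long that [tblocksQ_full] applies to it. *)
Lemma excess_low e i s Q : all (leq^~ (p ^ e)%N) s -> (i <= p ^ e)%N ->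
  (2 * p ^ e <= Q)%N -> excess Q (i :: s) + excess Q (Q - i :: s)%N = tblocksQ (i :: s).
Proof.
move=> sq iq qQ; have e0 := p_gt0 e.
rewrite /excess (tblocksQ_full (i := Q - i) sq); last by lia.
rewrite !szprod_cons natrB; last by lia.
have Q0 : Q%:R != 0 :> rat by rewrite pnatr_eq0; lia.
by field.
Qed.

End Brackets.

Section SizeLists.
Implicit Types (s M : seq nat) (Ms : seq (seq nat)).
Local Notation le n := (leq^~ n).

Lemma all_leW m n s : (m <= n)%N -> all (le m) s -> all (le n) s.
Proof. by move=> mn; apply: sub_all => i /leq_trans; apply. Qed.

Lemma xysizes_le q : all (le q) (xysizes q).
Proof.
by apply/allP => i; rewrite inE mem_cat !mem_iota; lia.
Qed.

Lemma sumn_iota1 n : (sumn (iota 1 n) * 2 = n * n.+1)%N.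
Proof.
elim: n => // n IH; rewrite -[in iota _ _](addn1 n) iotaD sumn_cat mulnDl IH /=; lia.
Qed.

Lemma sumn_xysizes q : (0 < q)%N -> sumn (xysizes q) = (q * q)%N.
Proof.
case: q => // q _; rewrite /xysizes /= sumn_cat.
have := sumn_iota1 q; lia.
Qed.

Lemma big_xysizes (R : nmodType) (F : nat -> R) q :
  \sum_(i <- xysizes q) F i = F q + (\sum_(i <- iota 1 q.-1) F i) *+ 2.
Proof. by rewrite big_cons big_cat mulr2n. Qed.

Lemma sum_iota_rev (R : nmodType) (F : nat -> R) n m :
  \sum_(i <- iota 1 n) F (m + n.+1 - i)%N = \sum_(i <- iota m.+1 n) F i.
Proof.
elim: n m => [|n IH] m; first by rewrite !big_nil.
rewrite -[in LHS](addn1 n) iotaD big_cat big_seq1 [RHS]big_cons addrC; congr (_ + _).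
  by rewrite -IH; apply: eq_big_seq => i; rewrite mem_iota => h; congr (F _); lia.
by congr (F _); lia.
Qed.

Lemma multisum_szprod_nseq (R : comPzRingType) n M Ms s :
  multisum (@szprod R) (nseq n M ++ Ms) s = (sumn M)%:R ^+ n * multisum (@szprod R) Ms s.
Proof.
rewrite !multisum_szprod big_cat mulrA /=; congr (_ * _ * _).
by elim: n => [|n IH]; rewrite ?big_nil ?expr0 //= big_cons IH exprS.
Qed.

Lemma multisum_cons (R : comPzRingType) (F : seq nat -> R) M Ms s :
  multisum F (M :: Ms) s = \sum_(i <- M) multisum F Ms (i :: s).
Proof. by []. Qed.

Lemma multisum_split (R : comPzRingType) (F G H : seq nat -> R) a b q Ns Ms s :
    (forall s', all (le q) s' -> multisum F Ns s' = a * G s' + b * H s') ->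
    symfun F -> all (all (le q)) Ms -> all (le q) s ->
  multisum F (Ns ++ Ms) s = a * multisum G Ms s + b * multisum H Ms s.
Proof.
by move=> FG sF Mq sq; rewrite multisum_rot // (eq_multisum FG) // multisum_lin.
Qed.

Lemma big_xysizes_double (F : nat -> rat) q : (0 < q)%N ->
  \sum_(i <- xysizes (2 * q)) F i =
  \sum_(i <- xysizes q) F i + \sum_(i <- xysizes q) F (2 * q - i)%N + F (2 * q)%N.
Proof.
move=> q0; rewrite !big_xysizes.
have -> : ((2 * q).-1 = q.-1 + (1 + q.-1))%N by lia.
rewrite iotaD big_cat iotaD big_cat big_seq1 /=.
have -> : (1 + q.-1 + 1 = q.+1)%N by lia.
have <- : \sum_(i <- iota 1 q.-1) F (2 * q - i)%N = \sum_(i <- iota q.+1 q.-1) F i.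
  rewrite -(sum_iota_rev F q.-1 q); apply: eq_big_seq => i; rewrite mem_iota => h.
  by congr (F _); lia.
have -> : (1 + q.-1 = q)%N by lia.
have -> : (2 * q - q = q)%N by lia.
by rewrite !mulr2n; ring.
Qed.

End SizeLists.

Section Reflections.
Variables (K : fieldType) (p : nat).
Hypothesis pK : p \in [pchar K].
Implicit Types (s M : seq nat) (Ms : seq (seq nat)).
Local Notation tblocksQ := (tblocksQ K).
Local Notation excess := (excess K).
Local Notation le n := (leq^~ n).

(** The list is stable under complements in [p^e], apart from [p^e] and [0], where
    the excess vanishes. *)
Lemma big_xysizes_reflect e s : all (le (p ^ e)%N) s ->
  \sum_(i <- xysizes (p ^ e)) excess (p ^ e) (p ^ e - i :: s)%N =
  \sum_(i <- xysizes (p ^ e)) excess (p ^ e) (i :: s).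
Proof.
move=> sq; rewrite !big_xysizes subnn excess0 (excess_full pK sq); congr (_ + _ *+ _).
case: (p ^ e)%N => [|q]; first by rewrite !big_nil.
by have /= := sum_iota_rev (fun i => excess q.+1 (i :: s)) q 0.
Qed.

(** Reflect [i] together with [j], then use the symmetry of the list of the [j]. *)
Lemma xysizes_excess_reflect e i s : all (le (p ^ e)%N) s -> (i <= p ^ e)%N ->
  \sum_(j <- xysizes (p ^ e)) excess (p ^ e) [:: j, p ^ e - i & s]%N =
  \sum_(j <- xysizes (p ^ e)) excess (p ^ e) [:: j, i & s].
Proof.
move=> sq iq; rewrite -big_xysizes_reflect /= ?leq_subr //.
apply: eq_big_seq => j /(allP (xysizes_le _)) jq.
exact: (excess_reflection pK).
Qed.

Lemma perm_nseq_mid n M Ms : perm_eq (nseq n M ++ M :: Ms) (nseq n.+1 M ++ Ms).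
Proof. by apply/permP => P; rewrite /= !count_cat /= addnCA. Qed.

(** * From q to 2q in characteristic 2 *)

Section Doubling.
Hypothesis p2 : p = 2%N.
Variable e : nat.
Local Notation q := (p ^ e)%N.
Local Notation Q := (p ^ e.+1)%N.

Let Qq : Q = (2 * q)%N. Proof. by rewrite expnS p2. Qed.
Let q0 : (0 < q)%N. Proof. by rewrite expn_gt0 p2. Qed.

Lemma excess_xysizes_double1 s : all (le q) s -> multisum (excess Q) [:: xysizes Q] s = multisum tblocksQ [:: xysizes q] s.
Proof.
move=> sq; have sQ : all (le Q) s by apply: all_leW sq; rewrite Qq; lia.
rewrite /= {1}Qq big_xysizes_double // -Qq (excess_full pK) // addr0 -big_split.
apply: eq_big_seq => i /(allP (xysizes_le _)) iq.
by rewrite /= (excess_low pK sq) // Qq.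
Qed.

(** The large sizes of the first list are reflected against the second list, which
    is symmetric. *)
Lemma excess_xysizes_double2 s : all (le Q) s ->
  multisum (excess Q) [:: xysizes Q; xysizes Q] s = 2%:R * multisum (excess Q) [:: xysizes q; xysizes Q] s.
Proof.
move=> sQ; rewrite /= {1}Qq big_xysizes_double // -Qq.
rewrite [X in _ + X]big1_seq => [|j /andP [_ /(allP (xysizes_le _)) jQ]]; last first.
  rewrite (@excess_sym _ _ _ [:: Q, j & s]); last exact: (permEl (perm_catCA [:: j] [:: Q] s)).
  by apply: (excess_full pK); rewrite /= jQ.
rewrite addr0 mulr_natl mulr2n; congr (_ + _).
apply: eq_big_seq => i /(allP (xysizes_le _)) iq.
by rewrite xysizes_excess_reflect // (leq_trans iq) // Qq; lia.
Qed.

(** [excess_xysizes_double2] brings one list after the other from [Q] to [q]; the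
    last one is left to [excess_xysizes_double1]. *)
Lemma excess_xysizes_doubling k Ms s : all (all (le q)) Ms -> all (le q) s ->
  multisum (excess Q) (nseq k.+1 (xysizes Q) ++ Ms) s =
  2%:R ^+ k * multisum tblocksQ (nseq k.+1 (xysizes q) ++ Ms) s.
Proof.
have qQ : (q <= Q)%N by rewrite Qq; lia.
elim: k Ms => [|k IH] Ms Mq sq.
  rewrite expr0 mul1r !multisum_rot; [|exact: tblocksQ_sym|exact: excess_sym].
  by apply: (eq_multisum (P := le q)) => // s' sq'; apply: excess_xysizes_double1.
have MQ : all (all (le Q)) (nseq k (xysizes Q) ++ Ms).
  rewrite all_cat all_nseq xysizes_le orbT /=.
  by apply: sub_all Mq => M; apply: all_leW.
transitivity (2%:R * multisum (excess Q) ([:: xysizes q; xysizes Q] ++ (nseq k (xysizes Q) ++ Ms)) s).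
  pose G := multisum (excess Q) [:: xysizes q; xysizes Q].
  have GE s' : all (le Q) s' -> multisum (excess Q) [:: xysizes Q; xysizes Q] s' = 2%:R * G s' + 0 * G s'.
    by move=> sQ'; rewrite mul0r addr0; apply: excess_xysizes_double2.
  have -> := multisum_split GE (@excess_sym K Q) MQ (all_leW qQ sq).
  by rewrite mul0r addr0 /G -multisum_rot //; exact: excess_sym.
rewrite exprS -mulrA; congr (_ * _).
rewrite (multisum_perm (Ns := nseq k.+1 (xysizes Q) ++ (xysizes q :: Ms))); last 2 first.
- exact: excess_sym.
- by apply/permP => P; rewrite /= !count_cat /= addnCA; congr addn; rewrite addnCA.
rewrite IH //; last by apply/andP; split=> //; apply: xysizes_le.
congr (_ * _); apply: (multisum_perm (Ms := nseq k.+1 _ ++ _)); first exact: tblocksQ_sym.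
exact: perm_nseq_mid.
Qed.

End Doubling.
End Reflections.

(** The sizes of the blocks of [x^k] on [K[x] / x^q]. *)
Definition powsizes k q : seq nat := [seq ((q + (k.-1 - r)) %/ k)%N | r <- iota 0 k].

Lemma nblocks_powsizes (K : fieldType) k q c (X : kmod K) : c != 0 -> (0 < k)%N -> (0 < q)%N ->
  nblocks (tens (@powstep k q) c X) = (\sum_(i <- powsizes k q) nblocks (delta i X))%N.
Proof.
move=> c0 k0 q0; rewrite nblocks_pow // big_map.
by apply: eq_bigr => i _; rewrite nblocks_delta.
Qed.

Lemma sumn_powsizes2 q : sumn (powsizes 2 q) = q.
Proof. rewrite /powsizes /=; lia. Qed.

Lemma sumn_powsizes3 q : sumn (powsizes 3 q) = q.
Proof. rewrite /powsizes /=; lia. Qed.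

Lemma sumn_iotaD a b n : sumn (iota (a + b) n) = (n * a + sumn (iota b n))%N.
Proof. by elim: n b => //= n IH b; rewrite -addnS IH; lia. Qed.

(** * From q to 3q in characteristic 3 *)

Section CharThree.
Variables (K : fieldType).
Hypothesis pK : 3 \in [pchar K].
Variable e : nat.
Implicit Types (s M : seq nat) (Ms : seq (seq nat)).
Local Notation tblocksQ := (tblocksQ K).
Local Notation excess := (excess K).
Local Notation le n := (leq^~ n).
Local Notation q := (3 ^ e)%N.
Local Notation Q := (3 ^ e.+1)%N.
Local Notation A := (powsizes 2 q).
Local Notation A3 := (powsizes 2 Q).

Let q0 : (0 < q)%N. Proof. by rewrite expn_gt0. Qed.
Let Qq : Q = (3 * q)%N. Proof. by rewrite expnS. Qed.

Let two_neq0 : 2%:R != 0 :> K.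
Proof.
apply/eqP => h2; have : 2%:R + 1 = 0 :> K by rewrite natr1; apply: pcharf0 pK.
by rewrite h2 add0r => /eqP; rewrite oner_eq0.
Qed.

(** The number of blocks in [nblocks_powsizes] does not depend on the scalar, so
    that [u^2 + v^2] may be replaced with [u^2 - v^2]. *)
Lemma sum_two_squares k s : (0 < k)%N ->
  (\sum_(i <- powsizes 2 (k * q)) \sum_(j <- powsizes 2 q) tblocks K [:: j, i & s] =
   nblocks (tens (@diagstep (k * q) q) 1 (deltas K s)))%N.
Proof.
move=> k0; rewrite (nblocks_iso (change_of_coordinates (deltas K s) e pK two_neq0 k0)).
rewrite nblocks_powsizes ?oner_neq0 // ?muln_gt0 ?k0 //.
apply: eq_bigr => i _; rewrite (nblocks_iso (tens_swap _ _ _ _ _)).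
by rewrite nblocks_powsizes // oppr_eq0 oner_neq0.
Qed.

Lemma tblocksQ_square s : multisum tblocksQ [:: A; A] s = multisum tblocksQ [:: xysizes q] s.
Proof.
have /= := sum_two_squares s (ltn0Sn 0); rewrite mul1n nblocks_diag_square ?oner_neq0 // => h.
rewrite /= -!natr_sum; under eq_bigr do rewrite -natr_sum.
rewrite -natr_sum h; congr _%:R.
by apply: eq_bigr => i _; rewrite tblocks_cons.
Qed.

Lemma tblocksQ_mixed s : multisum tblocksQ [:: A3; A] s = multisum tblocksQ [:: midsizes q] s.
Proof.
have := sum_two_squares s (ltn0Sn 2); rewrite nblocks_diag_mid ?oner_neq0 // -Qq => h.
rewrite /= -!natr_sum; under eq_bigr do rewrite -natr_sum.
rewrite -natr_sum h; congr _%:R.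
by apply: eq_bigr => i _; rewrite tblocks_cons.
Qed.

Lemma excess_mixed Q' s : multisum (excess Q') [:: A3; A] s = multisum (excess Q') [:: midsizes q] s.
Proof.
rewrite !multisum_excess tblocksQ_mixed !multisum_szprod !big_cons !big_nil !sumn_powsizes2 !mulr1 -natrM.
congr (_ - _%:R * _ / _); rewrite /midsizes /= sumn_cat Qq.
have -> : sumn (iota q.+1 q.-1) = (q.-1 * q + sumn (iota 1 q.-1))%N.
  by rewrite -[q.+1]addn1 sumn_iotaD.
by have := sumn_iota1 q.-1; move: q0; case: (3 ^ e)%N => //= n _; lia.
Qed.

End CharThree.

Lemma excess_square (K : fieldType) (pK : 3 \in [pchar K]) e Q s :
  multisum (excess K Q) [:: powsizes 2 (3 ^ e); powsizes 2 (3 ^ e)] s = multisum (excess K Q) [:: xysizes (3 ^ e)] s.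
Proof.
rewrite !multisum_excess tblocksQ_square // !multisum_szprod !big_cons !big_nil !sumn_powsizes2 !mulr1 -natrM.
by rewrite sumn_xysizes // expn_gt0.
Qed.

Lemma big_xysizes_triple (F : nat -> rat) q : (0 < q)%N ->
  \sum_(i <- xysizes (3 * q)) F i =
  \sum_(i <- xysizes q) F i + \sum_(i <- midsizes q) F i +
  \sum_(i <- xysizes q) F (3 * q - i)%N + F (3 * q)%N.
Proof.
move=> q0; rewrite !big_xysizes /midsizes !big_cons big_cat.
have -> : ((3 * q).-1 = q.-1 + (1 + (q.-1 + (1 + q.-1))))%N by lia.
rewrite 4!iotaD !big_cat !big_seq1 /=.
have -> : (1 + q.-1 + 1 = q.+1)%N by lia.
have -> : (q.+1 + q.-1 + 1 = q.*2.+1)%N by lia.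
have <- : \sum_(i <- iota 1 q.-1) F (3 * q - i)%N = \sum_(i <- iota q.*2.+1 q.-1) F i.
  rewrite -(sum_iota_rev F q.-1 q.*2); apply: eq_big_seq => i; rewrite mem_iota => h.
  by congr (F _); lia.
have -> : (1 + q.-1 = q)%N by lia.
have -> : (q.+1 + q.-1 = q.*2)%N by lia.
have -> : (3 * q - q = q.*2)%N by lia.
by rewrite !mulr2n; ring.
Qed.

(** The Jacobsthal numbers 0, 1, 1, 3, 5, 11, 21. *)
Definition jacobsthal n : rat := (2%:R ^+ n - (-1) ^+ n) / 3%:R.

Lemma jacobsthal_rec n : jacobsthal n.+2 = jacobsthal n.+1 + 2%:R * jacobsthal n.
Proof. by rewrite /jacobsthal !exprS; field. Qed.

Lemma jacobsthal0 : jacobsthal 0 = 0.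
Proof. by rewrite /jacobsthal !expr0 subrr mul0r. Qed.

Lemma jacobsthal1 : jacobsthal 1 = 1.
Proof. by rewrite /jacobsthal !expr1; field. Qed.

Section Tripling.
Variables (K : fieldType).
Hypothesis pK : 3 \in [pchar K].
Variable e : nat.
Implicit Types (s M : seq nat) (Ms : seq (seq nat)).
Local Notation tblocksQ := (tblocksQ K).
Local Notation excess := (excess K).
Local Notation le n := (leq^~ n).
Local Notation q := (3 ^ e)%N.
Local Notation Q := (3 ^ e.+1)%N.
Local Notation A := (powsizes 2 q).
Local Notation A3 := (powsizes 2 Q).

Let q0 : (0 < q)%N. Proof. by rewrite expn_gt0. Qed.
Let Qq : Q = (3 * q)%N. Proof. by rewrite expnS. Qed.

Lemma powsizes2_odd n : odd n -> powsizes 2 n = [:: n./2.+1; n./2].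
Proof. by move=> on; rewrite /powsizes /=; congr [:: _; _]; lia. Qed.

Let A3E : A3 = [:: Q./2.+1; Q./2].
Proof. by apply: powsizes2_odd; rewrite oddX orbT. Qed.

Let Qodd : odd Q. Proof. by rewrite oddX orbT. Qed.

Lemma powsizes2_le n : (0 < n)%N -> all (le n) (powsizes 2 n).
Proof. rewrite /powsizes /=; lia. Qed.

(** Both sizes of [A3] are at least [q]. *)
Lemma excess_A3_1 s : all (le q) s -> multisum (excess Q) [:: A3] s = szprod rat s.
Proof.
move=> sq; rewrite /= A3E big_cons big_seq1 /excess.
have lt : (q <= Q./2)%N by have := Qodd; rewrite Qq; lia.
rewrite !(tblocksQ_full pK sq) ?(leqW lt) // !szprod_cons.
have -> : Q./2.+1%:R = Q%:R - Q./2%:R :> rat.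
  by rewrite -natrB; [congr _%:R | ]; have := Qodd; lia.
have Q0 : Q%:R != 0 :> rat by rewrite pnatr_eq0 -lt0n expn_gt0.
by field.
Qed.

(** Two squares are one [xy], whose sizes at [3q] are those at [q], the sizes that
    belong to squares at [3q] and at [q], the complements of the former, and [3q]. *)
Lemma excess_A3_2 s : all (le Q) s ->
  multisum (excess Q) [:: A3; A3] s = multisum (excess Q) [:: A3; A] s +
   (\sum_(i <- xysizes q) excess Q (i :: s) + \sum_(i <- xysizes q) excess Q (Q - i :: s)%N).
Proof.
move=> sQ; rewrite excess_square // excess_mixed // /= {1}Qq big_xysizes_triple // -Qq.
by rewrite (excess_full pK) // addr0 -addrA addrCA.
Qed.

Lemma excess_A3_low s : all (le q) s ->
  multisum (excess Q) [:: A3; A3] s = multisum (excess Q) [:: A3; A] s + multisum tblocksQ [:: A; A] s.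
Proof.
move=> sq; rewrite excess_A3_2; last by apply: all_leW sq; rewrite Qq; lia.
congr (_ + _); rewrite -big_split tblocksQ_square //.
apply: eq_big_seq => i /(allP (xysizes_le _)) iq.
by rewrite /= (excess_low pK sq) // Qq leq_mul2r orbT.
Qed.

(** [A3] is symmetric about [Q / 2], so that the large sizes of the product of the
    first two factors can be reflected against it. *)
Lemma excess_A3_3 s : all (le Q) s ->
  multisum (excess Q) [:: A3; A3; A3] s =
  multisum (excess Q) [:: A3; A3; A] s + 2%:R * multisum (excess Q) [:: A3; A; A] s.
Proof.
move=> sQ; rewrite multisum_cons [multisum _ [:: A3; A3; A] s]multisum_cons [multisum _ [:: A3; A; A] s]multisum_cons.
have A3Q j : j \in A3 -> (j <= Q)%N by move=> jA; apply: (allP (powsizes2_le _)); rewrite ?expn_gt0.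
under eq_big_seq => j jA do rewrite excess_A3_2 /= ?A3Q //.
rewrite big_split; congr (_ + _); rewrite big_split mulr_natl mulr2n /=; congr (_ + _).
  by apply: eq_bigr => j _; rewrite -[RHS]/(multisum (excess Q) [:: A; A] (j :: s)) excess_square.
transitivity (\sum_(j <- A3) \sum_(i <- xysizes q) excess Q [:: i, Q - j & s]%N).
  apply: eq_big_seq => j jA; apply: eq_big_seq => i /(allP (xysizes_le _)) iq.
  have iQ : (i <= Q)%N by rewrite (leq_trans iq) // Qq; lia.
  by rewrite -(excess_reflection pK sQ (leq_subr i Q) (A3Q j jA)) subKn.
transitivity (\sum_(j <- A3) \sum_(i <- xysizes q) excess Q [:: i, j & s]%N).
  rewrite A3E [LHS]big_cons [RHS]big_cons !big_seq1 [LHS]addrC.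
  by congr (_ + _); apply: eq_bigr => i _; congr (excess Q [:: i, _ & s]);
    have := Qodd; lia.
by apply: eq_bigr => j _; rewrite -[RHS]/(multisum (excess Q) [:: A; A] (j :: s)) excess_square.
Qed.

(** For [k] factors at [Q] and the other ones at [q], [excess_A3_3] is the recursion
    [t_(k+2) = t_(k+1) + 2 t_k]; its first terms are given by [excess_A3_1] and
    [excess_A3_low]. *)
Lemma excess_tripling n Ms s : all (all (le q)) Ms -> all (le q) s ->
  multisum (excess Q) (nseq n.+1 A3 ++ Ms) s =
  jacobsthal n * multisum tblocksQ (nseq n.+1 A ++ Ms) s +
  jacobsthal n.+1 * q%:R ^+ n * multisum (szprod rat) Ms s.
Proof.
have qQ : (q <= Q)%N by rewrite Qq; lia.
have bs := @excess_sym K Q; have ds := @tblocksQ_sym K.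
elim/ltn_ind: n Ms => -[|[|n]] IH Ms Mq sq.
- rewrite jacobsthal0 jacobsthal1 mul0r add0r !mul1r.
  by rewrite !multisum_rot // (eq_multisum (G := szprod rat) _ Mq sq) // => s' sq'; apply: excess_A3_1.
- rewrite [LHS](@multisum_rot _ _ [:: A3; A3]) //.
  rewrite (eq_multisum (G := fun s' => 1 * multisum (excess Q) [:: A3; A] s' + 1 * multisum tblocksQ [:: A; A] s')
    _ Mq sq); last by move=> s' sq'; rewrite !mul1r; apply: excess_A3_low.
  rewrite multisum_lin !mul1r -!multisum_rot // (IH 0%N _ (A :: Ms)) //; last first.
    by apply/andP; split=> //; apply: powsizes2_le.
  rewrite -[multisum (szprod rat) (A :: Ms) s]/(multisum (szprod rat) (nseq 1 A ++ Ms) s) multisum_szprod_nseq sumn_powsizes2.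
  by rewrite jacobsthal0 jacobsthal1 mul0r add0r expr0 !mul1r addrC.
have MQ : all (all (le Q)) (nseq n A3 ++ Ms).
  rewrite all_cat all_nseq powsizes2_le ?expn_gt0 // orbT /=.
  by apply: sub_all Mq => M; apply: all_leW.
have AMq N : all (all (le q)) N -> all (all (le q)) (A :: N).
  by move=> Nq; apply/andP; split=> //; apply: powsizes2_le.
rewrite (_ : nseq n.+3 A3 ++ Ms = [:: A3; A3; A3] ++ (nseq n A3 ++ Ms)) //.
have -> := multisum_split (Ns := [:: A3; A3; A3]) (a := 1) (b := 2%:R)
  (fun s' sQ' => etrans (excess_A3_3 sQ') (congr1 (fun z => z + _) (esym (mul1r _)))) bs MQ (all_leW qQ sq).
rewrite mul1r -!multisum_rot //.
rewrite (multisum_perm (Ns := nseq n.+2 A3 ++ A :: Ms) _ bs); last first.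
  by apply/permP => P; rewrite /= !count_cat /=; lia.
rewrite (multisum_perm (Ms := [:: A3; A; A] ++ _) (Ns := nseq n.+1 A3 ++ [:: A, A & Ms]) _ bs); last first.
  by apply/permP => P; rewrite /= !count_cat /=; lia.
have Aq2 : all (all (le q)) [:: A, A & Ms] by apply/AMq/AMq.
rewrite (IH n.+1) ?(IH n) //; last exact: AMq.
rewrite -[multisum (szprod rat) (A :: Ms) s]/(multisum (szprod rat) (nseq 1 A ++ Ms) s).
rewrite -[multisum (szprod rat) [:: A, A & Ms] s]/(multisum (szprod rat) (nseq 2 A ++ Ms) s).
rewrite !multisum_szprod_nseq !sumn_powsizes2.
have e1 : multisum tblocksQ (nseq n.+2 A ++ A :: Ms) s = multisum tblocksQ (nseq n.+3 A ++ Ms) s.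
  by apply: multisum_perm => //; apply: perm_nseq_mid.
have e2 : multisum tblocksQ (nseq n.+1 A ++ [:: A, A & Ms]) s = multisum tblocksQ (nseq n.+3 A ++ Ms) s.
  apply: multisum_perm => //; apply: perm_trans (perm_nseq_mid _ _ _) _.
  exact: perm_nseq_mid.
rewrite e1 e2 (jacobsthal_rec n.+1) (jacobsthal_rec n) !exprS; ring.
Qed.

End Tripling.

(** * Contracting equations for power series *)

Local Open Scope classical_set_scope.

Section Order.
Variables (n : nat) (K : fieldType).
Local Notation S := (mpseries n K).
Implicit Types (f g h : S) (a b : expo n).

Definition edeg a : nat := (\sum_i a i)%N.

Lemma expo_sub_deg a b : expo_le b a -> edeg a = (edeg b + edeg (expo_sub a b))%N.
Proof.
move=> /forallP ba; rewrite /edeg -big_split; apply: eq_bigr => i _.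
by rewrite ffunE /= subnKC.
Qed.

Lemma edeg_eq0 a : edeg a = 0%N -> a = expo0 n.
Proof.
move=> /eqP; rewrite sum_nat_eq0 => /forallP a0; apply/ffunP => i.
by rewrite ffunE; apply/eqP/a0.
Qed.

Definition ord_ge k f : Prop := forall a, (edeg a < k)%N -> coefps f a = 0.

Lemma ord_ge0 f : ord_ge 0 f. Proof. by []. Qed.

Lemma ord_geW k l f : (l <= k)%N -> ord_ge k f -> ord_ge l f.
Proof. by move=> lk fk a al; apply: fk; apply: leq_trans lk. Qed.

Lemma ord_ge_zero k : ord_ge k 0. Proof. by []. Qed.

Lemma ord_geD k f g : ord_ge k f -> ord_ge k g -> ord_ge k (f + g).
Proof. by move=> fk gk a al; rewrite [LHS]/= fk // gk // addr0. Qed.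

Lemma ord_geN k f : ord_ge k f -> ord_ge k (- f).
Proof. by move=> fk a al; rewrite [LHS]/= fk // oppr0. Qed.

Lemma ord_geB k f g : ord_ge k f -> ord_ge k g -> ord_ge k (f - g).
Proof. by move=> fk gk; apply/ord_geD/ord_geN. Qed.

Lemma ord_ge_sum k (I : Type) (r : seq I) (P : pred I) (F : I -> S) :
  (forall i, P i -> ord_ge k (F i)) -> ord_ge k (\sum_(i <- r | P i) F i).
Proof. by move=> Fk; elim/big_rec: _ => // i f Pi fk; apply/ord_geD/fk/Fk. Qed.

Lemma ord_geM k l f g : ord_ge k f -> ord_ge l g -> ord_ge (k + l) (f * g).
Proof.
move=> fk gl a al; rewrite [LHS]/= big_seq big1 // => b; rewrite mem_expo_below => ba.
move: al; rewrite (expo_sub_deg ba) => al.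
case: (ltnP (edeg b) k) => bk; first by rewrite fk // mul0r.
by rewrite gl ?mulr0 //; lia.
Qed.

Lemma ord_geMl k f g : ord_ge k g -> ord_ge k (f * g).
Proof. by move=> gk; rewrite -[k]add0n; apply: ord_geM. Qed.

Lemma ord_ge1P f : ord_ge 1 f <-> const_term f = 0.
Proof.
split=> [f1|f0 a]; first by apply: f1; rewrite /edeg big1 // => i _; rewrite ffunE.
by rewrite ltnS leqn0 => /eqP /edeg_eq0 ->.
Qed.

Lemma ord_ge_inf f : (forall k, ord_ge k f) -> f = 0.
Proof. by move=> fk; apply: mpsP => a; apply: (fk (edeg a).+1). Qed.

(** The equations [h g = c g + \sum_i y_i h (q_i g)] have a unique solution by
    iteration, as the right-hand side is contracting for the [m]-adic topology. *)
Fixpoint approx (I : finType) (G : Type) (y : I -> S) (c : G -> S) (q : I -> G -> G)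
    (k : nat) (g : G) : S :=
  if k is k'.+1 then c g + \sum_i y i * approx y c q k' (q i g) else 0.

Lemma approxS (I : finType) (G : Type) (y : I -> S) (c : G -> S) (q : I -> G -> G)
    k (g : G) :
  approx y c q k.+1 g = c g + \sum_i y i * approx y c q k (q i g).
Proof. by []. Qed.

Definition solution (I : finType) (G : Type) (y : I -> S) (c : G -> S)
    (q : I -> G -> G) (g : G) : S :=
  MPSeries (fun a => coefps (approx y c q (edeg a).+1 g) a).

Section Contraction.
Variables (I : finType) (G : Type) (y : I -> S) (q : I -> G -> G).
Hypothesis y1 : forall i, ord_ge 1 (y i).

Lemma contraction_ord (D : G -> S) k :
  (forall g : G, ord_ge k (D g - \sum_i y i * D (q i g))) -> forall g : G, ord_ge k (D g).
Proof.
move=> Dk; have D' l : (l <= k)%N -> forall g : G, ord_ge l (D g).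
  elim: l => [|l IH] lk g; first exact: ord_ge0.
  rewrite -[D g](subrK (\sum_i y i * D (q i g))); apply: ord_geD.
    exact: ord_geW (Dk g).
  apply: ord_ge_sum => i _; rewrite -add1n; apply: ord_geM => //.
  by apply: IH; apply: ltnW.
exact: D'.
Qed.

Lemma contraction_eq0 (D : G -> S) :
  (forall g : G, D g = \sum_i y i * D (q i g)) -> forall g : G, D g = 0.
Proof.
move=> DE g; apply: ord_ge_inf => k; apply: contraction_ord => g'.
by rewrite -DE subrr.
Qed.

Lemma approx_cauchy c k l (g : G) : (k <= l)%N ->
  ord_ge k (approx y c q l g - approx y c q k g).
Proof.
elim: k l g => [|k IH] [|l] g kl //=; rewrite opprD addrACA subrr add0r -sumrB.
apply: ord_ge_sum => i _; rewrite -mulrBr -add1n.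
by apply: ord_geM => //; apply: IH.
Qed.

Lemma solution_approx c k (g : G) : ord_ge k (solution y c q g - approx y c q k g).
Proof.
move=> a al; have /(_ a (ltnSn _)) /= := approx_cauchy c (k := (edeg a).+1) (l := k) g al.
by move=> /eqP; rewrite subr_eq0 => /eqP ->; rewrite subrr.
Qed.

Lemma solutionE c (g : G) :
  solution y c q g = c g + \sum_i y i * solution y c q (q i g).
Proof.
apply/eqP; rewrite -subr_eq0; apply/eqP/ord_ge_inf => -[|k]; first exact: ord_ge0.
rewrite -(subrK (approx y c q k.+1 g) (solution y c q g)) -addrA.
apply: ord_geD; first exact: solution_approx.
rewrite /= opprD addrACA subrr add0r -sumrB; apply: ord_ge_sum => i _.
rewrite -mulrBr -add1n; apply: ord_geM => //.
by rewrite -opprB; apply/ord_geN/solution_approx.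
Qed.

End Contraction.

End Order.

(** * Evaluation of power series *)

Section Coefficients.
Variables (n : nat) (K : fieldType).
Local Notation S := (mpseries n K).
Implicit Types (f g h : S) (a b : expo n) (i j : 'I_n) (c : K).

Definition mpsC c : S := MPSeries (fun a => if a == expo0 n then c else 0).

Lemma expo_sub0 a : expo_sub a (expo0 n) = a.
Proof. by apply/ffunP => i; rewrite !ffunE subn0. Qed.

Lemma coefps_sum (I : Type) (r : seq I) (P : pred I) (F : I -> S) a :
  coefps (\sum_(i <- r | P i) F i) a = \sum_(i <- r | P i) coefps (F i) a.
Proof. by elim/big_rec2: _ => // i x f _ <-. Qed.

Lemma coefpsCM c f a : coefps (mpsC c * f) a = c * coefps f a.
Proof.
rewrite [LHS]/= (bigD1_seq (expo0 n)) ?expo_below_uniq //=; last first.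
  by rewrite mem_expo_below; apply/forallP => i; rewrite ffunE.
rewrite eqxx expo_sub0 big1 ?addr0 // => b /negPf ->; by rewrite mul0r.
Qed.

Lemma coefpsXM i f a :
  coefps (mpsX i * f) a = if (0 < a i)%N then coefps f (expo_sub a (expo1 i)) else 0.
Proof.
rewrite [LHS]/=; case: ifP => ai.
  rewrite (bigD1_seq (expo1 i)) ?expo_below_uniq //=; last first.
    rewrite mem_expo_below; apply/forallP => j; rewrite ffunE.
    by case: eqP => // ->.
  by rewrite eqxx mul1r big1 ?addr0 // => b /negPf ->; rewrite mul0r.
rewrite big_seq big1 // => b; rewrite mem_expo_below => /forallP /(_ i) ba.
case: eqP => [bi|]; last by rewrite mul0r.
by move: ba; rewrite bi ffunE eqxx ai.
Qed.

Lemma mpsCD c d : mpsC (c + d) = mpsC c + mpsC d.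
Proof. by apply: mpsP => a /=; case: eqP => // _; rewrite addr0. Qed.

Lemma mpsCM c d : mpsC (c * d) = mpsC c * mpsC d.
Proof. by apply: mpsP => a; rewrite coefpsCM /=; case: eqP => // _; rewrite mulr0. Qed.

Lemma mpsC0 : mpsC 0 = 0.
Proof. by apply: mpsP => a /=; case: eqP. Qed.

Lemma mpsC1 : mpsC 1 = 1.
Proof. by apply: mpsP => a /=; case: eqP. Qed.

Lemma const_termC c : const_term (mpsC c) = c.
Proof. by rewrite /const_term /= eqxx. Qed.

Definition firstvar i a : bool := [forall j : 'I_n, (j < i)%N ==> (a j == 0%N)].

(** Taking the first variable of each monomial makes the decomposition [mps_decomp]
    unique, and linear in the series. *)
Definition divX i f : S :=
  MPSeries (fun a => if firstvar i a then coefps f (expo_add a (expo1 i)) else 0).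

Lemma coefps_divX i f a : coefps (divX i f) a =
  if firstvar i a then coefps f (expo_add a (expo1 i)) else 0.
Proof. by []. Qed.

Lemma expo_subK1 i a : (0 < a i)%N -> expo_add (expo_sub a (expo1 i)) (expo1 i) = a.
Proof.
move=> ai; apply/ffunP => j; rewrite !ffunE; case: eqP => [->|_]; last by rewrite subn0 addn0.
by rewrite subnK.
Qed.

Lemma firstvar_sub i a : firstvar i (expo_sub a (expo1 i)) = firstvar i a.
Proof.
apply: eq_forallb => j; case: ltnP => //= ji; rewrite !ffunE.
by case: (j =P i) => [e|_]; [rewrite e ltnn in ji | rewrite subn0].
Qed.

Lemma coefpsXdivX i f a : coefps (mpsX i * divX i f) a =
  if (0 < a i)%N && firstvar i a then coefps f a else 0.
Proof.
rewrite coefpsXM; case: ifP => //= ai.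
by rewrite firstvar_sub expo_subK1.
Qed.

Lemma firstvarP a : a = expo0 n \/
  exists i, [/\ (0 < a i)%N, firstvar i a &
    forall j, (0 < a j)%N && firstvar j a = (j == i)].
Proof.
case: (pickP (fun i => 0 < a i)%N) => [i0 ai0|a0]; last first.
  by left; apply/ffunP => i; rewrite ffunE; have := a0 i; case: (a i).
right; case: (@arg_minnP _ i0 (fun i => 0 < a i)%N (fun i : 'I_n => nat_of_ord i) ai0) => i ai imin.
have fi : firstvar i a.
  apply/forallP => j; apply/implyP => ji; rewrite -leqn0 leqNgt.
  by apply/negP => /imin; rewrite leqNgt ji.
exists i; split=> // j; apply/idP/eqP => [/andP [aj /forallP fj]|->]; last by rewrite ai.
apply/val_inj/eqP; rewrite eqn_leq imin // andbT leqNgt; apply/negP => ij.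
by have := fj i; rewrite ij => /= /eqP a0; rewrite a0 in ai.
Qed.

Lemma mps_decomp f : f = mpsC (const_term f) + \sum_i mpsX i * divX i f.
Proof.
apply: mpsP => a; rewrite [RHS]/= coefps_sum.
under eq_bigr do rewrite coefpsXdivX.
have [->|[i [ai fi uniq]]] := firstvarP a.
  by rewrite eqxx big1 ?addr0 // => i _; rewrite ffunE.
case: eqP => [a0|_]; first by rewrite a0 ffunE in ai.
rewrite add0r (bigD1 i) //= ai fi big1 ?addr0 // => j ji.
by rewrite uniq (negPf ji).
Qed.

Lemma divXD i f g : divX i (f + g) = divX i f + divX i g.
Proof. by apply: mpsP => a /=; case: ifP => // _; rewrite addr0. Qed.

Lemma divXCM i c f : divX i (mpsC c * f) = mpsC c * divX i f.
Proof.
by apply: mpsP => a; rewrite coefpsCM !coefps_divX coefpsCM; case: ifP; rewrite ?mulr0.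
Qed.

Lemma divXC i c : divX i (mpsC c) = 0.
Proof.
apply: mpsP => a /=; case: ifP => // _; case: eqP => // /ffunP /(_ i).
by rewrite !ffunE eqxx addn1.
Qed.

Lemma divX_lt i j f : (i < j)%N -> divX i (mpsX j * f) = mpsX j * divX i f.
Proof.
move=> ij; apply: mpsP => a; rewrite [RHS]coefpsXM !coefps_divX coefpsXM.
have ne : (j == i) = false by apply/negP => /eqP e; rewrite e ltnn in ij.
have -> : firstvar i (expo_sub a (expo1 j)) = firstvar i a.
  apply: eq_forallb => l; case: ltnP => //= li; rewrite !ffunE.
  by case: (l =P j) => [e|_]; [move: li; rewrite e; lia | rewrite subn0].
have -> : expo_add a (expo1 i) j = a j by rewrite !ffunE ne addn0.
case: (posnP (a j)) => aj; first by case: (firstvar i a).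
case: (firstvar i a) => //; congr (coefps f); apply/ffunP => l; rewrite !ffunE.
by case: (l =P j) => [->|_]; rewrite ?ne ?addn0 ?subn0.
Qed.

Lemma divX_gt i j f : (j < i)%N -> divX i (mpsX j * f) = 0.
Proof.
move=> ji; apply: mpsP => a; rewrite coefps_divX coefpsXM; case: ifP => // /forallP /(_ j).
have ne : (j == i) = false by apply/negP => /eqP e; rewrite e ltnn in ji.
by rewrite ji /= !ffunE ne addn0 => /eqP ->.
Qed.

Lemma divX_eq j f :
  divX j (mpsX j * f) = f - \sum_(i : 'I_n | (i < j)%N) mpsX i * divX i f.
Proof.
apply: mpsP => a; rewrite coefps_divX coefpsXM !ffunE eqxx addn1 /=.
have -> : expo_sub (expo_add a (expo1 j)) (expo1 j) = a.
  by apply/ffunP => l; rewrite !ffunE addnK.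
rewrite coefps_sum; under eq_bigr do rewrite coefpsXdivX.
case: ifP => [/forallP fj|/negbT].
  rewrite big1 ?subr0 // => i ij.
  by have := fj i; rewrite ij => /= /eqP ->.
rewrite negb_forall => /existsP [l]; rewrite negb_imply => /andP [lj al].
have [a0|[i [ai fi uniq]]] := firstvarP a; first by rewrite a0 ffunE in al.
rewrite (bigD1 i) /=.
  rewrite ai fi big1 ?addr0 ?subrr // => k /andP [_ ki].
  by rewrite uniq (negPf ki).
rewrite (leq_ltn_trans _ lj) // leqNgt; apply/negP => li.
by move/forallP: fi => /(_ l); rewrite li (negPf al).
Qed.

End Coefficients.

Arguments mpsC {n K} c.

Section Evaluation.
Variables (n n' : nat) (K : fieldType).
Local Notation S := (mpseries n K).
Local Notation S' := (mpseries n' K).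
Implicit Types (f g h : S).

(** Horner's rule [f(z) = f(0) + \sum_i z_i (divX i f)(z)], read as a contracting
    equation. *)
Definition mps_eval (z : 'I_n -> S') : S -> S' :=
  solution z (fun f => mpsC (const_term f)) (@divX n K).

Section Points.
Variable z : 'I_n -> S'.
Hypothesis z1 : forall i, ord_ge 1 (z i).

Lemma mps_evalE f :
  mps_eval z f = mpsC (const_term f) + \sum_i z i * mps_eval z (divX i f).
Proof. exact: solutionE. Qed.

Lemma mps_evalD f g : mps_eval z (f + g) = mps_eval z f + mps_eval z g.
Proof.
apply/eqP; rewrite -subr_eq0; apply/eqP.
pose D (fg : S * S) := mps_eval z (fg.1 + fg.2) - (mps_eval z fg.1 + mps_eval z fg.2).
rewrite -[LHS]/(D (f, g)).
apply: (contraction_eq0 z1 (q := fun i fg => (divX i fg.1, divX i fg.2))) => {f g}[[f g]].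
rewrite /D /= (mps_evalE (f + g)) (mps_evalE f) (mps_evalE g) rmorphD /= mpsCD.
rewrite [X in _ - X]addrACA -big_split /= opprD addrACA subrr add0r -sumrB.
by apply: eq_bigr => i _; rewrite divXD !mulrDr mulrN mulrDr.
Qed.

Lemma mps_evalCM c f : mps_eval z (mpsC c * f) = mpsC c * mps_eval z f.
Proof.
apply/eqP; rewrite -subr_eq0; apply/eqP; move: f.
apply: (contraction_eq0 z1 (q := @divX n K)) => f.
rewrite mps_evalE [in X in _ - X]mps_evalE rmorphM /= const_termC mpsCM mulrDr.
rewrite opprD addrACA subrr add0r mulr_sumr -sumrB; apply: eq_bigr => i _.
by rewrite divXCM mulrBr [mpsC c * (z i * _)]mulrCA.
Qed.

Lemma mps_evalC c : mps_eval z (mpsC c) = mpsC c.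
Proof.
rewrite mps_evalE const_termC big1 ?addr0 // => i _; rewrite divXC -(mpsC0 n K).
by rewrite -[mpsC 0]mulr1 mps_evalCM mpsC0 mul0r mulr0.
Qed.

Lemma mps_eval0 : mps_eval z 0 = 0.
Proof. by rewrite -(mpsC0 n K) mps_evalC mpsC0. Qed.

Lemma mps_evalN f : mps_eval z (- f) = - mps_eval z f.
Proof. by apply/eqP; rewrite -addr_eq0 -mps_evalD addNr mps_eval0. Qed.

Lemma mps_evalB f g : mps_eval z (f - g) = mps_eval z f - mps_eval z g.
Proof. by rewrite mps_evalD mps_evalN. Qed.

Lemma mps_eval_sum (I : Type) (r : seq I) (P : pred I) (F : I -> S) :
  mps_eval z (\sum_(i <- r | P i) F i) = \sum_(i <- r | P i) mps_eval z (F i).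
Proof. exact: (big_morph _ mps_evalD mps_eval0). Qed.

(** The defect [E j f] of the identity is a combination of defects of quotients of
    [f] with coefficients among the [z i], so that its order is infinite. *)
Lemma mps_evalXM j f : mps_eval z (mpsX j * f) = z j * mps_eval z f.
Proof.
pose E j f := mps_eval z (mpsX j * f) - z j * mps_eval z f.
apply/eqP; rewrite -subr_eq0; apply/eqP; rewrite -[LHS]/(E j f).
have EE j' f' : E j' f' =
    \sum_(i < n | (i < j')%N) (z i * E j' (divX i f') - z j' * E i (divX i f')).
  have -> : E j' f' = \sum_(i < n | (i < j')%N) z i * mps_eval z (mpsX j' * divX i f') -
      z j' * \sum_(i < n | (i < j')%N) mps_eval z (mpsX i * divX i f').
    rewrite /E mps_evalE rmorphM /= const_termX mul0r mpsC0 add0r.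
    rewrite (bigID (fun i : 'I_n => (i < j')%N)) /= -addrA; congr (_ + _).
      by apply: eq_bigr => i ij; rewrite divX_lt.
    rewrite (bigD1 j') ?ltnn //= big1 => [|i /andP [ij ne]]; last first.
      rewrite divX_gt ?mps_eval0 ?mulr0 // ltn_neqAle leqNgt ij andbT.
      by rewrite eq_sym val_eqE.
    by rewrite addr0 divX_eq mps_evalB mps_eval_sum mulrBr addrAC subrr add0r.
  rewrite mulr_sumr -sumrB; apply: eq_bigr => i ij; rewrite /E.
  ring.
apply: ord_ge_inf => k; elim: k j f => [|k IH] j f; first exact: ord_ge0.
rewrite EE; apply: ord_ge_sum => i _; rewrite -add1n.
by apply: ord_geB; apply: ord_geM.
Qed.

Lemma mps_evalM f g : mps_eval z (f * g) = mps_eval z f * mps_eval z g.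
Proof.
apply/eqP; rewrite -subr_eq0; apply/eqP; move: f.
apply: (contraction_eq0 z1 (q := @divX n K)) => f.
rewrite [f in mps_eval z (f * g)]mps_decomp [mps_eval z f]mps_evalE !mulrDl mps_evalD.
rewrite mps_evalCM opprD addrACA subrr add0r !mulr_suml mps_eval_sum -sumrB.
by apply: eq_bigr => i _; rewrite -mulrA mps_evalXM mulrBr mulrA.
Qed.

Lemma mps_eval1 : mps_eval z 1 = 1.
Proof. by rewrite -(mpsC1 n K) mps_evalC mpsC1. Qed.

Lemma mps_evalX j : mps_eval z (mpsX j) = z j.
Proof. by rewrite -[mpsX j]mulr1 mps_evalXM mps_eval1 mulr1. Qed.

Lemma mps_evalXn f k : mps_eval z (f ^+ k) = mps_eval z f ^+ k.
Proof. by elim: k => [|k IH]; rewrite ?mps_eval1 // !exprS mps_evalM IH. Qed.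

Lemma const_term_eval f : const_term (mps_eval z f) = const_term f.
Proof.
rewrite mps_evalE rmorphD /= const_termC rmorph_sum big1 ?addr0 // => i _.
by rewrite rmorphM /= (iffLR (ord_ge1P _) (z1 i)) mul0r.
Qed.

Lemma eval_unique (phi : S -> S') :
    (forall f g, phi (f + g) = phi f + phi g) -> (forall c, phi (mpsC c) = mpsC c) ->
    (forall i f, phi (mpsX i * f) = z i * phi f) ->
  phi =1 mps_eval z.
Proof.
move=> pD pC pX f; apply/eqP; rewrite -subr_eq0; apply/eqP; move: f.
apply: (contraction_eq0 z1 (q := @divX n K)) => f.
have p0 : phi 0 = 0 by rewrite -(mpsC0 n K) pC mpsC0.
rewrite [in LHS](mps_decomp f) pD pC (big_morph _ pD p0) -mps_decomp [mps_eval z f]mps_evalE.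
rewrite opprD addrACA subrr add0r -sumrB.
by apply: eq_bigr => i _; rewrite pX mulrBr.
Qed.

(** Subtracting the two Horner expansions yields a contracting equation for the
    quotients [r i]. *)
Lemma eval_diff (z' : 'I_n -> S') : (forall i, ord_ge 1 (z' i)) -> forall f,
  exists r : 'I_n -> S', mps_eval z f - mps_eval z' f = \sum_i (z i - z' i) * r i.
Proof.
move=> z'1 f.
pose R i := solution z' (fun f => mps_eval z (divX i f)) (@divX n K).
exists (fun i => R i f); apply/eqP; rewrite -subr_eq0; apply/eqP; move: f.
apply: (contraction_eq0 z'1 (q := @divX n K)) => f.
have RE i : R i f = mps_eval z (divX i f) + \sum_j z' j * R i (divX j f).
  exact: solutionE.
rewrite (mps_evalE f) -/(mps_eval z' f) [mps_eval z' f](solutionE _ z'1) opprD addrACA subrr add0r.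
under [X in _ - X]eq_bigr do rewrite -/(R _ _) RE mulrDr mulr_sumr.
rewrite big_split exchange_big /= -!sumrB opprD addrA -!sumrB.
apply: eq_bigr => i _; rewrite -/(mps_eval z' _) mulrBr mulr_sumr mulrBr.
rewrite (eq_bigr (fun j => z' i * ((z j - z' j) * R j (divX i f)))) => [|j _].
  by ring.
by rewrite mulrCA.
Qed.

End Points.

End Evaluation.

Section Units.
Variables (n : nat) (K : fieldType).
Local Notation S := (mpseries n K).
Implicit Types (f g h : S).

(** The geometric series solves [s = 1 + h s]. *)
Lemma mps_unit f : const_term f != 0 -> exists g, f * g = 1.
Proof.
set c := const_term f => c0; pose h := 1 - mpsC c^-1 * f.
have h1 : ord_ge 1 h.
  apply/ord_ge1P; rewrite rmorphB rmorph1 rmorphM /= const_termC mulVf ?subrr //.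
pose s := solution (fun _ : unit => h) (fun _ : unit => 1) (fun _ (u : unit) => u) tt.
have sE : s = 1 + h * s.
  by rewrite {1}/s solutionE // (bigD1 tt) //= big1 ?addr0 // => -[].
exists (mpsC c^-1 * s); apply/eqP; rewrite -subr_eq0; apply/eqP.
have -> : f * (mpsC c^-1 * s) = (1 - h) * s by rewrite /h opprB addrC subrK; ring.
by rewrite mulrBl mul1r [in X in X - _ - _]sE; ring.
Qed.

Lemma eval_id f : mps_eval (fun i => mpsX i) f = f.
Proof.
apply/esym; have X1 (i : 'I_n) : ord_ge 1 (mpsX i : S) by apply/ord_ge1P/const_termX.
exact: (eval_unique X1).
Qed.

Lemma ord_geXn k N f : ord_ge k f -> ord_ge (N * k) (f ^+ N).
Proof.
move=> fk; elim: N => [|N IH]; first exact: ord_ge0.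
by rewrite exprS mulSn; apply: ord_geM.
Qed.

Lemma ord_geX i : ord_ge 1 (mpsX i : S). Proof. exact/ord_ge1P/const_termX. Qed.

Lemma mpsXn_eq0 i N f : mpsX i ^+ N * f = 0 -> f = 0.
Proof.
elim: N => [|N IH]; first by rewrite mul1r.
rewrite exprS -mulrA => f0; apply: IH; apply: mpsP => a.
have e : expo_sub (expo_add a (expo1 i)) (expo1 i) = a.
  by apply/ffunP => l; rewrite !ffunE addnK.
have := congr1 (fun g : S => coefps g (expo_add a (expo1 i))) f0.
by rewrite coefpsXM e !ffunE eqxx addn1.
Qed.

Definition freeof (i : 'I_n) f : Prop := forall a : expo n, a i != 0%N -> coefps f a = 0.

Lemma freeof_mul i f g : freeof i f -> freeof i g -> freeof i (f * g).
Proof.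
move=> fi gi a ai; rewrite [LHS]/= big_seq big1 // => b; rewrite mem_expo_below => ba.
case: (eqVneq (b i) 0%N) => bi; last by rewrite fi ?mul0r.
by rewrite gi ?mulr0 // ffunE bi subn0.
Qed.

Lemma freeof_add i f g : freeof i f -> freeof i g -> freeof i (f + g).
Proof. by move=> fi gi a ai; rewrite [LHS]/= fi // gi // addr0. Qed.

Lemma freeof_sum i (I : Type) (r : seq I) (P : pred I) (F : I -> S) :
  (forall l, P l -> freeof i (F l)) -> freeof i (\sum_(l <- r | P l) F l).
Proof. by move=> Fi; elim/big_rec: _ => // l f Pl fi; apply/freeof_add/fi/Fi. Qed.

Lemma freeofC i c : freeof i (mpsC c).
Proof.
move=> a ai /=; case: eqP => // a0; by rewrite a0 ffunE in ai.
Qed.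

Lemma freeofX i j : i != j -> freeof i (mpsX j).
Proof.
move=> ij a ai /=; case: eqP => // a0; by rewrite a0 ffunE (negPf ij) in ai.
Qed.

Lemma freeofXn i f N : freeof i f -> freeof i (f ^+ N).
Proof.
move=> fi; elim: N => [|N IH]; last by rewrite exprS; apply: freeof_mul.
by rewrite expr0 -(mpsC1 n K); apply: freeofC.
Qed.

Lemma freeof_divX0 i f : freeof i f -> divX i f = 0.
Proof.
by move=> fi; apply: mpsP => a; rewrite coefps_divX fi ?if_same // !ffunE eqxx addn1.
Qed.

Lemma freeof_divX i j f : freeof i f -> freeof i (divX j f).
Proof.
move=> fi a ai; rewrite coefps_divX fi ?if_same // !ffunE.
by case: (a i) ai.
Qed.

Lemma freeof_eval (A : pred 'I_n) (z : 'I_n -> S) (i : 'I_n) f :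
    (forall j, A j -> freeof j f) -> (forall j, ~~ A j -> freeof i (z j)) ->
  freeof i (mps_eval z f).
Proof.
move=> fA zA; pose app := approx z (fun f => mpsC (const_term f)) (@divX n K).
have a0 l : app l 0 = 0.
  elim: l => // l IH; rewrite /app approxS rmorph0 mpsC0 add0r big1 // => j _.
  by rewrite (_ : divX j 0 = 0) -/app ?IH ?mulr0 //; apply: freeof_divX0.
suff H k g : (forall j, A j -> freeof j g) -> freeof i (app k g).
  by move=> a; apply: (H (edeg a).+1 f fA a).
elim: k g => [|k IH] g gA //; rewrite /app approxS; apply: freeof_add.
  exact: freeofC.
apply: freeof_sum => j _; case: (boolP (A j)) => Aj.
  by rewrite (freeof_divX0 (gA j Aj)) -/app a0 mulr0.
apply: freeof_mul; first exact: zA.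
by apply: IH => l Al; apply/freeof_divX/gA.
Qed.

Lemma eval_freeof (z : 'I_n -> S) i f : (forall j, ord_ge 1 (z j)) ->
  (forall j, j != i -> z j = mpsX j) -> freeof i f -> mps_eval z f = f.
Proof.
move=> z1 zX fi; apply/eqP; rewrite -subr_eq0; apply/eqP/ord_ge_inf => k.
elim: k f fi => [|k IH] f fi; first exact: ord_ge0.
rewrite mps_evalE // [X in _ - X]mps_decomp opprD addrACA subrr add0r -sumrB.
apply: ord_ge_sum => j _; case: (eqVneq j i) => [->|ji].
  by rewrite freeof_divX0 // mps_eval0 // !mulr0 subrr; apply: ord_ge_zero.
rewrite zX // -mulrBr -add1n; apply: ord_geM; first exact: ord_geX.
by apply/IH/freeof_divX.
Qed.

(** [s] is the smallest exponent of the variable among the monomials of [f]. *)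
Lemma mpsX_valuation i f : f != 0 -> exists s f1 f2,
  [/\ f = mpsX i ^+ s * (f1 + mpsX i * f2), f1 != 0, freeof i f1 &
      forall j, j != i -> freeof j f -> freeof j f1].
Proof.
move=> f0; have ex : exists s, `[< exists2 a : expo n, a i = s & coefps f a != 0 >].
  apply: contrapT => ex; case/eqP: f0; apply: mpsP => a; apply: contrapT => /eqP fa.
  by apply: ex; exists (a i); apply/asboolP; exists a.
case: (ex_minnP ex) => s /asboolP [a0 a0s fa0] smin.
pose ad k (a : expo n) : expo n := [ffun j => a j + (if j == i then k else 0)]%N.
pose f1 : S := MPSeries (fun a : expo n => if a i == 0%N then coefps f (ad s a) else 0).
pose f2 : S := MPSeries (fun a : expo n => coefps f (ad s.+1 a)).
have fE : f1 + mpsX i * f2 = MPSeries (fun a => coefps f (ad s a)).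
  apply: mpsP => a; rewrite [LHS]/= -[X in _ + X]/(coefps (mpsX i * f2) a) coefpsXM /=.
  case: (posnP (a i)) => ai; first by rewrite addr0.
  rewrite add0r; congr (coefps f _).
  apply/ffunP => j; rewrite !ffunE; case: eqP => [->|_]; last by rewrite subn0.
  by rewrite addnS -addSn subn1 prednK.
exists s, f1, f2; split.
- rewrite fE; have shift k : forall h : S, (forall a : expo n, (a i < k)%N -> coefps h a = 0) ->
      h = mpsX i ^+ k * MPSeries (fun a => coefps h (ad k a)).
    elim: k => [|k IH] h hk.
      rewrite expr0 mul1r; apply: mpsP => a /=; congr (coefps h _).
      by apply/ffunP => j; rewrite ffunE; case: eqP; rewrite addn0.
    pose h' : S := MPSeries (fun a : expo n => coefps h (ad 1%N a)).
    have hh : h = mpsX i * h'.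
      apply: mpsP => a; rewrite coefpsXM /=; case: (posnP (a i)) => ai.
        by rewrite hk ?ai.
      congr (coefps h _); apply/ffunP => j; rewrite !ffunE.
      by case: (eqVneq j i) => [->|_]; [rewrite subnK | rewrite subn0 addn0].
    rewrite [LHS]hh exprS -mulrA; congr (_ * _); rewrite [LHS]IH.
      congr (_ * _); apply: mpsP => a /=; congr (coefps h _); apply/ffunP => j.
      by rewrite !ffunE; case: eqP; rewrite ?addn0 // -addnA addn1.
    by move=> a ak /=; apply: hk; rewrite ffunE eqxx addn1.
  apply: shift => a; rewrite ltnNge => ak; apply: contrapT => /eqP fa; case/negP: ak.
  by apply: smin; apply/asboolP; exists a.
- apply/eqP => /(congr1 (fun g => coefps g [ffun j => if j == i then 0%N else a0 j])) /=.
  rewrite ffunE eqxx /= => h; case/eqP: fa0; rewrite -h; congr (coefps f _).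
  by apply/ffunP => j; rewrite !ffunE; case: eqP => [->|_]; rewrite ?addn0.
- by move=> a ai /=; rewrite (negPf ai).
- move=> j ji fj a aj /=; case: eqP => // _; rewrite fj // ffunE (negPf ji) addn0 //.
Qed.

End Units.

(** * Noether normalization *)

Section Normalization.
Variables (n : nat) (K : fieldType).
Local Notation S := (mpseries n.+1 K).
Implicit Types (f g h : S).
Local Notation t := (mpsX ord_max : S).

Definition subst_power (i : 'I_n.+1) N (j : 'I_n.+1) : S :=
  if j == i then t ^+ N else mpsX j.

Let ord_pow N : (0 < N)%N -> ord_ge 1 (t ^+ N).
Proof.
by move=> N0; have := @ord_geXn _ _ 1 N _ (@ord_geX n.+1 K ord_max); rewrite muln1; apply: ord_geW.
Qed.

Lemma subst_power_ord i N j : (0 < N)%N -> ord_ge 1 (subst_power i N j).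
Proof.
move=> N0; rewrite /subst_power; case: eqP => _; last exact: ord_geX.
exact: ord_pow.
Qed.

(** After division by a power of [x_i], there is a monomial without [x_i], which
    terms divisible by [t^N] with [N] above its degree cannot cancel. *)
Lemma subst_power_neq0 i f : f != 0 -> i != ord_max ->
  exists N0, forall N, (N0 <= N)%N -> (0 < N)%N -> mps_eval (subst_power i N) f != 0.
Proof.
move=> f0 im; have [s [f1 [f2 [-> f10 fr _]]]] := mpsX_valuation i f0.
have [a0 fa0] : exists a0, coefps f1 a0 != 0.
  apply: contrapT => ex; case/eqP: f10; apply: mpsP => a; apply: contrapT => /eqP fa.
  by apply: ex; exists a.
exists (edeg a0).+1 => N aN N0; have z1 j := subst_power_ord i j N0.
rewrite mps_evalM // mps_evalXn // mps_evalD // mps_evalM // !mps_evalX //.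
have zi : subst_power i N i = t ^+ N by rewrite /subst_power eqxx.
rewrite zi -exprM (@eval_freeof _ _ _ i f1) //; last first.
  by move=> j ji; rewrite /subst_power (negPf ji).
have cD (u v : S) b : coefps (u + v) b = coefps u b + coefps v b by [].
apply/eqP => /mpsXn_eq0 /(congr1 (fun h : S => coefps h a0)).
have tN : ord_ge N (t ^+ N).
  by have := @ord_geXn _ _ 1 N _ (@ord_geX n.+1 K ord_max); rewrite muln1.
have := ord_geM tN (@ord_ge0 _ _ (mps_eval (subst_power i N) f2)); rewrite addn0 => tNg.
rewrite cD tNg // addr0 => h.
by rewrite h eqxx in fa0.
Qed.

(** Powers of [t] are substituted for one variable after the other, with exponents
    large enough for [subst_power_neq0] to apply to the values of [f] and [g]. *)
Lemma normalization f g : f != 0 -> g != 0 -> forall k, (k <= n)%N ->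
  exists (N : 'I_n.+1 -> nat) (E : S -> S),
    [/\ (forall i, (0 < N i)%N), (forall h h', E (h * h') = E h * E h') /\ E 0 = 0,
        E f != 0 /\ E g != 0,
        (forall h (i : 'I_n.+1), (i < k)%N -> freeof i (E h)) &
        (forall h, exists r, h - E h =
           \sum_(i : 'I_n.+1 | (i < k)%N) (mpsX i - t ^+ N i) * r i)].
Proof.
move=> f0 g0; elim=> [|k IH] kn.
  exists (fun=> 1%N), id; split=> // h; exists (fun=> 0).
  by rewrite subrr big_pred0.
have [N [E [N0 [EM E0] [Ef Eg] Efr Er]]] := IH (ltnW kn).
have kn1 : (k < n.+1)%N by apply: ltnW.
pose i0 : 'I_n.+1 := Ordinal kn1.
have i0m : i0 != ord_max by rewrite -val_eqE /= neq_ltn kn.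
have [Nf Nf0] := subst_power_neq0 Ef i0m.
have [Ng Ng0] := subst_power_neq0 Eg i0m.
pose M := (maxn Nf Ng).+1.
have z1 j := subst_power_ord i0 j (ltn0Sn (maxn Nf Ng)).
exists (fun i => if i == i0 then M else N i), (fun h => mps_eval (subst_power i0 M) (E h)).
split.
- by move=> i; case: eqP.
- by split=> [h h'|]; [rewrite EM mps_evalM | rewrite E0 mps_eval0].
- by rewrite Nf0 ?Ng0 // leqW // ?leq_maxl ?leq_maxr.
- move=> h i ik; case: (ltnP i k) => ik'.
    apply: (@freeof_eval _ _ (pred1 i)) => [j /eqP ->|j ji]; first exact: Efr.
    rewrite /subst_power; case: eqP => _; last by apply: freeofX; rewrite eq_sym.
    by apply/freeofXn/freeofX; rewrite -val_eqE /= neq_ltn (leq_trans ik).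
  have -> : i = i0 by apply/val_inj/eqP; rewrite eqn_leq ik' -ltnS ik.
  apply: (@freeof_eval _ _ pred0) => // j _.
  rewrite /subst_power; case: (eqVneq j i0) => ji; first exact/freeofXn/freeofX.
  by apply: freeofX; rewrite eq_sym.
- move=> h; have [r hr] := Er h.
  have [r' hr'] := eval_diff (fun i => @ord_geX _ K i) z1 (E h).
  exists (fun i => if i == i0 then r' i else r i).
  rewrite eval_id in hr'.
  have -> : h - mps_eval (subst_power i0 M) (E h) =
    (h - E h) + (E h - mps_eval (subst_power i0 M) (E h)) by rewrite addrA subrK.
  rewrite hr hr'.
  have -> : \sum_i (mpsX i - subst_power i0 M i) * r' i = (mpsX i0 - t ^+ M) * r' i0.
    rewrite (bigD1 i0) //= /subst_power eqxx big1 ?addr0 // => i ii.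
    by rewrite (negPf ii) subrr mul0r.
  rewrite [RHS](bigD1 i0) /= ?ltnSn // !eqxx [RHS]addrC; congr (_ + _).
  apply: eq_big => [i|i ik].
    by rewrite ltnS -[i == i0]val_eqE /= ltn_neqAle andbC.
  have ii : i != i0 by rewrite -val_eqE /= neq_ltn ik.
  by rewrite !ifN.
Qed.

Lemma last_variable_unit h : h != 0 -> (forall i : 'I_n.+1, (i < n)%N -> freeof i h) ->
  exists s u, h = t ^+ s * u /\ const_term u != 0.
Proof.
move=> h0 hf; have [s [h1 [h2 [hE h10 fr frj]]]] := mpsX_valuation ord_max h0.
exists s, (h1 + t * h2); split=> //.
rewrite rmorphD rmorphM /= const_termX mul0r addr0; apply/eqP => h1c.
case/eqP: h10; apply: mpsP => a; case: (eqVneq a (expo0 _)) => [->//|a0].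
have [i ai] : exists i, a i != 0%N.
  apply: contrapT => ex; case/eqP: a0; apply/ffunP => i; rewrite ffunE.
  by apply: contrapT => /eqP ai; apply: ex; exists i.
case: (eqVneq i ord_max) => im; first by apply: fr; rewrite -im.
have ilt : (i < n)%N.
  have := ltn_ord i; rewrite ltnS leq_eqVlt.
  by case/orP => // /eqP e; case/eqP: im; apply/val_inj.
exact: frj im (hf i ilt) a ai.
Qed.

Lemma last_variable_trunc s h : (forall i : 'I_n.+1, (i < n)%N -> freeof i h) ->
  exists (c : nat -> K) H, h = \sum_(j < s) mpsC (c j) * t ^+ j + t ^+ s * H.
Proof.
move=> hf; suff [c [H [-> _]]] : exists (c : nat -> K) H, h = \sum_(j < s) mpsC (c j) * t ^+ j + t ^+ s * H
    /\ (forall i : 'I_n.+1, (i < n)%N -> freeof i H) by exists c, H.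
elim: s => [|s [c [H [hE Hf]]]].
  by exists (fun=> 0), h; rewrite big_ord0 add0r mul1r.
exists (fun j => if j == s then const_term H else c j), (divX ord_max H).
split; last by move=> i im; apply/freeof_divX/Hf.
have HE : H = mpsC (const_term H) + t * divX ord_max H.
  rewrite {1}(mps_decomp H) (bigD1 ord_max) //= big1 ?addr0 // => i im.
  rewrite freeof_divX0 ?mulr0 //; apply: Hf; have := ltn_ord i; rewrite ltnS leq_eqVlt.
  by case/orP => // /eqP e; case/eqP: im; apply/val_inj.
rewrite big_ord_recr /= eqxx hE {1}HE.
have -> : \sum_(j < s) mpsC (if j == s :> nat then const_term H else c j) * t ^+ j =
    \sum_(j < s) mpsC (c j) * t ^+ j.
  by apply: eq_bigr => j _; rewrite ifN // neq_ltn ltn_ord.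
by rewrite exprS; ring.
Qed.

(** Modulo the [y i = x_i - t^(N i)], [f] is a unit times [t^s]. *)
Lemma finite_generation f : f != 0 -> exists (y : 'I_n -> S) s,
  (forall i, ord_ge 1 (y i)) /\
  (forall g, exists (c : nat -> K) (q : 'I_n -> S) r,
    g = \sum_(j < s) mpsC (c j) * t ^+ j + \sum_i y i * q i + f * r).
Proof.
move=> f0; have [N [E [N0 _ [Ef _] Efr Er]]] := normalization f0 f0 (leqnn n).
have [s [u [EfE u0]]] := last_variable_unit Ef (Efr f).
have [v uv] := mps_unit u0.
pose y (i : 'I_n) : S := mpsX (widen_ord (leqnSn n) i) - t ^+ N (widen_ord (leqnSn n) i).
have Er' h : exists r : 'I_n -> S, h = E h + \sum_i y i * r i.
  have [r hr] := Er h; exists (fun i => r (widen_ord (leqnSn n) i)).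
  apply/eqP; rewrite addrC -subr_eq; apply/eqP; rewrite hr.
  rewrite big_mkcond big_ord_recr /= ltnn addr0; apply: eq_bigr => i _.
  by rewrite /= ltn_ord.
exists y, s; split=> [i|g].
  apply: ord_geB; first exact: ord_geX.
  exact: ord_pow.
have [rg gE] := Er' g; have [rf fE] := Er' f.
have [c [H EgE]] := last_variable_trunc s (Efr g).
exists c, (fun i => rg i - rf i * (v * H)), (v * H).
have ts : t ^+ s = (f - \sum_i y i * rf i) * v.
  by rewrite {1}fE addrK EfE -mulrA uv mulr1.
rewrite {1}gE EgE ts -!addrA; congr (_ + _).
have -> : \sum_i y i * (rg i - rf i * (v * H)) =
    \sum_i y i * rg i - (\sum_i y i * rf i) * (v * H).
  by rewrite mulr_suml -sumrB; apply: eq_bigr => i _; ring.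
ring.
Qed.

(** The completed form of Nakayama's lemma: generators of [S / (y, f)] over [K]
    generate [S / (f)] over the power series in [y]. *)
Lemma finite_over f : f != 0 -> exists (y : 'I_n -> S) s,
  (forall i, ord_ge 1 (y i)) /\
  (forall g, exists (F : 'I_s -> mpseries n K) r,
    g = \sum_(j < s) mps_eval y (F j) * t ^+ j + f * r).
Proof.
move=> f0; have [y [s [y1 gen]]] := finite_generation f0.
exists y, s; split=> // g.
have /choice [W hW] : forall g, exists W : (nat -> K) * ('I_n -> S) * S,
    g = \sum_(j < s) mpsC (W.1.1 j) * t ^+ j + \sum_i y i * W.1.2 i + f * W.2.
  by move=> h; have [c [q [r hE]]] := gen h; exists (c, q, r).
pose q i h := (W h).1.2 i.
have X1 (i : 'I_n) : ord_ge 1 (mpsX i : mpseries n K) by apply: ord_geX.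
pose F (j : 'I_s) := solution (fun i : 'I_n => mpsX i : mpseries n K) (fun h => mpsC ((W h).1.1 j)) q.
pose R := solution y (fun h => (W h).2) q.
exists (F^~ g), (R g); apply/eqP; rewrite -subr_eq0; apply/eqP; move: g.
apply: (contraction_eq0 y1 (q := q)) => g.
have FE j : mps_eval y (F j g) = mpsC ((W g).1.1 j) + \sum_i y i * mps_eval y (F j (q i g)).
  rewrite {1}/F solutionE // mps_evalD // mps_evalC // mps_eval_sum //.
  by congr (_ + _); apply: eq_bigr => i _; rewrite mps_evalXM.
rewrite [X in X - _]hW {1}/R solutionE // -/R.
under [X in _ - (X + _)]eq_bigr do rewrite FE mulrDl.
rewrite big_split /= mulrDr.
under [X in _ - (_ + X + _)]eq_bigr do rewrite mulr_suml.
rewrite exchange_big /= mulr_sumr.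
under [RHS]eq_bigr do rewrite mulrBr mulrDr mulr_sumr.
rewrite sumrB big_split /=.
under [X in _ = _ - (X + _)]eq_bigr do under eq_bigr do rewrite mulrA.
under [X in _ = _ - (_ + X)]eq_bigr do rewrite mulrCA.
ring.
Qed.

(** Cayley-Hamilton, for the multiplication by [x] on the generators [t^j]. *)
Lemma integral_over f : f != 0 -> exists y : 'I_n -> S,
  (forall i, ord_ge 1 (y i)) /\ (forall x : S, exists (h : {poly mpseries n K}) r,
    h \is monic /\ (map_poly (mps_eval y) h).[x] = f * r).
Proof.
move=> f0; have [y [s [y1 gen]]] := finite_over f0; exists y; split=> // x.
pose phi : {rmorphism mpseries n K -> S} := HB.pack (mps_eval y)
  (GRing.isZmodMorphism.Build _ _ _ (mps_evalB y1))
  (GRing.isMonoidMorphism.Build _ _ _ (conj (mps_eval1 y1) (mps_evalM y1))).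
rewrite -/phi -[mps_eval y]/(phi : _ -> _).
case: s gen => [|s] gen.
  have [F [r]] := gen 1; rewrite big_ord0 add0r => fr.
  by exists 1, r; rewrite monic1 rmorph1 hornerC.
have /choice [W hW] : forall j : 'I_s.+1, exists W : ('I_s.+1 -> mpseries n K) * S,
    x * t ^+ j = \sum_(l < s.+1) phi (W.1 l) * t ^+ l + f * W.2.
  by move=> j; have [F [r ->]] := gen (x * t ^+ j); exists (F, r).
pose M : 'M[mpseries n K]_s.+1 := \matrix_(j, l) (W j).1 l.
pose v : 'cV[S]_s.+1 := \col_j t ^+ j.
pose w : 'cV[S]_s.+1 := \col_j (W j).2.
have eq1 : (x%:M - map_mx phi M) *m v = f *: w.
  apply/matrixP => j l; rewrite !mxE.
  under eq_bigr do rewrite !mxE mulrBl.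
  rewrite sumrB (bigD1 j) //= eqxx mulr1n big1 ?addr0 => [|i ij]; last first.
    by rewrite eq_sym (negPf ij) mulr0n mul0r.
  by rewrite hW addrAC subrr add0r.
have dE : \det (x%:M - map_mx phi M) = (map_poly phi (char_poly M)).[x].
  rewrite map_char_poly -[RHS]/(horner_eval x _) /char_poly -det_map_mx.
  congr (\det _); apply/matrixP => i j; rewrite /char_poly_mx !mxE /horner_eval.
  by rewrite rmorphB rmorphMn /= /horner_eval hornerX hornerC.
exists (char_poly M), ((\adj (x%:M - map_mx phi M) *m w) 0 0).
split; first exact: char_poly_monic.
have := congr1 (fun z => (\adj (x%:M - map_mx phi M) *m z) 0 0) eq1.
rewrite mulmxA mul_adj_mx dE mul_scalar_mx -scalemxAr !mxE => <-.
by rewrite expr0 mulr1.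
Qed.

End Normalization.

(** * Prime ideals and dimension *)

Section PrimeIdeals.
Variable A : comNzRingType.
Implicit Types (I P Q : set A).

Lemma prime_idealP P : is_prime_ideal P <->
  [/\ P 0, ~ P 1, (forall a u v, P u -> P v -> P (a * u + v)) &
      forall u v, P (u * v) -> P u \/ P v].
Proof.
split=> [[[P0 P1 PM] Pp]|[P0 P1 PM Pp]].
  split=> [||a u v Pu Pv|u v Puv].
  - by move: P0; rewrite inE.
  - by move=> P1'; move/negP: P1; rewrite inE.
  - by have := PM a u v; rewrite !inE; apply.
  - by have := Pp u v; rewrite !inE => /(_ Puv) /orP [] ; rewrite inE; [left | right].
split; first split.
- by rewrite inE.
- by apply/negP; rewrite inE.
- by move=> a u v; rewrite !inE; apply: PM.
by move=> u v; rewrite !inE => /Pp [Pu|Pv]; apply/orP; rewrite !inE; [left | right].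
Qed.

End PrimeIdeals.

Section PrimeTheory.
Variables (A : comNzRingType) (P : set A).
Hypothesis PP : is_prime_ideal P.

Lemma prime0 : P 0. Proof. by have [] := (iffLR (prime_idealP P)) PP. Qed.
Lemma prime1 : ~ P 1. Proof. by have [] := (iffLR (prime_idealP P)) PP. Qed.
Lemma primeMD a u v : P u -> P v -> P (a * u + v).
Proof. by have [_ _ + _] := (iffLR (prime_idealP P)) PP; apply. Qed.
Lemma primeMl a u : P u -> P (a * u).
Proof. by move=> Pu; rewrite -[_ * _]addr0; apply: primeMD prime0. Qed.
Lemma primeD u v : P u -> P v -> P (u + v).
Proof. by move=> Pu Pv; rewrite -[u]mul1r; apply: primeMD. Qed.
Lemma primeN u : P u -> P (- u).
Proof. by move=> Pu; rewrite -mulN1r; apply: primeMl. Qed.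
Lemma primeB u v : P u -> P v -> P (u - v).
Proof. by move=> Pu Pv; apply/primeD/primeN. Qed.
Lemma primeM u v : P (u * v) -> P u \/ P v.
Proof. by have [_ _ _] := (iffLR (prime_idealP P)) PP; apply. Qed.
End PrimeTheory.

Section PrimeContraction.
Variable A : comNzRingType.
Implicit Types (P Q : set A).

Lemma prime_preimage (B : comNzRingType) (phi : B -> A) P :
    (forall u v, phi (u + v) = phi u + phi v) -> (forall u v, phi (u * v) = phi u * phi v) ->
    phi 1 = 1 -> is_prime_ideal P -> is_prime_ideal [set b | P (phi b)].
Proof.
move=> pD pM p1 PP; apply/prime_idealP; split=> /=.
- have -> : phi 0 = 0 by apply: (addrI (phi 0)); rewrite -pD !addr0.
  exact: prime0.
- by rewrite p1; apply: prime1.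
- by move=> a u v Pu Pv; rewrite pD pM; apply: primeMD.
- by move=> u v; rewrite pM; apply: primeM.
Qed.

(** Divide a monic relation for [x] modulo [P] by [x] until its constant term is
    not in [P]. *)
Lemma incomparability (B : comNzRingType) (phi : {rmorphism B -> A}) P Q x (h : {poly B}) :
    is_prime_ideal P -> is_prime_ideal Q -> P `<=` Q -> Q x -> ~ P x ->
    h \is monic -> P (map_poly phi h).[x] ->
  exists b, Q (phi b) /\ ~ P (phi b).
Proof.
move=> PP PQ PleQ Qx nPx; elim/poly_ind: h => [|h c IH].
  by rewrite monicE lead_coef0 eq_sym oner_eq0.
have [-> |h0] := eqVneq h 0.
  rewrite mul0r add0r monicE lead_coefC => /eqP ->.
  by rewrite rmorph1 hornerC => /prime1.
move=> hm; rewrite rmorphD rmorphM /= map_polyX map_polyC hornerD hornerMX hornerC => Phx.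
have hm' : h \is monic.
  move: hm; rewrite !monicE lead_coefDl ?lead_coefMX //.
  by rewrite size_mulX // (leq_ltn_trans (size_polyC_leq1 _)) // ltnS lt0n size_poly_eq0.
have Qc : Q (phi c).
  rewrite (_ : phi c = (map_poly phi h).[x] * x + phi c - (map_poly phi h).[x] * x).
    by apply: primeB => //; [apply: PleQ | apply: primeMl].
  by rewrite addrAC subrr add0r.
have [Pc|nPc] := pselect (P (phi c)); last by exists c.
apply: IH => //; have /(primeM PP) [] : P ((map_poly phi h).[x] * x) => //.
by rewrite -[_ * _](addrK (phi c)); apply: primeB.
Qed.

End PrimeContraction.

Section KrullUpper.
Variable K : fieldType.

(** Modulo [f], the power series are integral over power series in one variable
    less, and incomparability keeps the inclusions strict. *)
Lemma chain_contraction n (f : mpseries n.+1 K) k (X : nat -> set (mpseries n.+1 K)) :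
    f != 0 -> X 0%N f -> (forall i, (i <= k)%N -> is_prime_ideal (X i)) ->
    (forall i, (i < k)%N -> X i `<` X i.+1) ->
  has_chain (@is_prime_ideal (mpseries n K)) k.
Proof.
move=> f0 Xf Xp Xs; have [y [y1 int]] := integral_over f0.
have Xif i : (i <= k)%N -> X i f.
  elim: i => // i IH ik; have [sub _] := Xs i ik.
  by apply/sub/IH/ltnW.
pose phi : {rmorphism mpseries n K -> mpseries n.+1 K} := HB.pack (mps_eval y)
  (GRing.isZmodMorphism.Build _ _ _ (mps_evalB y1))
  (GRing.isMonoidMorphism.Build _ _ _ (conj (mps_eval1 y1) (mps_evalM y1))).
exists (fun i => [set b | X i (phi b)]); split=> [i ik|i ik].
  by apply: prime_preimage (Xp i ik); [exact: rmorphD | exact: rmorphM | exact: rmorph1].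
have [sub nsub] := Xs i ik; split=> [b /= /sub //|sub'].
apply: nsub => x Xx; apply: contrapT => nXx.
have [h [r [hm hx]]] := int x.
have [|b [Qb nPb]] := @incomparability _ _ phi (X i) (X i.+1) x h
    (Xp i (ltnW ik)) (Xp i.+1 ik) sub Xx nXx hm.
  by have -> : (map_poly phi h).[x] = r * f := etrans hx (mulrC _ _); apply: primeMl; [apply/Xp/ltnW | apply/Xif/ltnW].
exact/nPb/sub'.
Qed.

(** The second prime of a chain contains a nonzero series, to which
    [chain_contraction] applies. *)
Lemma krull_mpseries n k : has_chain (@is_prime_ideal (mpseries n K)) k -> (k <= n)%N.
Proof.
elim: n k => [|n IH] [|k] // [X [Xp Xs]]; have [sub nsub] := Xs 0%N isT.
  case: nsub => x X1x; apply: contrapT => nX0x.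
  have x0 : const_term x != 0.
    apply/eqP => xc; apply: nX0x; rewrite (_ : x = 0); last first.
      apply: mpsP => a; rewrite (_ : a = expo0 0) //; apply/ffunP => -[].
      by [].
    by apply: prime0; apply: Xp.
  have [z xz] := mps_unit x0; apply: (@prime1 _ (X 1%N)); first exact: Xp.
  by rewrite -xz mulrC; apply: primeMl => //; apply: Xp.
have [f X1f nX0f] : exists2 f, X 1%N f & ~ X 0%N f.
  by apply: contrapT => ex; apply: nsub => f X1f; apply: contrapT => ?; apply: ex; exists f.
have f0 : f != 0 by apply/eqP => f0; apply: nX0f; rewrite f0; exact: prime0 (Xp 0%N isT).
rewrite ltnS; apply: IH; apply: (chain_contraction (X := fun i => X i.+1) f0 X1f) => i ik.
  exact: Xp.
exact: Xs.
Qed.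

(** One substitution maps both [f] and [g] to units times powers of [t]. *)
Lemma mpseries_domain n (f g : mpseries n K) : f * g = 0 -> f = 0 \/ g = 0.
Proof.
move=> fg; apply: contrapT => /not_orP [/eqP f0 /eqP g0].
case: n f g f0 g0 fg => [|n] f g f0 g0 fg.
  have cf (h : mpseries 0 K) : h != 0 -> const_term h != 0.
    apply: contra_neq => hc; apply: mpsP => a; rewrite (_ : a = expo0 0) //.
    by apply/ffunP => -[].
  have /eqP := congr1 const_term fg; rewrite rmorphM rmorph0 /= mulf_eq0.
  by rewrite (negPf (cf f f0)) (negPf (cf g g0)).
have [N [E [N0 [EM E0] [Ef Eg] Efr _]]] := normalization f0 g0 (leqnn n).
have [s [u [fE u0]]] := last_variable_unit Ef (Efr f).
have [s' [u' [gE u0']]] := last_variable_unit Eg (Efr g).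
have uu : const_term (u * u') != 0 by rewrite rmorphM mulf_neq0.
have := EM f g; rewrite fg E0 => EfEg.
have : mpsX ord_max ^+ (s + s') * (u * u') = 0 by rewrite EfEg fE gE exprD; ring.
by move=> /mpsXn_eq0 uu0; rewrite uu0 rmorph0 eqxx in uu.
Qed.

End KrullUpper.

(** * Hypersurface rings *)

Section HypersurfaceRing.
Variables (n : nat) (K : fieldType) (f : mpseries n K) (f0 : const_term f = 0).
Local Notation S := (mpseries n K).
Local Notation A := (hypersurface f0).
Implicit Types (g h : S) (a : A).

Definition cls g : A := \pi_({ideal_quot (mps_principal f0)})%qT g.

Lemma clsD g h : cls (g + h) = cls g + cls h.
Proof. exact: Quotient.pi_add. Qed.

Lemma clsN g : cls (- g) = - cls g.
Proof. exact: Quotient.pi_opp. Qed.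

Lemma clsM g h : cls (g * h) = cls g * cls h.
Proof. exact: Quotient.pi_mul. Qed.

Lemma cls1 : cls 1 = 1.
Proof. by rewrite /cls piE. Qed.

Lemma cls0 : cls 0 = 0.
Proof. by apply: (addrI (cls 0)); rewrite -clsD !addr0. Qed.

Lemma clsXn g k : cls (g ^+ k) = cls g ^+ k.
Proof. by elim: k => [|k IH]; rewrite ?cls1 // !exprS clsM IH. Qed.

Lemma cls_sum (I : Type) (r : seq I) (P : pred I) (F : I -> S) :
  cls (\sum_(i <- r | P i) F i) = \sum_(i <- r | P i) cls (F i).
Proof. exact: (big_morph _ clsD cls0). Qed.

Lemma cls_eq0 g : cls g = 0 <-> exists h, g = h * f.
Proof.
rewrite -cls0; split=> [/eqP|[h ->]]; last first.
  apply/eqP; rewrite /cls -Quotient.idealrBE subr0.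
  by apply/asboolP; exists h.
by rewrite /cls -Quotient.idealrBE subr0 => /asboolP.
Qed.

Lemma clsS a : exists g, a = cls g.
Proof. by exists (repr a); rewrite /cls reprK. Qed.

Lemma cls_f : cls f = 0.
Proof. by apply/cls_eq0; exists 1; rewrite mul1r. Qed.

Lemma proper_idealP (B : comNzRingType) (I : set B) : is_proper_ideal I <->
  [/\ I 0, ~ I 1 & forall b u v, I u -> I v -> I (b * u + v)].
Proof.
split=> [[I0 I1 IM]|[I0 I1 IM]].
  split=> [||b u v Iu Iv].
  - by move: I0; rewrite inE.
  - by move=> I1'; move/negP: I1; rewrite inE.
  - by have := IM b u v; rewrite !inE; apply.
by split; [rewrite inE | apply/negP; rewrite inE | move=> b u v; rewrite !inE; apply: IM].
Qed.

Definition max_ideal : set A := [set a | exists g, a = cls g /\ const_term g = 0].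

Lemma max_ideal_cls g : max_ideal (cls g) <-> const_term g = 0.
Proof.
split=> [[h [gh h0]]|g0]; last by exists g.
have /cls_eq0 [k e] : cls (g - h) = 0 by rewrite clsD clsN gh subrr.
by rewrite -[g](subrK h) e rmorphD rmorphM /= f0 mulr0 h0 addr0.
Qed.

Lemma proper_ideal_sub_max (I : set A) : is_proper_ideal I -> I `<=` max_ideal.
Proof.
move=> /proper_idealP [I0 I1 IM] a; have [g ->] := clsS a => Ig.
apply/max_ideal_cls; apply: contrapT => /eqP g0; apply: I1.
have [h gh] := mps_unit g0; rewrite -cls1 -gh mulrC clsM -[_ * _]addr0.
exact: IM.
Qed.

Lemma max_ideal_proper : is_proper_ideal max_ideal.
Proof.
apply/proper_idealP; split=> [||b u v].
- by exists 0; rewrite cls0 rmorph0.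
- by rewrite -cls1 max_ideal_cls rmorph1; apply/eqP/oner_neq0.
move=> [g [-> g0]] [h [-> h0]]; have [k ->] := clsS b.
by exists (k * g + h); rewrite clsD clsM rmorphD rmorphM /= g0 h0 mulr0 addr0.
Qed.

Lemma hypersurface_local : is_local max_ideal.
Proof.
have pm := max_ideal_proper; split=> [|m' [pm' mm']].
  split=> // J pJ mJ; apply/seteqP; split=> //; exact: proper_ideal_sub_max.
by apply/esym/mm' => //; apply: proper_ideal_sub_max.
Qed.

Lemma hypersurface_char p : p \in [pchar K] -> p \in [pchar A].
Proof.
move=> pK; rewrite inE (pcharf_prime pK); apply/eqP.
have e k : (k%:R : A) = cls (mpsC (k%:R : K)).
  elim: k => [|k IH]; first by rewrite mulr0n mpsC0 cls0.
  by rewrite -!natr1 IH mpsCD clsD mpsC1 cls1.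
by rewrite e (pcharf0 pK) mpsC0 cls0.
Qed.

(** The kernels of evaluations are prime because power series form a domain; they
    increase because each evaluation factors through the preceding one, and
    strictly so because of the [w i]. *)
Lemma krull_ge (n' d : nat) (z : nat -> 'I_n -> mpseries n' K)
    (kappa : nat -> mpseries n' K -> mpseries n' K) (w : nat -> S) :
    (forall i j, ord_ge 1 (z i j)) -> (forall i, (i <= d)%N -> mps_eval (z i) f = 0) ->
    (forall i, (i < d)%N -> kappa i 0 = 0) ->
    (forall i g, (i < d)%N -> mps_eval (z i.+1) g = kappa i (mps_eval (z i) g)) ->
    (forall i, (i < d)%N -> mps_eval (z i) (w i) != 0 /\ mps_eval (z i.+1) (w i) = 0) ->
  has_chain (@is_prime_ideal A) d.
Proof.
move=> z1 zf k0 zk zw.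
pose X i : set A := [set a | exists g, a = cls g /\ mps_eval (z i) g = 0].
have XE i g : (i <= d)%N -> X i (cls g) <-> mps_eval (z i) g = 0.
  move=> id; split=> [[h [gh h0]]|g0]; last by exists g.
  have /cls_eq0 [k e] : cls (g - h) = 0 by rewrite clsD clsN gh subrr.
  by rewrite -[g](subrK h) e mps_evalD // mps_evalM // zf // mulr0 h0 addr0.
exists X; split=> [i id|i id].
  apply/prime_idealP; split.
  - by exists 0; rewrite cls0 mps_eval0.
  - by rewrite -cls1 XE // mps_eval1 //; apply/eqP/oner_neq0.
  - move=> b u v [g [-> g0]] [h [-> h0]]; have [k ->] := clsS b.
    by exists (k * g + h); rewrite clsD clsM mps_evalD // mps_evalM // g0 h0 mulr0 addr0.
  - move=> u v; have [g ->] := clsS u; have [h ->] := clsS v.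
    by rewrite -clsM !XE // mps_evalM // => /mpseries_domain.
have [w0 w1] := zw i id; split=> [a [g [-> g0]]|sub].
  by exists g; rewrite zk // g0 k0.
have /sub : X i.+1 (cls (w i)) by apply/XE.
by rewrite XE ?(ltnW id) // => w00; rewrite w00 eqxx in w0.
Qed.

End HypersurfaceRing.
Arguments max_ideal {n K f} f0 _.

Lemma krull_le n (K : fieldType) (f : mpseries n.+1 K) (f0 : const_term f = 0) k :
  f != 0 -> has_chain (@is_prime_ideal (hypersurface f0)) k -> (k <= n)%N.
Proof.
move=> fn0 [X [Xp Xs]]; apply: (@krull_mpseries K).
apply: (chain_contraction (X := fun i => [set g | X i (cls f0 g)]) fn0) => /=.
- by rewrite cls_f; apply: prime0 (Xp 0%N _).
- by move=> i ik; apply: prime_preimage (Xp i ik); [exact: clsD | exact: clsM | exact: cls1].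
move=> i ik; have [sub nsub] := Xs i ik; split=> [g /= /sub //|sub'].
by apply: nsub => a; have [g ->] := clsS a; apply: sub'.
Qed.

Local Close Scope classical_set_scope.

(** * Length as a dimension *)

Local Open Scope classical_set_scope.

Section Length.
Variables (n : nat) (K : fieldType) (f : mpseries n K) (f0 : const_term f = 0).
Local Notation S := (mpseries n K).
Local Notation A := (hypersurface f0).
Variables (M : lmodType A) (sigma : S -> M) (V : vectType K) (pi : S -> V).
Variables (U : {vspace V}) (N : nat).
Hypothesis sigmaD : forall g h, sigma (g + h) = sigma g + sigma h.
Hypothesis sigmaM : forall g h, sigma (g * h) = cls f0 g *: sigma h.
Hypothesis sigmaS : forall x, exists g, x = sigma g.
Hypothesis piD : forall g h, pi (g + h) = pi g + pi h.
Hypothesis piC : forall c g, pi (mpsC c * g) = c *: pi g.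
Hypothesis piS : forall v, exists g, v = pi g.
Hypothesis sigma_pi : forall g, sigma g = 0 <-> pi g \in U.
Hypothesis pi_nil : forall g, ord_ge N g -> pi g = 0.

Let sigma0 : sigma 0 = 0.
Proof. by apply: (addrI (sigma 0)); rewrite -sigmaD !addr0. Qed.

Let sigmaN g : sigma (- g) = - sigma g.
Proof. by rewrite -mulN1r sigmaM clsN cls1 scaleN1r. Qed.

Let pi0 : pi 0 = 0.
Proof. by apply: (addrI (pi 0)); rewrite -piD !addr0. Qed.

Let piN g : pi (- g) = - pi g.
Proof. by apply/eqP; rewrite -addr_eq0 -piD addNr pi0. Qed.

Let pi_sum (I : Type) (r : seq I) (F : I -> S) (W : {vspace V}) :
  (forall i, pi (F i) \in W) -> pi (\sum_(i <- r) F i) \in W.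
Proof.
move=> FW; elim/big_rec: _ => [|i x _ xW]; last by rewrite piD memvD.
by rewrite pi0 mem0v.
Qed.

Lemma submodP (X : set M) : submod_closed [in X] <->
  X 0 /\ forall a u v, X u -> X v -> X (a *: u + v).
Proof.
split=> [[X0 XD]|[X0 XD]].
  split=> [|a u v Xu Xv]; first by move: X0; rewrite inE.
  by have := XD a u v; rewrite !inE; apply.
by split; [rewrite inE | move=> a u v; rewrite !inE; apply: XD].
Qed.

(** Elements that witness the strictness of the inclusions are linearly independent
    modulo [U]. *)
Let length_le k : has_chain (fun X : set M => submod_closed [in X]) k ->
  (k + \dim U <= \dim {:V})%N.
Proof.
move=> [X [Xm Xs]].
have /choice [g hg] : forall i, exists g : S, (i < k)%N -> X i.+1 (sigma g) /\ ~ X i (sigma g).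
  move=> i; case: (ltnP i k) => ik; last by exists 0.
  have [sub nsub] := Xs i ik.
  have [x Xx nXx] : exists2 x, X i.+1 x & ~ X i x.
    by apply: contrapT => ex; apply: nsub => x Xx; apply: contrapT => ?; apply: ex; exists x.
  by have [h xh] := sigmaS x; exists h => _; rewrite -xh.
pose W := fix W i : {vspace V} := if i is j.+1 then (W j + <[pi (g j)]>)%VS else U.
have WX i : (i <= k)%N -> forall h, pi h \in W i -> X i (sigma h).
  elim: i => [|i IH] ik h hW.
    have [X0 _] := (iffLR (submodP _)) (Xm 0%N isT).
    by move/sigma_pi: hW => ->.
  have [X0 XD] := (iffLR (submodP _)) (Xm _ ik); have [sub _] := Xs i ik.
  have [Xg _] := hg i ik.
  move/memv_addP: hW => [u uW [_ /vlineP [c ->] hE]].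
  have -> : h = (h - mpsC c * g i) + mpsC c * g i by rewrite subrK.
  rewrite sigmaD sigmaM addrC; apply: XD => //; apply: sub; apply: IH; first exact: ltnW.
  by rewrite piD piN piC hE addrK.
have dW i : (i <= k)%N -> (i + \dim U <= \dim (W i))%N.
  elim: i => // i IH ik; rewrite addSn; apply: leq_ltn_trans (IH (ltnW ik)) _.
  rewrite ltnNge; apply/negP => le.
  have /eqP e : W i == W i.+1 by rewrite eqEdim addvSl le.
  have [_ nXg] := hg i ik; apply/nXg/WX; first exact: ltnW.
  by rewrite e; apply: subvP (addvSr _ _) _ (memv_line _).
by rewrite (leq_trans (dW k _)) // dimvS ?subvf.
Qed.

Let stable (W : {vspace V}) := forall g h, pi h \in W -> pi (g * h) \in W.

(** The variables act nilpotently on [V / W], so that they kill a nonzero vector. *)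
Let socle (W : {vspace V}) : W != fullv ->
  exists z, pi z \notin W /\ forall i, pi (mpsX i * z) \in W.
Proof.
move=> Wf; apply: contrapT => ex; case/eqP: Wf.
have H z : (forall i, pi (mpsX i * z) \in W) -> pi z \in W.
  by move=> zW; apply: contrapT => /negP nz; apply: ex; exists z.
suff all_W j g : ord_ge (N - j) g -> pi g \in W.
  apply/vspaceP => v; rewrite memvf; have [g ->] := piS v.
  by apply: (all_W N); rewrite subnn; apply: ord_ge0.
elim: j g => [|j IH] g; first by rewrite subn0 => /pi_nil ->; apply: mem0v.
move=> gN; apply: H => i; apply: IH.
apply: ord_geW (ord_geM (@ord_geX _ _ i) gN); lia.
Qed.

Let chain_from (W : {vspace V}) c : stable W -> (U <= W)%VS ->
    (\dim W + c = \dim {:V})%N ->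
  exists X : nat -> set M, [/\ X 0%N = [set x | exists g, x = sigma g /\ pi g \in W],
    forall i, (i <= c)%N -> submod_closed [in X i] &
    forall i, (i < c)%N -> X i `<` X i.+1].
Proof.
have sub W' : stable W' -> submod_closed [in [set x | exists g, x = sigma g /\ pi g \in W']].
  move=> sW; apply/submodP; split.
    by exists 0; rewrite pi0 mem0v sigma0.
  move=> a _ _ [g [-> gW]] [h [-> hW]]; have [k ->] := clsS a.
  by exists (k * g + h); rewrite sigmaD sigmaM piD memvD ?sW.
elim: c W => [|c IH] W sW UW dW.
  exists (fun=> [set x | exists g, x = sigma g /\ pi g \in W]); split=> // i _.
  exact: sub.
have Wf : W != fullv by apply/eqP => e; move: dW; rewrite e; lia.
have [z [zW Xz]] := socle Wf; pose W' := (W + <[pi z]>)%VS.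
have WW' : (W <= W')%VS by apply: addvSl.
have zW' : pi z \in W' by apply: subvP (addvSr _ _) _ (memv_line _).
have gz g : pi (g * z) \in W'.
  rewrite [g]mps_decomp mulrDl piD piC memvD ?memvZ // mulr_suml.
  apply: pi_sum => i; rewrite mulrAC mulrC; apply: (subvP WW').
  exact: sW.
have sW' : stable W'.
  move=> g h /memv_addP [u uW [_ /vlineP [k ->] hE]].
  have -> : g * h = g * (h - mpsC k * z) + g * mpsC k * z by ring.
  rewrite piD memvD // (subvP WW') //; apply: sW.
  by rewrite piD piN piC hE addrK.
have dW' : (\dim W' + c = \dim {:V})%N.
  rewrite dimv_disjoint_sum.
    rewrite dim_vline; case: eqP => [z0|_] /=; last by lia.
    by rewrite z0 mem0v in zW.
  apply/eqP; rewrite -subv0; apply/subvP => u; rewrite memv_cap memv0.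
  move=> /andP [uW /vlineP [k uE]]; rewrite uE in uW *.
  case: (eqVneq k 0) => [->|k0]; first by rewrite scale0r.
  by case/negP: zW; rewrite -[pi z](scalerK k0) memvZ.
have [X [X0 Xm Xs]] := IH W' sW' (subv_trans UW WW') dW'.
exists (fun i => if i is j.+1 then X j else [set x | exists g, x = sigma g /\ pi g \in W]).
split=> // [[|i] ic|[|i] ic]; [exact: sub | exact: Xm | | exact: Xs].
rewrite X0; split=> [_ [g [-> gW]]|ss].
  by exists g; split=> //; apply: (subvP WW').
have [g [zg gW]] : [set x | exists g, x = sigma g /\ pi g \in W] (sigma z).
  by apply: ss; exists z.
have /sigma_pi zgU : sigma (z - g) = 0 by rewrite sigmaD sigmaN zg subrr.
case/negP: zW; rewrite -[z](subrK g) piD memvD //; exact: subvP UW _ zgU.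
Qed.

(** [M] is [V / U] as a module. A stable subspace other than [V] is a hyperplane in
    a larger one, spanned by [socle], so that maximal chains have the length of
    complete flags. *)
Lemma length_by_dimension : is_length M (\dim {:V} - \dim U).
Proof.
have dU : (\dim U <= \dim {:V})%N by rewrite dimvS ?subvf.
split; last by move=> k /length_le; lia.
have sU : stable U.
  by move=> g h /sigma_pi h0; apply/sigma_pi; rewrite sigmaM h0 scaler0.
have [|X [_ Xm Xs]] := chain_from (c := \dim {:V} - \dim U) sU (subvv U).
  by rewrite subnKC.
by exists X.
Qed.

End Length.

Local Close Scope classical_set_scope.

(** * Polynomials in separate blocks of variables *)

Local Open Scope classical_set_scope.

(** A polynomial in separate variables: [None] stands for a term [xy] and [Some k]
    for a term [x^k]. *)
Definition shape := seq (option nat).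

Definition nvars (sh : shape) : nat := (\sum_(b <- sh) if b is Some _ then 1 else 2)%N.

Section Shapes.
Variables (K : fieldType) (q : nat).

(** The polynomial acting on [K[x_0, ..., x_n] / (x_0^q, ..., x_n^q)]. *)
Fixpoint blocks (sh : shape) : kmod K :=
  match sh with
  | [::] => unitk K
  | None :: sh' => tens (@diagstep q q) 1 (blocks sh')
  | Some k :: sh' => tens (@powstep k q) 1 (blocks sh')
  end.

(** The truncation of the series in which [G s] is the coefficient of the monomial
    of exponents [s]. *)
Fixpoint coords (sh : shape) : (seq nat -> K) -> kcar (blocks sh) :=
  match sh with
  | [::] => fun G => G [::]
  | None :: sh' => fun G =>
      [ffun ab : 'I_q * 'I_q => coords sh' (fun s => G [:: (ab.1 : nat), (ab.2 : nat) & s])]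
  | Some k :: sh' => fun G => [ffun a : 'I_q => coords sh' (fun s => G ((a : nat) :: s))]
  end.

(** The coefficients of the product with the polynomial. *)
Fixpoint shape_mul (sh : shape) (G : seq nat -> K) (s : seq nat) : K :=
  match sh, s with
  | None :: sh', [:: a, b & s'] =>
      shape_mul sh' (fun t => G [:: a, b & t]) s'
        + (if (0 < a)%N && (0 < b)%N then G [:: a.-1, b.-1 & s'] else 0)
  | Some k :: sh', a :: s' =>
      shape_mul sh' (fun t => G (a :: t)) s' + (if (k <= a)%N then G ((a - k)%N :: s') else 0)
  | _, _ => 0
  end.

Lemma coordsD sh G H : coords sh (fun s => G s + H s) = coords sh G + coords sh H.
Proof.
elim: sh G H => [|[k|] sh IH] G H //=; apply/ffunP => i; rewrite !ffunE; exact: IH.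
Qed.

Lemma coordsZ sh c G : coords sh (fun s => c * G s) = c *: coords sh G.
Proof.
elim: sh G => [|[k|] sh IH] G //=; apply/ffunP => i; rewrite !ffunE; exact: IH.
Qed.

Lemma coords_eq0 sh G : coords sh G = 0 <->
  forall s, size s = nvars sh -> all (fun a => (a < q)%N) s -> G s = 0.
Proof.
rewrite /nvars; elim: sh G => [|[k|] sh IH] G /=; rewrite ?big_nil ?big_cons /=.
- by split=> [G0 [|//] _ _|G0]; last exact: G0.
- split=> [/ffunP G0 [|a s] //= [sz] /andP [aq sq]|G0].
    by have := G0 (Ordinal aq); rewrite !ffunE => /IH; apply.
  by apply/ffunP => a; rewrite !ffunE; apply/IH => s sz sq; apply: G0; rewrite /= ?sz ?ltn_ord.
- split=> [/ffunP G0 [|a [|b s]] //= [sz] /and3P [aq bq sq]|G0].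
    by have := G0 (Ordinal aq, Ordinal bq); rewrite !ffunE => /IH; apply.
  by apply/ffunP => a; rewrite !ffunE; apply/IH => s sz sq; apply: G0; rewrite /= ?sz ?ltn_ord.
Qed.

Lemma eq_coords sh G H : (forall s, size s = nvars sh -> G s = H s) -> coords sh G = coords sh H.
Proof.
move=> GH; apply/eqP; rewrite -subr_eq0 -scaleN1r -coordsZ -coordsD.
by apply/eqP/coords_eq0 => s sz _; rewrite GH // mulN1r subrr.
Qed.

Lemma coords0 sh : coords sh (fun=> 0) = 0.
Proof. exact/coords_eq0. Qed.

Lemma coords_surj sh v : exists G, v = coords sh G.
Proof.
elim: sh v => [|[k|] sh IH] v /=.
- by exists (fun=> v).
- have /choice [G GE] : forall a : 'I_q, exists G, v a = coords sh G by move=> a; apply: IH.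
  exists (fun s => if insub (head 0%N s) is Some a then G a (behead s) else 0).
  by apply/ffunP => a; rewrite ffunE /= valK GE.
- have /choice [G GE] : forall ab, exists G, v ab = coords sh G by move=> ab; apply: IH.
  exists (fun s => if ordpair q q (nth 0%N s 0) (nth 0%N s 1) is Some ab
                   then G ab (behead (behead s)) else 0).
  apply/ffunP => -[a b]; rewrite ffunE /= GE; congr coords.
  by have := ordpairP q q a b; rewrite /ordpair; case: insubP => [u _ ua|]; rewrite ?ltn_ord //;
    case: insubP => [w _ wb|]; rewrite ?ltn_ord // => _; congr G; congr pair; apply: val_inj.
Qed.

Lemma coords_mul sh G : coords sh (shape_mul sh G) = kop (blocks sh) (coords sh G).
Proof.
elim: sh G => [|[k|] sh IH] G; first by rewrite /= lfunE.
- apply/ffunP => a; rewrite [RHS](@tensE _ _ _ _ (blocks sh)) scale1r /= !ffunE -IH.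
  rewrite coordsD; congr (_ + _).
  case: leqP => ka; last first.
    rewrite coords0 big1 // => i; rewrite /powstep; case: insubP => //= j _ ji /eqP [ja].
    by rewrite -ja ji ltnNge leq_addl in ka.
  have aq : (a - k < q)%N by rewrite (leq_ltn_trans (leq_subr _ _)).
  rewrite (big_pred1 (Ordinal aq)) ?ffunE // => i; rewrite /powstep /=.
  case: insubP => [j _ ji|/negP nij]; last first.
    apply/esym/negbTE/eqP => e; apply: nij; rewrite e /= subnK //.
  apply/eqP/eqP => [[ja]|ia]; first by apply: val_inj; rewrite /= -ja ji addnK.
  by congr Some; apply: val_inj; rewrite ji ia /= subnK.
- apply/ffunP => -[a b]; rewrite [RHS](@tensE _ _ _ _ (blocks sh)) scale1r /= !ffunE /= -IH.
  rewrite coordsD; congr (_ + _).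
  have step i : (diagstep i == Some (a, b)) = (i.1.+1 == a :> nat) && (i.2.+1 == b :> nat).
    rewrite /diagstep; case: ltnP => iq.
      have := ordpairP q q i.1.+1 i.2.+1; case: ordpair => [[x y] /= [<- <-]|] //.
      by move=> [|]; rewrite leqNgt ?iq // => xq; apply/esym/negbTE/negP => /andP [/eqP e _];
        move: xq; rewrite e ltn_ord.
    have := ordpairP q q (i.1 + q).+1 0; case: ordpair => [[x y] /= [xq _]|_].
      by have := ltn_ord x; rewrite xq; lia.
    by apply/esym/negbTE/negP => /andP [_ /eqP e]; have := ltn_ord b; lia.
  case: (boolP ((0 < a)%N && (0 < b)%N)) => ab; last first.
    rewrite coords0 big_pred0 // => i; rewrite step; apply/negP => /andP [/eqP ia /eqP ib].
    by rewrite -ia -ib in ab.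
  have /andP [a0 b0] := ab.
  have aq : (a.-1 < q)%N by rewrite prednK // ltnW.
  have bq : (b.-1 < q)%N by rewrite prednK // ltnW.
  rewrite (big_pred1 (Ordinal aq, Ordinal bq)) ?ffunE // => -[i j]; rewrite step /=.
  apply/andP/eqP => [[/eqP ia /eqP jb]|[-> ->]] /=; last by rewrite !prednK.
  by congr pair; apply: val_inj; rewrite /= -?ia -?jb.
Qed.

End Shapes.

Section ShapePolynomial.
Variables (n : nat) (K : fieldType).
Local Notation S := (mpseries n.+1 K).
Local Notation x i := (@mpsX n.+1 K (inord i)).

Lemma coefpsD f g (a : expo n.+1) : coefps (f + g : S) a = coefps f a + coefps g a.
Proof. by []. Qed.

(** The variables before the [i]-th one are already in use. *)
Fixpoint shape_poly (i : nat) (sh : shape) : S :=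
  match sh with
  | [::] => 0
  | None :: sh' => x i * x i.+1 + shape_poly i.+2 sh'
  | Some k :: sh' => x i ^+ k + shape_poly i.+1 sh'
  end.

Lemma shape_poly_cat i sh sh' :
  shape_poly i (sh ++ sh') = shape_poly i sh + shape_poly (i + nvars sh) sh'.
Proof.
rewrite /nvars; elim: sh i => [|[k|] sh IH] i /=; first by rewrite big_nil addn0 add0r.
- by rewrite big_cons IH addrA addnA addn1.
- by rewrite big_cons IH addrA addnA addn2.
Qed.

Definition expo_of (s : seq nat) : expo n.+1 := [ffun i : 'I_n.+1 => nth 0%N s i].

Lemma expo_of_map (a : expo n.+1) : expo_of [seq a i | i <- enum 'I_n.+1] = a.
Proof. by apply/ffunP => i; rewrite ffunE (nth_map ord0) ?size_enum_ord // nth_ord_enum. Qed.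

Lemma coefpsXnM (i : 'I_n.+1) k (f : S) (a : expo n.+1) : coefps (mpsX i ^+ k * f) a =
  if (k <= a i)%N then coefps f [ffun j => if j == i then (a i - k)%N else a j] else 0.
Proof.
elim: k a => [|k IH] a.
  rewrite expr0 mul1r; congr coefps; apply/ffunP => j; rewrite !ffunE subn0.
  by case: eqP => [->|].
rewrite exprS -mulrA coefpsXM IH !ffunE eqxx.
case: (posnP (a i)) => ai; first by rewrite ai.
have -> : (k < a i)%N = (k <= a i - 1)%N by lia.
case: ifP => // ka; congr coefps; apply/ffunP => j; rewrite !ffunE.
by case: eqP => _; lia.
Qed.

(** Here [l] lists the exponents of the variables that precede those of [sh]. *)
Lemma coefps_shape_poly i sh l s g : size l = i -> size s = nvars sh -> (i + nvars sh <= n.+1)%N ->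
  coefps (shape_poly i sh * g) (expo_of (l ++ s)) =
  shape_mul sh (fun t => coefps g (expo_of (l ++ t))) s.
Proof.
have set_last a m (t u : seq nat) (j : 'I_n.+1) : j = size u :> nat ->
    [ffun k => if k == j then m else expo_of (u ++ a :: t) k] = expo_of (u ++ m :: t).
  move=> ju; apply/ffunP => k; rewrite !ffunE !nth_cat -ju -val_eqE /=.
  case: eqP => [->|kj]; first by rewrite ltnn subnn.
  by case: ltnP => // jk; rewrite (_ : (k - j)%N = (k - j).-1.+1) //; lia.
rewrite /nvars; elim: sh i l s => [|[k|] sh IH] i l s li; rewrite [shape_poly _ _]/=.
- by rewrite mul0r; case: s.
- rewrite big_cons; case: s => [|a s] // [sz] le.
  have ii : (inord i : 'I_n.+1) = i :> nat by rewrite inordK //; lia.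
  rewrite mulrDl coefpsD addrC [RHS]/= -[in LHS]cat_rcons; congr (_ + _).
    rewrite IH ?size_rcons ?li //; last by lia.
    by congr shape_mul; apply/funext => t; rewrite cat_rcons.
  rewrite cat_rcons [LHS]coefpsXnM ffunE ii nth_cat -li ltnn subnn /=.
  by rewrite set_last ?li ?ii.
- rewrite big_cons; case: s => [|a [|b s]] // [sz] le.
  have ii : (inord i : 'I_n.+1) = i :> nat by rewrite inordK //; lia.
  have ii1 : (inord i.+1 : 'I_n.+1) = i.+1 :> nat by rewrite inordK //; lia.
  rewrite mulrDl coefpsD addrC [RHS]/= (_ : l ++ [:: a, b & s] = rcons (rcons l a) b ++ s); last first.
    by rewrite !cat_rcons.
  congr (_ + _).
    rewrite IH ?size_rcons ?li //; last by lia.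
    by congr shape_mul; apply/funext => t; rewrite !cat_rcons.
  rewrite cat_rcons -(expr1 (x i)) -(expr1 (x i.+1)) -mulrA [LHS]coefpsXnM.
  rewrite ffunE ii cat_rcons nth_cat -li ltnn subnn [nth _ _ _]/= set_last ?li ?ii // coefpsXnM.
  rewrite ffunE ii1 -cat_rcons nth_cat size_rcons li ltnn subnn /=.
  rewrite set_last ?ii1 ?size_rcons ?li // cat_rcons !subn1.
  by case: posnP => a0; case: posnP => b0.
Qed.

End ShapePolynomial.

Local Close Scope classical_set_scope.

(** * Hilbert-Kunz functions as numbers of Jordan blocks *)

Local Open Scope classical_set_scope.

Section HilbertKunzLength.
Variables (n : nat) (K : fieldType) (p e : nat) (sh : shape).
Hypothesis pK : p \in [pchar K].
Variables (f : mpseries n.+1 K) (f0 : const_term f = 0).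
Hypothesis fE : f = shape_poly n K 0 sh.
Hypothesis shn : nvars sh = n.+1.
Local Notation S := (mpseries n.+1 K).
Local Notation A := (hypersurface f0).
Local Notation q := (p ^ e)%N.

Let q0 : (0 < q)%N. Proof. by rewrite expn_gt0 prime_gt0 ?(pcharf_prime pK). Qed.

Let pS : p \in [pchar S].
Proof.
rewrite inE (pcharf_prime pK); have H k : k%:R = mpsC k%:R :> S.
  by elim: k => [|k IH]; rewrite ?mpsC0 // !mulrS IH mpsCD mpsC1.
by rewrite H (pcharf0 pK) mpsC0 eqxx.
Qed.

Definition coords_of (g : S) : kcar (blocks K q sh) := coords q sh (fun s => coefps g (expo_of n s)).

Lemma coords_of_eq0 g : coords_of g = 0 <->
  forall a : expo n.+1, (forall i, (a i < q)%N) -> coefps g a = 0.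
Proof.
rewrite /coords_of coords_eq0; split=> [g0 a aq|g0 s sz /allP sq].
  rewrite -[a]expo_of_map; apply: g0; first by rewrite size_map size_enum_ord shn.
  by apply/allP => _ /mapP [i _ ->].
by apply: g0 => i; rewrite ffunE; apply/sq/mem_nth; rewrite sz shn ltn_ord.
Qed.

Lemma coords_ofB g h : coords_of (g - h) = coords_of g - coords_of h.
Proof.
rewrite -scaleN1r -coordsZ -coordsD; congr coords; apply/funext => s.
by rewrite coefpsD mulN1r.
Qed.

Lemma eq_coords_of g h :
  (forall a : expo n.+1, (forall i, (a i < q)%N) -> coefps (g - h) a = 0) -> coords_of g = coords_of h.
Proof. by move=> /coords_of_eq0; rewrite coords_ofB => /eqP; rewrite subr_eq0 => /eqP. Qed.

Lemma coords_of_surj v : exists g, v = coords_of g.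
Proof.
have [G ->] := coords_surj v.
exists (MPSeries (fun a => G [seq a i | i <- enum 'I_n.+1])).
apply: eq_coords => s sz; rewrite [RHS]/=; congr G.
apply: (@eq_from_nth _ 0%N); rewrite sz shn ?size_map -?enumT ?size_enum_ord // => i il.
by rewrite (nth_map ord0) ?size_enum_ord // ffunE nth_enum_ord.
Qed.

Lemma coords_of_mul g : coords_of (f * g) = kop (blocks K q sh) (coords_of g).
Proof.
rewrite -coords_mul; apply: eq_coords => s sz.
by rewrite fE -[expo_of n s]/(expo_of n ([::] ++ s)) coefps_shape_poly // shn.
Qed.

(** Each monomial is assigned to its first variable of exponent at least [q]. *)
Lemma frobenius_ideal g : (forall a : expo n.+1, (forall i, (a i < q)%N) -> coefps g a = 0) ->
  exists h : 'I_n.+1 -> S, g = \sum_i mpsX i ^+ q * h i.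
Proof.
move=> g0; pose first_ge (i : 'I_n.+1) (a : expo n.+1) := [forall j : 'I_n.+1, (j < i)%N ==> (a j < q)%N].
exists (fun i => MPSeries (fun b => if first_ge i b then
  coefps g [ffun j => if j == i then (b i + q)%N else b j] else 0)).
apply: mpsP => a; rewrite coefps_sum.
have E i : coefps (mpsX i ^+ q * MPSeries (fun b => if first_ge i b then
  coefps g [ffun j => if j == i then (b i + q)%N else b j] else 0)) a =
  if (q <= a i)%N && first_ge i a then coefps g a else 0.
  rewrite coefpsXnM; case: leqP => //= qa.
  rewrite (_ : first_ge i _ = first_ge i a).
    case: ifP => // _; congr coefps; apply/ffunP => j; rewrite !ffunE eqxx subnK //.
    by case: eqP => [->|].
  apply: eq_forallb => j; rewrite ffunE; case: eqP => [->|//]; by rewrite ltnn.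
under eq_bigr do rewrite E.
case: (pselect (exists i, (q <= a i)%N)) => [[i0 i0q]|nq]; last first.
  have aq i : (a i < q)%N by rewrite ltnNge; apply/negP => ?; apply: nq; exists i.
  by rewrite g0 // big1 // => i _; rewrite leqNgt aq.
case: (arg_minnP (P := fun i : 'I_n.+1 => (q <= a i)%N) (fun i => i : nat) i0q) => i iq imin.
have fi : first_ge i a.
  by apply/forallP => j; apply/implyP => ji; rewrite ltnNge; apply/negP => /imin; rewrite leqNgt ji.
rewrite (bigD1 i) //= big1 => [|j ji]; first by rewrite addr0 (_ : _ && _) // iq fi.
case: ifP => // /andP [jq /forallP /(_ i)]; rewrite [(a i < q)%N]ltnNge iq implybF -leqNgt => ij.
have ije : i = j by apply: val_inj; apply/eqP; rewrite eqn_leq ij (imin j jq).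
by rewrite ije eqxx in ji.
Qed.

Let J : set A^o := [set a ^+ q | a in max_ideal f0].
Let M := mod_frobenius_power (max_ideal f0) q.
Let sigma (g : S) : M := \pi_(Quotient.quot (@span_set A A^o J))%qT (cls f0 g).

Lemma sigma_eq0 g : sigma g = 0 <-> @span_set A A^o J (cls f0 g).
Proof.
have pi0 : \pi_(Quotient.quot (@span_set A A^o J))%qT 0 = 0 :> M.
  by apply: (addrI (\pi_(Quotient.quot (@span_set A A^o J))%qT 0 : M)); rewrite -piQD !addr0.
by rewrite /sigma -pi0; split=> [/eqP|h]; last apply/eqP; rewrite -Quotient.idealrBE subr0.
Qed.

Lemma frobenius_sum (r : 'I_n.+1 -> S) : (\sum_i r i) ^+ q = \sum_i r i ^+ q.
Proof.
elim/big_rec2: _ => [|i y z _ <-]; first by rewrite expr0n; case: (q) q0.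
by rewrite exprDn_pchar // pnatX (pnatE _ (pcharf_prime pK)) pS.
Qed.

(** The inverse image of [m^[q]] is generated by [f] and the [x_i^q], by additivity
    of the Frobenius map, and truncation has the latter as its kernel. *)
Lemma sigma_coords g : sigma g = 0 <-> coords_of g \in limg (kop (blocks K q sh)).
Proof.
rewrite sigma_eq0; split=> [/asboolP [k [c [x [xm gE]]]]|/memv_imgP [v _ gv]].
  have /choice [y yE] : forall i, exists y, const_term y = 0 /\ x i = cls f0 y ^+ q.
    by move=> i; have [_ [y [-> y0]] <-] := xm i; exists y.
  have /choice [b bE] : forall i, exists b, c i = cls f0 b by move=> i; apply: clsS.
  have : cls f0 (g - \sum_i b i * y i ^+ q) = 0.
    rewrite clsD clsN cls_sum gE; apply/eqP; rewrite subr_eq0; apply/eqP.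
    by apply: eq_bigr => i _; rewrite clsM clsXn bE; have [_ ->] := yE i.
  move=> /cls_eq0 [h hE].
  have -> : coords_of g = coords_of (h * f).
    apply: eq_coords_of; rewrite -hE opprB addrC subrK => a aq.
    rewrite coefps_sum big1 // => i _; have [y0 _] := yE i.
    rewrite [y i]mps_decomp y0 mpsC0 add0r frobenius_sum mulr_sumr coefps_sum big1 // => j _.
    by rewrite exprMn mulrCA coefpsXnM leqNgt aq.
  by rewrite mulrC coords_of_mul memv_img ?memvf.
have [h vh] := coords_of_surj v; rewrite vh -coords_of_mul in gv.
have /frobenius_ideal [r rE] : forall a : expo n.+1, (forall i, (a i < q)%N) -> coefps (g - f * h) a = 0.
  by apply/coords_of_eq0; rewrite coords_ofB gv subrr.
apply/asboolP; exists n.+1, (fun i => cls f0 (r i)), (fun i => cls f0 (mpsX i) ^+ q); split=> [i|].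
  by exists (cls f0 (mpsX i)) => //; apply/max_ideal_cls/const_termX.
have -> : g = \sum_i mpsX i ^+ q * r i + h * f by rewrite -rE [h * f]mulrC subrK.
rewrite clsD [X in _ + X]clsM cls_f mulr0 addr0 cls_sum.
by apply: eq_bigr => i _; rewrite clsM clsXn mulrC.
Qed.

(** The cokernel of [f] on the truncation has the dimension of its kernel. *)
Lemma hilbert_kunz_length : is_length M (nblocks (blocks K q sh)).
Proof.
have -> : nblocks (blocks K q sh) =
  (\dim {:kcar (blocks K q sh)} - \dim (limg (kop (blocks K q sh))))%N.
  by rewrite -(limg_ker_dim (kop (blocks K q sh)) fullv) capfv addnK.
apply: (@length_by_dimension _ _ _ f0 M sigma _ coords_of _ (n.+1 * q)%N).
- by move=> g h; rewrite /sigma clsD; apply: piQD.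
- by move=> g h; rewrite /sigma clsM; apply/esym; apply: quot_scale_pi.
- by move=> x; elim/piQ_ind: x => u; have [g ->] := clsS u; exists g.
- by move=> g h; rewrite -coordsD.
- by move=> c g; rewrite -coordsZ; congr coords; apply/funext => s; rewrite coefpsCM.
- exact: coords_of_surj.
- exact: sigma_coords.
- move=> g gN; apply/coords_of_eq0 => a aq; apply: gN.
  have: (edeg a <= n.+1 * q.-1)%N.
    rewrite /edeg -[X in (_ <= X * _)%N]card_ord -sum_nat_const.
    by apply: leq_sum => i _; have := aq i; lia.
  nia.
Qed.

End HilbertKunzLength.

Local Close Scope classical_set_scope.

(** * Recursions for the Hilbert-Kunz functions *)

Definition block_sizes q (b : option nat) : seq nat := if b is Some k then powsizes k q else xysizes q.

Definition hk_value (K : fieldType) q (sh : shape) : rat := multisum (tblocksQ K) (map (block_sizes q) sh) [::].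

(** The terms are treated one after the other, in the presence of the blocks [s]
    that have been chosen for the preceding ones. *)
Lemma nblocks_blocks (K : fieldType) q (sh : shape) : (0 < q)%N -> Some 0%N \notin sh ->
  (nblocks (blocks K q sh))%:R = hk_value K q sh.
Proof.
move=> q0; rewrite /hk_value -[blocks K q sh]/(foldr (@delta K) (blocks K q sh) [::]).
elim: sh [::] => [|b sh IH] s; first by [].
rewrite inE negb_or => /andP [b0 sh0]; rewrite [multisum _ _ _]/=.
have E (I : finType) (phi : I -> option I) : (forall X : kmod K, nblocks (tens phi 1 X) =
     (\sum_(i <- block_sizes q b) nblocks (delta i X))%N) ->
    (nblocks (foldr (@delta K) (tens phi 1 (blocks K q sh)) s))%:R =
    \sum_(i <- block_sizes q b) multisum (tblocksQ K) (map (block_sizes q) sh) (i :: s).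
  move=> phiE; rewrite -(nblocks_iso (tens_deltas _ _ _ _)) phiE natr_sum.
  by apply: eq_bigr => i _; rewrite -IH.
case: b b0 E => [k|] k0 E; apply: E => X.
  by rewrite nblocks_powsizes ?oner_neq0 // lt0n; apply: contraNneq k0 => ->.
by rewrite nblocks_diag_square ?oner_neq0 //; apply: eq_bigr => i _; rewrite nblocks_delta.
Qed.

Lemma hk_value_pairs K q k sh : hk_value K q (nseq k None ++ sh) =
  multisum (tblocksQ K) (nseq k (xysizes q) ++ map (block_sizes q) sh) [::].
Proof. by rewrite /hk_value map_cat map_nseq. Qed.

Section Recursions.
Variable K : fieldType.
Implicit Types (s M : seq nat) (Ms : seq (seq nat)).
Local Notation tblocksQ := (tblocksQ K).
Local Notation excess := (excess K).
Local Notation le n := (leq^~ n).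

Lemma tblocksQ_excess Q Ms s : multisum tblocksQ Ms s = multisum (excess Q) Ms s + multisum (szprod rat) Ms s / Q%:R.
Proof. by rewrite multisum_excess subrK. Qed.

Lemma multisum_tblocksQ_full p e k Ms s : p \in [pchar K] ->
    all (all (le (p ^ e)%N)) Ms -> all (le (p ^ e)%N) s ->
  multisum tblocksQ (nseq k (p ^ e)%N :: Ms) s = k%:R * multisum (szprod rat) Ms s.
Proof.
move=> pK Mq sq; rewrite -cat1s multisum_rot; last exact: tblocksQ_sym.
rewrite [LHS](eq_multisum (G := fun s' => k%:R * szprod rat s' + 0 * szprod rat s') _ Mq sq) => [|s' sq'].
  by rewrite multisum_lin mul0r addr0.
rewrite /= big_nseq iter_addr_0 (tblocksQ_full pK sq') // -mulr_natl; ring.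
Qed.

Lemma multisum_szprod_cons M Ms s : multisum (szprod rat) (M :: Ms) s = (sumn M)%:R * multisum (szprod rat) Ms s.
Proof. by rewrite !multisum_szprod big_cons mulrA. Qed.

Lemma multisum_szprod_xy q m Ms s : (0 < q)%N ->
  multisum (szprod rat) (nseq m (xysizes q) ++ Ms) s = q%:R ^+ (2 * m) * multisum (szprod rat) Ms s.
Proof. by move=> q0; rewrite multisum_szprod_nseq sumn_xysizes // natrM -expr2 exprM. Qed.

Lemma szprod_nil : (szprod rat [::] = 1) * (multisum (szprod rat) [::] [::] = 1).
Proof. by rewrite /= /szprod big_nil. Qed.

Lemma all_xysizes q m Ms : all (all (le q)) Ms -> all (all (le q)) (nseq m (xysizes q) ++ Ms).
Proof. by move=> Mq; rewrite all_cat all_nseq xysizes_le orbT. Qed.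

End Recursions.

Section CharTwo.
Variable K : fieldType.
Hypothesis pK : 2 \in [pchar K].
Variable e : nat.
Implicit Types (s M : seq nat) (Ms : seq (seq nat)).
Local Notation tblocksQ := (tblocksQ K).
Local Notation excess := (excess K).
Local Notation le n := (leq^~ n).
Local Notation q := (2 ^ e)%N.
Local Notation Q := (2 ^ e.+1)%N.

Let q0 : (0 < q)%N. Proof. by rewrite expn_gt0. Qed.
Let Q0 : (0 < Q)%N. Proof. by rewrite expn_gt0. Qed.
Let Qq : Q = (2 * q)%N. Proof. by rewrite expnS. Qed.
Let Qr : Q%:R = 2 * q%:R :> rat. Proof. by rewrite Qq natrM. Qed.

Lemma tblocksQ_doubling k Ms : all (all (le q)) Ms ->
  multisum tblocksQ (nseq k.+1 (xysizes Q) ++ Ms) [::] =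
  2 ^+ k * multisum tblocksQ (nseq k.+1 (xysizes q) ++ Ms) [::] +
  Q%:R ^+ (2 * k).+1 * multisum (szprod rat) Ms [::].
Proof.
move=> Mq; have Q0r : Q%:R != 0 :> rat by rewrite pnatr_eq0 -lt0n.
rewrite (tblocksQ_excess _ Q) excess_xysizes_doubling // multisum_szprod_xy // mulnS add2n exprS; congr (_ + _).
by rewrite mulrC -!mulrA mulKf.
Qed.

Lemma hk_A1_odd k : hk_value K Q (nseq k.+1 None) =
  2 ^+ k * hk_value K q (nseq k.+1 None) + Q%:R ^+ (2 * k).+1.
Proof.
have := @tblocksQ_doubling k [::] isT; rewrite !cats0 szprod_nil mulr1.
by rewrite /hk_value !map_nseq.
Qed.

Lemma powsizes2_double : powsizes 2 Q = nseq 2 q.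
Proof. by rewrite /powsizes /= Qq; congr [:: _; _]; lia. Qed.

(** Both blocks of the square have size [q], at which the count is a product. *)
Lemma hk_A1_even k : hk_value K Q (nseq k.+1 None ++ [:: Some 2%N]) =
  2 ^+ k.+1 * q%:R ^+ (2 * k.+1) + Q%:R ^+ (2 * k.+1).
Proof.
rewrite hk_value_pairs [map _ _]/= powsizes2_double tblocksQ_doubling; last by rewrite /= leqnn.
rewrite (multisum_perm (Ns := nseq 2 q :: nseq k.+1 (xysizes q))); last 2 first.
- exact: tblocksQ_sym.
- by rewrite perm_catC.
rewrite (multisum_tblocksQ_full (p := 2)) //; last by rewrite -[nseq _ _]cats0; apply: all_xysizes.
rewrite -[nseq k.+1 _]cats0 multisum_szprod_xy // multisum_szprod_cons !szprod_nil [sumn _]/=.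
by rewrite addn0 natrD Qr !mulnS !exprS !exprMn !exprM; ring.
Qed.

Lemma powsizes3_double : all (le q) (powsizes 3 Q).
Proof. by rewrite /powsizes /= Qq; lia. Qed.

Lemma hk_A2_odd k : hk_value K Q (nseq k None ++ [:: Some 2%N; Some 3%N]) =
  2 ^+ k * q%:R ^+ (2 * k) * Q%:R + Q%:R ^+ (2 * k).+1.
Proof.
have p3 := powsizes3_double.
case: k => [|k]; rewrite hk_value_pairs [map _ _]/= powsizes2_double.
  rewrite (multisum_tblocksQ_full (p := 2)) //; last by apply/andP; split.
  by rewrite multisum_szprod_cons !szprod_nil sumn_powsizes3; ring.
rewrite tblocksQ_doubling; last by apply/and3P; split; rewrite //= leqnn.
rewrite (multisum_perm (Ns := nseq 2 q :: nseq k.+1 (xysizes q) ++ [:: powsizes 3 Q])); last 2 first.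
- exact: tblocksQ_sym.
- by apply/permP => P; rewrite /= !count_cat /=; lia.
rewrite (multisum_tblocksQ_full (p := 2)) //; last by apply: all_xysizes; apply/andP; split.
rewrite multisum_szprod_xy // !multisum_szprod_cons sumn_powsizes3 !szprod_nil [sumn _]/= addn0 natrD Qr.
by rewrite !mulnS !exprS !exprMn !exprM; ring.
Qed.

Lemma powsizes3_reflect : perm_eq (powsizes 3 Q) [seq (q - i)%N | i <- powsizes 3 q].
Proof.
have h : [:: ((Q + 2) %/ 3)%N; ((Q + 1) %/ 3)%N; ((Q + 0) %/ 3)%N] =
    rev [seq (q - i)%N | i <- [:: ((q + 2) %/ 3)%N; ((q + 1) %/ 3)%N; ((q + 0) %/ 3)%N]].
  by rewrite Qq /rev /=; congr [:: _; _; _]; lia.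
by rewrite /powsizes /= h perm_rev.
Qed.

(** The sizes of the cube at [2q] are the complements in [q] of those at [q], and
    reflecting at level [q] against a list of [xy] leads back to the latter. *)
Lemma hk_A2_even k : hk_value K Q (nseq k.+1 None ++ [:: Some 3%N]) =
  2 ^+ k * (hk_value K q (nseq k.+1 None ++ [:: Some 3%N]) + q%:R ^+ (2 * k.+1)) +
  Q%:R ^+ (2 * k.+1).
Proof.
rewrite !hk_value_pairs ![map _ _]/= tblocksQ_doubling; last by apply/andP; split=> //; apply: powsizes3_double.
rewrite multisum_szprod_cons sumn_powsizes3 szprod_nil mulr1 -exprSr mulnS add2n; congr (_ * _ + _).
have Wq := xysizes_le q; have Yq : all (le q) (powsizes 3 q) by rewrite /powsizes /=; lia.
pose Y' := [seq (q - i)%N | i <- powsizes 3 q].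
have Y'E : multisum tblocksQ (nseq k.+1 (xysizes q) ++ [:: powsizes 3 Q]) [::] =
           multisum tblocksQ (nseq k.+1 (xysizes q) ++ [:: Y']) [::].
  rewrite !(multisum_rot (nseq _ _)); try exact: tblocksQ_sym.
  exact: perm_big powsizes3_reflect.
have reflect : multisum (excess q) (nseq k.+1 (xysizes q) ++ [:: Y']) [::] =
           multisum (excess q) (nseq k.+1 (xysizes q) ++ [:: powsizes 3 q]) [::].
  rewrite -!(multisum_perm _ (@excess_sym K q) (perm_nseq_mid k _ _)) !multisum_cat.
  apply: (eq_multisum (P := le q)) => //; last by rewrite -[nseq _ _]cats0; apply: all_xysizes.
  move=> s sq; rewrite !(multisum_swap (xysizes q)); try exact: excess_sym.
  rewrite multisum_cons big_map [RHS]multisum_cons; apply: eq_big_seq => i /(allP Yq) iq.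
  exact: (xysizes_excess_reflect pK sq iq).
rewrite Y'E (tblocksQ_excess K q) reflect [in RHS](tblocksQ_excess K q) !multisum_szprod_xy // !multisum_szprod_cons !szprod_nil.
rewrite (perm_sumn (s2 := powsizes 3 Q)) 1?perm_sym ?powsizes3_reflect // !sumn_powsizes3 Qr.
by rewrite mulnS add2n; field.
Qed.

End CharTwo.

Section CharThreeValues.
Variable K : fieldType.
Hypothesis pK : 3 \in [pchar K].
Variable e : nat.
Local Notation tblocksQ := (tblocksQ K).
Local Notation excess := (excess K).
Local Notation le n := (leq^~ n).
Local Notation q := (3 ^ e)%N.
Local Notation Q := (3 ^ e.+1)%N.

Let q0 : (0 < q)%N. Proof. by rewrite expn_gt0. Qed.
Let Qr0 : Q%:R != 0 :> rat. Proof. by rewrite pnatr_eq0 expn_eq0. Qed.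

Lemma multisum_pairs_squares e' m Ms s :
  multisum tblocksQ (nseq m (xysizes (3 ^ e')) ++ Ms) s = multisum tblocksQ (nseq m.*2 (powsizes 2 (3 ^ e')) ++ Ms) s.
Proof.
elim: m Ms => // m IH Ms; set W := xysizes _; set A := powsizes 2 _.
rewrite -(multisum_perm _ (@tblocksQ_sym K) (perm_nseq_mid m _ _)) IH -/A.
have A2 : perm_eq (nseq m.*2 A ++ W :: Ms) ([:: W] ++ (nseq m.*2 A ++ Ms)).
  by apply/permP => P; rewrite /= !count_cat /=; lia.
rewrite (multisum_perm _ (@tblocksQ_sym K) A2) multisum_rot; last exact: tblocksQ_sym.
rewrite doubleS [RHS](@multisum_rot _ _ [:: A; A]); last exact: tblocksQ_sym.
rewrite (eq_multisum (P := predT) (G := multisum tblocksQ [:: A; A])) ?all_predT //.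
  by move=> s' _; rewrite -tblocksQ_square.
by apply/allP => M _; apply: all_predT.
Qed.

Lemma tblocksQ_tripling n Ms : all (all (le q)) Ms ->
  multisum tblocksQ (nseq n.+1 (powsizes 2 Q) ++ Ms) [::] =
  jacobsthal n * multisum tblocksQ (nseq n.+1 (powsizes 2 q) ++ Ms) [::] +
  (jacobsthal n.+1 * q%:R ^+ n + Q%:R ^+ n) * multisum (szprod rat) Ms [::].
Proof.
move=> Mq; rewrite (tblocksQ_excess _ Q) excess_tripling // mulrDl addrA; congr (_ + _).
by rewrite multisum_szprod_nseq sumn_powsizes2 exprS mulrC -!mulrA mulKf.
Qed.

Lemma hk_A1_three n : multisum tblocksQ (nseq n.+1 (powsizes 2 Q)) [::] =
  jacobsthal n * multisum tblocksQ (nseq n.+1 (powsizes 2 q)) [::] +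
  (jacobsthal n.+1 * q%:R ^+ n + Q%:R ^+ n).
Proof. by have := @tblocksQ_tripling n [::] isT; rewrite !cats0 szprod_nil mulr1. Qed.

(** The three blocks of the cube at [3q] have size [q], at which the count is a
    product. *)
Lemma hk_A2_three n : multisum tblocksQ (nseq n.+1 (powsizes 2 Q) ++ [:: powsizes 3 Q]) [::] =
  3 * 2 ^+ n * q%:R ^+ n.+1 + Q%:R ^+ n.+1.
Proof.
have -> : powsizes 3 Q = nseq 3 q.
  by rewrite /powsizes /= expnS; congr [:: _; _; _]; lia.
rewrite tblocksQ_tripling; last by rewrite /= leqnn.
rewrite (multisum_perm (Ns := nseq 3 q :: nseq n.+1 (powsizes 2 q)) _ (@tblocksQ_sym K)); last first.
  by rewrite perm_catC.
rewrite (multisum_tblocksQ_full (p := 3)) //; last by rewrite all_nseq (powsizes2_le pK e) ?orbT.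
rewrite -[nseq n.+1 _]cats0 multisum_szprod_nseq sumn_powsizes2 multisum_szprod_cons !szprod_nil [sumn _]/= !addn0 !natrD.
by rewrite /jacobsthal expnS natrM !exprMn !exprS; field.
Qed.

End CharThreeValues.

(** * Chains of primes of maximal length *)

Local Open Scope classical_set_scope.

Section Killing.
Variables (n : nat) (K : fieldType).
Local Notation S := (mpseries n K).

Definition kill (v : 'I_n) : S -> S := mps_eval (fun j => if j == v then 0 else mpsX j).

Fixpoint killed (v : nat -> 'I_n) (i : nat) (g : S) : S :=
  if i is i'.+1 then kill (v i') (killed v i' g) else g.

Let kill_ord (v j : 'I_n) : ord_ge 1 (if j == v then 0 else mpsX j : S).
Proof. by case: eqP => // _; apply: ord_geX. Qed.

Lemma killD v g h : kill v (g + h) = kill v g + kill v h.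
Proof. exact: mps_evalD. Qed.

Lemma kill0 v : kill v 0 = 0.
Proof. exact: mps_eval0. Qed.

Lemma killM v g h : kill v (g * h) = kill v g * kill v h.
Proof. exact: mps_evalM. Qed.

Lemma killedD v i g h : killed v i (g + h) = killed v i g + killed v i h.
Proof. by elim: i => //= i ->; rewrite killD. Qed.

Lemma killedM v i g h : killed v i (g * h) = killed v i g * killed v i h.
Proof. by elim: i => //= i ->; rewrite killM. Qed.

Lemma killedC v i c : killed v i (mpsC c) = mpsC c.
Proof. by elim: i => //= i ->; rewrite /kill mps_evalC. Qed.

Lemma killed0 v i : killed v i 0 = 0.
Proof. by rewrite -(mpsC0 n K) killedC. Qed.

Lemma killedX v i j : killed v i (mpsX j) = if [exists k : 'I_i, v k == j] then 0 else mpsX j.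
Proof.
elim: i => [|i IH].
  by case: existsP => // -[[]].
rewrite [LHS]/= IH; case: existsP => [[k kj]|nk].
  rewrite (_ : [exists _, _] = true) ?kill0 //.
  by apply/existsP; exists (widen_ord (leqnSn i) k).
rewrite [LHS]mps_evalX // eq_sym; case: existsP => [[k kj]|nk'].
  case: eqP => // ne; case: (ltngtP k i) => ki.
  - by case: nk; exists (Ordinal ki).
  - by have := ltn_ord k; lia.
  - by case: ne; rewrite -ki (eqP kj).
by case: eqP => // e; case: nk'; exists ord_max; rewrite /= e.
Qed.

Lemma killed_const v i g : const_term (killed v i g) = const_term g.
Proof. by elim: i => //= i <-; apply: const_term_eval. Qed.

End Killing.

(** The evaluations are obtained from one by killing variables of the target. *)
Lemma krull_ge_kill n (K : fieldType) (f : mpseries n K) (f0 : const_term f = 0) n' d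
    (z : 'I_n -> mpseries n' K) (v : nat -> 'I_n') (w : nat -> mpseries n K) :
    (forall i, ord_ge 1 (z i)) -> mps_eval z f = 0 ->
    (forall i, (i < d)%N -> killed v i (mps_eval z (w i)) != 0 /\
      killed v i.+1 (mps_eval z (w i)) = 0) ->
  has_chain (@is_prime_ideal (hypersurface f0)) d.
Proof.
move=> z1 zf zw; have kz1 i j : ord_ge 1 (killed v i (z j)).
  by apply/ord_ge1P; rewrite killed_const; apply/ord_ge1P.
have kzE i g : mps_eval (fun j => killed v i (z j)) g = killed v i (mps_eval z g).
  apply/esym; move: g; apply: eval_unique => //.
  - by move=> g1 g2; rewrite mps_evalD // killedD.
  - by move=> c; rewrite mps_evalC // killedC.
  - by move=> j g1; rewrite mps_evalXM // killedM.
apply: (@krull_ge _ _ _ f0 _ _ (fun i j => killed v i (z j)) (fun i => kill (v i)) w).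
- by [].
- by move=> i _; rewrite kzE zf killed0.
- by move=> i _; apply: kill0.
- by move=> i g _; rewrite (kzE i.+1) (kzE i).
by move=> i id; rewrite !kzE; apply: zw.
Qed.

Section Dimension.
Variables (n : nat) (K : fieldType).
Local Notation S := (mpseries n.+1 K).
Local Notation x i := (@mpsX n.+1 K (inord i)).

(** The quotient by [t] of the value of [shape_poly] at [t x]. *)
Fixpoint shape_quot (t : S) (i : nat) (sh : shape) : S :=
  match sh with
  | [::] => 0
  | None :: sh' => x i * (t * x i.+1) + shape_quot t i.+2 sh'
  | Some k :: sh' => x i * (t * x i) ^+ k.-1 + shape_quot t i.+1 sh'
  end.

Lemma eval_shape_quot (t : S) (z : 'I_n.+1 -> S) i sh : (forall j, ord_ge 1 (z j)) ->
    (forall j, (i <= j < i + nvars sh)%N -> z (inord j) = t * x j) -> Some 0%N \notin sh ->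
  mps_eval z (shape_poly n K i sh) = t * shape_quot t i sh.
Proof.
move=> z1; rewrite /nvars; elim: sh i => [|[k|] sh IH] i zi.
- by rewrite mps_eval0 // mulr0.
- rewrite inE negb_or => /andP [k0 sh0]; rewrite big_cons in zi.
  rewrite [shape_poly _ _ _ _]/= mps_evalD // mps_evalXn // mps_evalX // zi; last by lia.
  rewrite IH // => [|j ij]; last by apply: zi; lia.
  rewrite [shape_quot _ _ _]/= mulrDr mulrA -exprS prednK // lt0n.
  by apply: contraNneq k0 => ->.
- rewrite inE /= => sh0; rewrite big_cons in zi.
  rewrite [shape_poly _ _ _ _]/= mps_evalD // mps_evalM // !mps_evalX // !zi; try by lia.
  rewrite IH // => [|j ij]; last by apply: zi; lia.
  by rewrite [shape_quot _ _ _]/= mulrDr -mulrA.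
Qed.

Lemma shape_quot_ord t i sh : ord_ge 1 (shape_quot t i sh).
Proof.
elim: sh i => [|[k|] sh IH] i //=; apply: ord_geD => //; rewrite mulrC; apply/ord_geMl/ord_geX.
Qed.

Lemma mulX_eq0 (i : 'I_n.+1) (g : S) : mpsX i * g = 0 -> g = 0.
Proof. by rewrite -[mpsX i]expr1; apply: mpsXn_eq0. Qed.

Lemma mpsX_neq0 (i : 'I_n.+1) : mpsX i != 0 :> S.
Proof.
apply/eqP => e; have := @mulX_eq0 i 1; rewrite mulr1 => /(_ e) /eqP.
by rewrite oner_eq0.
Qed.

Lemma pair_shape_neq0 sh : (nvars sh).+1 = n -> Some 0%N \notin sh ->
  shape_poly n K 0 (None :: sh) != 0.
Proof.
move=> shn sh0; pose z (j : 'I_n.+1) : S := if (j < 2)%N then mpsX j else 0.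
have z1 j : ord_ge 1 (z j) by rewrite /z; case: ifP => // _; apply: ord_geX.
apply/eqP => /(congr1 (mps_eval z)); rewrite [shape_poly _ _ _ _]/=.
rewrite mps_evalD // mps_evalM // !mps_evalX // mps_eval0 //.
rewrite (@eval_shape_quot 0) // => [|j ji]; last first.
  by rewrite /z mul0r inordK ?ifN //; lia.
rewrite mul0r addr0 /z !inordK; try by lia.
by move=> /mulX_eq0 /eqP; rewrite (negPf (mpsX_neq0 _)).
Qed.

(** Substituting [t] for [x_1] and [t x_i] for [x_i], [i >= 2], makes all the terms
    but [x_0 x_1] divisible by [t], so that a value for [x_0] cancels them; the
    variables [x_2, ..., x_n] and [t] are then killed in turn. *)
Lemma pair_shape_krull sh (f : mpseries n.+1 K) (f0 : const_term f = 0) :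
    f = shape_poly n K 0 (None :: sh) -> (nvars sh).+1 = n -> Some 0%N \notin sh ->
  has_chain (@is_prime_ideal (hypersurface f0)) n.
Proof.
move=> fE shn sh0; pose t := x 1; pose u := shape_quot t 2 sh.
pose z (j : 'I_n.+1) : S := if j == 0%N :> nat then - u else if j == 1%N :> nat then t else t * mpsX j.
have z1 j : ord_ge 1 (z j).
  rewrite /z; case: ifP => _; first by apply/ord_geN/shape_quot_ord.
  case: ifP => _; first exact: ord_geX.
  by apply/ord_geMl/ord_geX.
pose v i : 'I_n.+1 := inord (if (i.+1 < n)%N then i.+2 else 1).
pose w i : S := x (if (i.+1 < n)%N then i.+2 else 1).
have n1 : (1 <= n)%N by rewrite -shn.
apply: (@krull_ge_kill _ _ _ f0 _ _ z v w) => //.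
  rewrite fE [shape_poly _ _ _ _]/= mps_evalD // mps_evalM // !mps_evalX //.
  rewrite (@eval_shape_quot t) // => [|j ji]; last by rewrite /z inordK ?ifN ?ifN //; lia.
  by rewrite /z !inordK //= mulNr mulrC addNr.
have vE k : v k = (if (k.+1 < n)%N then k.+2 else 1) :> nat.
  by rewrite /v inordK //; case: ifP; lia.
have nk i j : (i < n)%N -> (forall k, (k < i)%N -> v k != j :> nat) -> (j <= n)%N -> killed v i (x j) = x j.
  move=> id H jn; rewrite killedX ifN //; apply/existsP => -[k] /eqP e.
  have /eqP := H k (ltn_ord k); apply; by rewrite e inordK.
have kk i j : v i = j :> nat -> killed v i.+1 (x j) = 0.
  move=> H; rewrite killedX ifT //; apply/existsP; exists ord_max.
  by rewrite -val_eqE /= -H inord_val.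
move=> i id; rewrite /w; case: ltnP => ilt.
  rewrite !mps_evalX // /z inordK; last by lia.
  rewrite [_ == _]/= [_ == _]/= !killedM (kk i i.+2) ?mulr0 ?vE ?ilt //; split=> //.
  rewrite /t !nk //; try by move=> k ki; rewrite vE; case: ifP; lia.
  by apply/eqP => /mulX_eq0 /eqP; rewrite (negPf (mpsX_neq0 _)).
rewrite !mps_evalX // /z inordK; last by lia.
rewrite [_ == _]/= [_ == _]/= /t kk ?vE ?ifN -?leqNgt //; split=> //.
by rewrite nk ?mpsX_neq0 //; move=> k ki; rewrite vE; case: ifP; lia.
Qed.

End Dimension.

Local Close Scope classical_set_scope.

(** * From a recursion to the multiplicity *)

Local Open Scope classical_set_scope.

Lemma affine_recursion_cvg (R : realType) (u : nat -> R) (a r : R) : `|r| < 1 ->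
  (forall e, u e.+1 = a + r * u e) -> u @ \oo --> a / (1 - r).
Proof.
move=> r1 uS; pose l := a / (1 - r).
have r0 : 1 - r != 0 by rewrite subr_eq0 eq_sym; apply: contraTneq r1 => ->; rewrite normr1 ltxx.
have uE e : u e = l + r ^+ e * (u 0%N - l).
  elim: e => [|e IH]; first by rewrite mul1r addrC subrK.
  by rewrite uS IH exprS /l; field.
rewrite -/l (_ : u = fun e => l + r ^+ e * (u 0%N - l)); last by apply/funext.
rewrite -[X in _ --> X]addr0 -[X in l + X](mul0r (u 0%N - l)).
by apply: cvgD; [exact: cvg_cst | apply: cvgMl; exact: cvg_expr].
Qed.

Lemma hypersurface_hilbert_kunz (R : realType) p n sh (f : mpseries n.+1 'F_p)
    (f0 : const_term f = 0) (a r : rat) :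
    prime p -> f = shape_poly n 'F_p 0 sh -> nvars sh = n.+1 -> Some 0%N \notin sh -> f != 0 ->
    has_chain (@is_prime_ideal (hypersurface f0)) n -> `|r| < 1 ->
    (forall e, hk_value 'F_p (p ^ e.+1) sh / (p ^ e.+1)%:R ^+ n =
       a + r * (hk_value 'F_p (p ^ e) sh / (p ^ e)%:R ^+ n)) ->
  is_hilbert_kunz_multiplicity (hypersurface f0) p (ratr (a / (1 - r)) : R).
Proof.
move=> pp fE shn sh0 fn0 ch r1 rec; have pF : p \in [pchar 'F_p] by apply: pchar_Fp.
exists (max_ideal f0), n, (fun e => nblocks (blocks 'F_p (p ^ e) sh)); split.
- exact: hypersurface_char.
- exact: hypersurface_local.
- by split=> // k; apply: krull_le.
- by move=> e; apply: hilbert_kunz_length.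
have uE e : (nblocks (blocks 'F_p (p ^ e) sh))%:R / (p%:R ^+ (e * n)) =
    ratr (hk_value 'F_p (p ^ e) sh / (p ^ e)%:R ^+ n) :> R.
  rewrite -nblocks_blocks ?expn_gt0 ?prime_gt0 // fmorph_div rmorphXn /= !ratr_nat.
  by rewrite natrX exprM.
rewrite fmorph_div rmorphB rmorph1 /=; apply: affine_recursion_cvg.
  by rewrite -ratr_norm -[1](ratr_nat R 1) ltr_rat.
by move=> e; rewrite !uE rec rmorphD rmorphM.
Qed.

Section Shapes.
Variable d : nat.

Definition A1_shape : shape := nseq (uphalf d) None ++ if odd d then [::] else [:: Some 2%N].
Definition A2_shape : shape :=
  nseq d./2 None ++ if odd d then [:: Some 2%N; Some 3%N] else [:: Some 3%N].

Lemma nvars_cat sh sh' : nvars (sh ++ sh') = (nvars sh + nvars sh')%N.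
Proof. exact: big_cat. Qed.

Lemma nvars_pairs m : nvars (nseq m None) = m.*2.
Proof. by rewrite /nvars big_nseq iter_addn_0 mul2n. Qed.

Lemma shape_poly_pairs n (K : fieldType) m : shape_poly n K 0 (nseq m None) =
  \sum_(i < m) mpsX (inord i.*2) * mpsX (inord i.*2.+1).
Proof.
elim: m => [|m IH]; first by rewrite big_ord0.
rewrite (_ : nseq m.+1 None = nseq m None ++ [:: None] :> shape); last by rewrite -[[:: None]]/(nseq 1 None) -nseqD addn1.
by rewrite shape_poly_cat IH nvars_pairs add0n big_ord_recr [shape_poly _ _ _ [:: _]]/= addr0.
Qed.

Lemma nvars_A1 : nvars A1_shape = d.+1.
Proof.
rewrite nvars_cat nvars_pairs /nvars; case: ifP; rewrite ?big_nil ?big_seq1; lia.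
Qed.

Lemma nvars_A2 : nvars A2_shape = d.+1.
Proof.
rewrite nvars_cat nvars_pairs /nvars; case: ifP; rewrite ?big_cons ?big_nil; lia.
Qed.

Lemma A1_shape0 : Some 0%N \notin A1_shape.
Proof. by rewrite mem_cat mem_nseq andbF; case: ifP. Qed.

Lemma A2_shape0 : Some 0%N \notin A2_shape.
Proof. by rewrite mem_cat mem_nseq andbF; case: ifP. Qed.

Lemma Q_polyE p : Q_poly p d = shape_poly d 'F_p 0 A1_shape.
Proof.
rewrite shape_poly_cat shape_poly_pairs nvars_pairs; congr (_ + _).
case: ifP => // dd; rewrite [RHS]/= addr0; congr (mpsX (inord _) ^+ _); lia.
Qed.

Lemma P_polyE p : P_poly p d = shape_poly d 'F_p 0 A2_shape.
Proof.
rewrite /P_poly -addrA shape_poly_cat shape_poly_pairs nvars_pairs; congr (_ + _).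
case: ifP => dd; rewrite [RHS]/= addr0 ?add0r; last by congr (mpsX (inord _) ^+ _); lia.
by congr (mpsX (inord _) ^+ _ + mpsX (inord _) ^+ _); lia.
Qed.

End Shapes.

Lemma A1_nontrivial p d : (0 < d)%N -> Q_poly p d != 0 /\
  has_chain (@is_prime_ideal (A1_singularity p d)) d.
Proof.
move=> d0; have [sh shE] : exists sh, A1_shape d = None :: sh.
  by rewrite /A1_shape (_ : uphalf d = (uphalf d).-1.+1) /=; [eexists | lia].
have := nvars_A1 d; have := A1_shape0 d; rewrite shE inE /= => sh0.
rewrite /nvars big_cons => -[shn]; split.
  by rewrite Q_polyE shE; apply: pair_shape_neq0.
by apply: (pair_shape_krull (sh := sh)) => //; rewrite Q_polyE shE.
Qed.

(** The cusp [x_0^2 + x_1^3] has no term [xy]; it is parametrized by [t^3] and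
    [- t^2]. *)
Lemma cusp_nontrivial p : P_poly p 1 != 0 /\
  has_chain (@is_prime_ideal (A2_singularity p 1)) 1.
Proof.
have e0 : (inord 0 : 'I_2) = ord0 by apply: val_inj; rewrite /= inordK.
have e1 : (inord 1 : 'I_2) = ord_max by apply: val_inj; rewrite /= inordK.
have ev n' (z : 'I_2 -> mpseries n' 'F_p) : (forall i, ord_ge 1 (z i)) ->
    mps_eval z (P_poly p 1) = z ord0 ^+ 2 + z ord_max ^+ 3.
  move=> z1; rewrite P_polyE [shape_poly _ _ _ _]/= addr0.
  by rewrite mps_evalD // !mps_evalXn // !mps_evalX // e0 e1.
split.
  pose z (i : 'I_2) : mpseries 1 'F_p := if i == ord0 then mpsX ord0 else 0.
  have z1 i : ord_ge 1 (z i) by rewrite /z; case: ifP => // _; apply: ord_geX.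
  apply/eqP => /(congr1 (mps_eval z)); rewrite ev // mps_eval0 // /z /= expr0n addr0.
  rewrite -[_ ^+ 2]mulr1 => /mpsXn_eq0 /eqP; by rewrite oner_eq0.
pose t : mpseries 1 'F_p := mpsX ord0.
pose z (i : 'I_2) := if i == ord0 then t ^+ 3 else - t ^+ 2.
have t1 k : (0 < k)%N -> ord_ge 1 (t ^+ k).
  move=> k0; apply: (@ord_geW _ _ k); rewrite ?k0 //.
  by have := @ord_geXn _ _ 1 k _ (@ord_geX 1 'F_p ord0); rewrite muln1.
have z1 i : ord_ge 1 (z i) by rewrite /z; case: ifP => _; [|apply: ord_geN]; apply: t1.
apply: (@krull_ge_kill _ _ _ _ _ _ z (fun=> ord0) (fun=> mpsX ord_max)) => //.
  by rewrite ev // /z /=; ring.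
case=> // _; rewrite mps_evalX // /z /=; split.
  rewrite oppr_eq0 -[_ ^+ 2]mulr1; apply/eqP => /mpsXn_eq0 /eqP; by rewrite oner_eq0.
rewrite -[X in kill _ X]/(killed (fun=> ord0) 0 _) -[kill _ _]/(killed (fun=> ord0) 1 (- t ^+ 2)).
have tk : killed (fun=> ord0) 1 t = 0.
  by rewrite killedX ifT //; apply/existsP; exists ord0.
by rewrite -mulN1r killedM expr2 killedM tk !mulr0.
Qed.

Lemma A2_nontrivial p d : (0 < d)%N -> P_poly p d != 0 /\
  has_chain (@is_prime_ideal (A2_singularity p d)) d.
Proof.
case: (ltnP 1 d) => [d1 _|d1 d0]; last first.
  have -> : d = 1%N by lia.
  exact: cusp_nontrivial.
have [sh shE] : exists sh, A2_shape d = None :: sh.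
  by rewrite /A2_shape (_ : d./2 = d./2.-1.+1) /=; [eexists | lia].
have := nvars_A2 d; have := A2_shape0 d; rewrite shE inE /= => sh0.
rewrite /nvars big_cons => -[shn]; split.
  by rewrite P_polyE shE; apply: pair_shape_neq0.
by apply: (pair_shape_krull (sh := sh)) => //; rewrite P_polyE shE.
Qed.

Local Close Scope classical_set_scope.

(** * The multiplicities of the two singularities *)

Lemma A1_shape_odd k : A1_shape (2 * k).+1 = nseq k.+1 None.
Proof.
rewrite /A1_shape ifT; last by lia.
by rewrite cats0 (_ : uphalf _ = k.+1) //; lia.
Qed.

Lemma A1_shape_even k : A1_shape (2 * k) = nseq k None ++ [:: Some 2%N].
Proof.
rewrite /A1_shape ifF; last by lia.
by rewrite (_ : uphalf _ = k) //; lia.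
Qed.

Lemma A2_shape_odd k : A2_shape (2 * k).+1 = nseq k None ++ [:: Some 2%N; Some 3%N].
Proof.
rewrite /A2_shape ifT; last by lia.
by rewrite (_ : half _ = k) //; lia.
Qed.

Lemma A2_shape_even k : A2_shape (2 * k) = nseq k None ++ [:: Some 3%N].
Proof.
rewrite /A2_shape ifF; last by lia.
by rewrite (_ : half _ = k) //; lia.
Qed.

Section Multiplicities.
Variables (R : realType).

Lemma A1_multiplicity p d (a r : rat) (l : R) : prime p -> (0 < d)%N -> `|r| < 1 ->
    (forall e, hk_value 'F_p (p ^ e.+1) (A1_shape d) / (p ^ e.+1)%:R ^+ d =
       a + r * (hk_value 'F_p (p ^ e) (A1_shape d) / (p ^ e)%:R ^+ d)) ->
    l = ratr (a / (1 - r)) -> is_hilbert_kunz_multiplicity (A1_singularity p d) p l.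
Proof.
move=> pp d0 r1 rec ->; have [Q0 ch] := A1_nontrivial p d0.
by apply: (@hypersurface_hilbert_kunz _ _ _ (A1_shape d)) => //;
  [exact: Q_polyE | exact: nvars_A1 | exact: A1_shape0].
Qed.

Lemma A2_multiplicity p d (a r : rat) (l : R) : prime p -> (0 < d)%N -> `|r| < 1 ->
    (forall e, hk_value 'F_p (p ^ e.+1) (A2_shape d) / (p ^ e.+1)%:R ^+ d =
       a + r * (hk_value 'F_p (p ^ e) (A2_shape d) / (p ^ e)%:R ^+ d)) ->
    l = ratr (a / (1 - r)) -> is_hilbert_kunz_multiplicity (A2_singularity p d) p l.
Proof.
move=> pp d0 r1 rec ->; have [P0 ch] := A2_nontrivial p d0.
by apply: (@hypersurface_hilbert_kunz _ _ _ (A2_shape d)) => //;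
  [exact: P_polyE | exact: nvars_A2 | exact: A2_shape0].
Qed.

Let pow_gt1 k : 1 < 2 ^+ k.+1 :> rat.
Proof. by rewrite exprn_egt1 // ltr1n. Qed.

Let inv_pow_lt1 k : `|(2 ^+ k.+1)^-1| < 1 :> rat.
Proof. by rewrite normfV normrX normr_nat invf_lt1 ?exprn_gt0. Qed.

Let pow2_neq0 k : 2 ^+ k != 0 :> rat.
Proof. by rewrite expf_neq0. Qed.

Let geometric (a x : rat) : 1 < x -> a / (1 - x^-1) = a * x / (x - 1).
Proof.
move=> x1; have x0 : x != 0 by rewrite gt_eqF // (lt_trans _ x1).
have x10 : x - 1 != 0 by rewrite subr_eq0 gt_eqF.
by field; rewrite x0 x10.
Qed.

Let nat_pow_neq0 p e : (0 < p)%N -> (p ^ e)%:R != 0 :> rat.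
Proof. by move=> p0; rewrite pnatr_eq0 -lt0n expn_gt0 p0. Qed.

Let F2 : 2 \in [pchar 'F_2]. Proof. exact: pchar_Fp. Qed.
Let F3 : 3 \in [pchar 'F_3]. Proof. exact: pchar_Fp. Qed.

Lemma A1_two_odd k : is_hilbert_kunz_multiplicity (A1_singularity 2 (2 * k).+1) 2
  (2 ^+ k.+1 / (2 ^+ k.+1 - 1) : R).
Proof.
apply: (A1_multiplicity (a := 1) (r := (2 ^+ k.+1)^-1)) => // [e|].
  rewrite A1_shape_odd.
  rewrite hk_A1_odd // expnS natrM exprMn.
  have q0 := nat_pow_neq0 e (ltn0Sn 1).
  have -> : 2 ^+ (2 * k).+1 = 2 ^+ k * 2 ^+ k.+1 :> rat by rewrite -exprD; congr (_ ^+ _); lia.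
  by field; rewrite ?q0 ?expf_neq0.
by rewrite geometric // mul1r fmorph_div rmorphB rmorphXn rmorph1 /= ratr_nat.
Qed.

Lemma A1_two_even k : is_hilbert_kunz_multiplicity (A1_singularity 2 (2 * k.+1)) 2
  ((2 ^+ k.+1 + 1) / 2 ^+ k.+1 : R).
Proof.
apply: (A1_multiplicity (a := (2 ^+ k.+1 + 1) / 2 ^+ k.+1) (r := 0)) => [//|//||e|]; first by rewrite normr0.
  rewrite A1_shape_even.
  rewrite hk_A1_even // expnS natrM exprMn.
  have q0 := nat_pow_neq0 e (ltn0Sn 1).
  have -> : 2 ^+ (2 * k.+1) = 2 ^+ k.+1 * 2 ^+ k.+1 :> rat by rewrite -exprD addnn mul2n.
  by field; rewrite ?q0 ?expf_neq0.
by rewrite subr0 divr1 fmorph_div rmorphD rmorphXn rmorph1 /= ratr_nat.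
Qed.

Lemma A2_two_odd k : is_hilbert_kunz_multiplicity (A2_singularity 2 (2 * k).+1) 2
  ((2 ^+ k + 1) / 2 ^+ k : R).
Proof.
apply: (A2_multiplicity (a := (2 ^+ k + 1) / 2 ^+ k) (r := 0)) => [//|//||e|]; first by rewrite normr0.
  rewrite A2_shape_odd hk_A2_odd // expnS natrM !exprS !exprMn.
  have q0 := nat_pow_neq0 e (ltn0Sn 1).
  have -> : 2 ^+ (2 * k) = 2 ^+ k * 2 ^+ k :> rat by rewrite -exprD addnn mul2n.
  by field; rewrite ?q0 ?expf_neq0.
by rewrite subr0 divr1 fmorph_div rmorphD rmorphXn rmorph1 /= ratr_nat.
Qed.

Lemma A2_two_even k : is_hilbert_kunz_multiplicity (A2_singularity 2 (2 * k.+1)) 2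
  ((2 ^+ k.+2 + 1) / (2 ^+ k.+2 - 1) : R).
Proof.
apply: (A2_multiplicity (a := 1 + (2 ^+ k.+2)^-1) (r := (2 ^+ k.+2)^-1)) => // [e|].
  rewrite A2_shape_even hk_A2_even // expnS natrM exprMn.
  have q0 := nat_pow_neq0 e (ltn0Sn 1).
  have -> : 2 ^+ (2 * k.+1) = 2 ^+ k * 2 ^+ k.+2 :> rat by rewrite -exprD; congr (_ ^+ _); lia.
  by field; rewrite ?q0 ?expf_neq0.
rewrite geometric // (_ : (1 + (2 ^+ k.+2)^-1) * _ = 2 ^+ k.+2 + 1 :> rat); last by field; rewrite expf_neq0.
by rewrite fmorph_div rmorphD rmorphB rmorphXn rmorph1 /= ratr_nat.
Qed.

Lemma A1_shape_three d e : hk_value 'F_3 (3 ^ e) (A1_shape d) =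
  multisum (tblocksQ 'F_3) (nseq d.+1 (powsizes 2 (3 ^ e))) [::].
Proof.
rewrite hk_value_pairs multisum_pairs_squares //; congr multisum.
case: ifP => dd; rewrite [map _ _]/=; first by rewrite cats0; congr nseq; lia.
by rewrite -[[:: powsizes 2 _]]/(nseq 1 _) -nseqD; congr nseq; lia.
Qed.

Lemma A2_shape_three d e : hk_value 'F_3 (3 ^ e) (A2_shape d.+1) =
  multisum (tblocksQ 'F_3) (nseq d.+1 (powsizes 2 (3 ^ e)) ++ [:: powsizes 3 (3 ^ e)]) [::].
Proof.
rewrite hk_value_pairs multisum_pairs_squares //; congr multisum.
case: ifP => dd; rewrite [map _ _]/=.
  rewrite -cat1s catA -[[:: powsizes 2 _]]/(nseq 1 _) -nseqD; congr (nseq _ _ ++ _); lia.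
congr (nseq _ _ ++ _); lia.
Qed.

Lemma A1_three d : (0 < d)%N -> is_hilbert_kunz_multiplicity (A1_singularity 3 d) 3
  (1 + 3 * 2 ^+ d / (3 ^+ (d + 1) - 2 ^+ d + (-1) ^+ d) : R).
Proof.
move=> d0.
have j_lt : jacobsthal d < 3 ^+ d.
  rewrite /jacobsthal ltr_pdivrMr // -exprSr.
  have h2 : 2 ^+ d <= 3 ^+ d :> rat by rewrite lerXn2r ?nnegrE // ler_nat.
  have h3 : 1 <= 3 ^+ d :> rat by rewrite exprn_ege1 // ler1n.
  have h1 : -1 <= (-1) ^+ d :> rat by rewrite -signr_odd; case: odd; rewrite ?expr1 ?expr0 ?lexx ?lerN10 //; lra.
  by rewrite exprS; lra.
have j_ge0 : 0 <= jacobsthal d.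
  rewrite /jacobsthal divr_ge0 // subr_ge0 -signr_odd.
  have h2 : 1 <= 2 ^+ d :> rat by rewrite exprn_ege1 // ler1n.
  by case: odd; rewrite ?expr1 ?expr0; lra.
have p3 : 0 < 3 ^+ d :> rat by rewrite exprn_gt0.
apply: (A1_multiplicity (a := 1 + jacobsthal d.+1 / 3 ^+ d) (r := jacobsthal d / 3 ^+ d)) => [//|//||e|].
- rewrite ger0_norm; first by rewrite ltr_pdivrMr // mul1r.
  by rewrite divr_ge0 // ltW.
- rewrite !A1_shape_three hk_A1_three // expnS natrM exprMn.
  have q0 := nat_pow_neq0 e (ltn0Sn 2).
  by field; rewrite !expf_neq0 // gt_eqF.
have -> : (1 + jacobsthal d.+1 / 3 ^+ d) / (1 - jacobsthal d / 3 ^+ d) =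
    1 + 3 * 2 ^+ d / (3 ^+ (d + 1) - 2 ^+ d + (-1) ^+ d).
  have D0 : 3 ^+ d - jacobsthal d != 0 by rewrite subr_eq0 gt_eqF.
  have DE : 3 ^+ (d + 1) - 2 ^+ d + (-1) ^+ d = 3 * (3 ^+ d - jacobsthal d).
    by rewrite /jacobsthal addn1 exprS; field.
  have JE : jacobsthal d.+1 = 2 ^+ d - jacobsthal d by rewrite /jacobsthal !exprS; field.
  by rewrite DE JE; field; rewrite D0 gt_eqF.
by rewrite rmorphD rmorph1 fmorph_div !rmorphD rmorphM !rmorphN !rmorphXn rmorphN1 /= !ratr_nat.
Qed.

Lemma A2_three d : is_hilbert_kunz_multiplicity (A2_singularity 3 d.+1) 3
  (1 + (2 / 3) ^+ d : R).
Proof.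
apply: (A2_multiplicity (a := 1 + (2 / 3) ^+ d) (r := 0)) => [//|//||e|]; first by rewrite normr0.
  rewrite !A2_shape_three hk_A2_three // expnS natrM !exprMn exprVn !exprS.
  have q0 := nat_pow_neq0 e (ltn0Sn 2).
  by field; rewrite ?q0 ?expf_neq0.
by rewrite subr0 divr1 rmorphD rmorph1 rmorphXn fmorph_div /= !ratr_nat.
Qed.

End Multiplicities.

Theorem theorem2 (R : realType) (d m : nat) (d_ge1 : (1 <= d)%N)
    (m_ge1 : (1 <= m)%N) (dm : d = (2 * m - 1)%N \/ d = (2 * m)%N) :
  [/\ is_hilbert_kunz_multiplicity (A1_singularity 2 d) 2
        (if d == (2 * m - 1)%N then 2 ^+ m / (2 ^+ m - 1)
         else (2 ^+ m + 1) / 2 ^+ m : R),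
      is_hilbert_kunz_multiplicity (A2_singularity 2 d) 2
        (if d == (2 * m - 1)%N then (2 ^+ (m - 1) + 1) / 2 ^+ (m - 1)
         else (2 ^+ (m + 1) + 1) / (2 ^+ (m + 1) - 1) : R),
      is_hilbert_kunz_multiplicity (A1_singularity 3 d) 3
        (1 + 3 * 2 ^+ d / (3 ^+ (d + 1) - 2 ^+ d + (-1) ^+ d) : R)
    & is_hilbert_kunz_multiplicity (A2_singularity 3 d) 3
        (1 + (2 / 3) ^+ (d - 1) : R)].
Proof.
have three2 : is_hilbert_kunz_multiplicity (A2_singularity 3 d) 3 (1 + (2 / 3) ^+ (d - 1) : R).
  by case: d d_ge1 {dm} => // d' _; rewrite subn1; apply: A2_three.
case: m m_ge1 dm => // k _ [dE|dE]; (split=> //; last exact: A1_three).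
- have -> : d = (2 * k).+1 by lia.
  by rewrite ifT; [exact: A1_two_odd | lia].
- have -> : d = (2 * k).+1 by lia.
  by rewrite ifT; [rewrite subn1; exact: A2_two_odd | lia].
- by rewrite dE ifF; [exact: A1_two_even | lia].
- by rewrite dE ifF; [rewrite addn1; exact: A2_two_even | lia].
Qed.
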